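(* Let $A\subset\mathbb{C}$ be a locally finite subset and let $f:\mathbb{C}\setminus A\to\mathbb{C}$ be an analytic function. Assume that for some real numbers $a<b$ we have $A\cap(a,b)=\varnothing$, $f\in L^\infty((a,b))$ and $f(x)\neq 0$ for all $x\in(a,b)$, and that there exists $t\in\mathbb{R}$ such that on the horizontal line $\{z\in\mathbb{C}:\operatorname{Im} z=t\}$ there is exactly one essential singularity of $f$. Put $g(x)=f(x)\chi_{(a,b)}(x)$ for $x\in\mathbb{R}$ (so $g=f$ on $(a,b)$ and $g=0$ on $\mathbb{R}\setminus(a,b)$). Then for all $\alpha,\beta>0$ such that $\alpha<b-a$, $\alpha\beta<1$ and $\alpha\beta\notin\mathbb{Q}$, the Gabor system $\mathcal{G}(g;\alpha,\beta)$ is a frame.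
   Context: For $g\in L^2(\mathbb{R})$ and $\alpha,\beta>0$, the Gabor system is $\mathcal{G}(g;\alpha,\beta)=\{g_{m,n}\}_{m,n\in\mathbb{Z}}$, where $g_{m,n}(x)=e^{2\pi i\beta m x}g(x-\alpha n)$. It is called a frame if there are constants $A_0,B_0>0$ such that for all $h\in L^2(\mathbb{R})$ $$A_0\|h\|_2^2\le\sum_{m,n\in\mathbb{Z}}|(h,g_{m,n})|^2\le B_0\|h\|_2^2,$$ where $(\cdot,\cdot)$ is the inner product of $L^2(\mathbb{R})$. A subset of $\mathbb{C}$ is locally finite if its intersection with every bounded set is finite. *)

(* Defs.v *)
From HB Require Import structures.
From mathcomp Require Import all_boot all_order all_algebra.
From mathcomp Require Import all_classical all_reals all_analysis.
From mathcomp Require Import complex.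
Set Implicit Arguments.
Unset Strict Implicit.
Unset Printing Implicit Defensive.
Import Order.TTheory GRing.Theory Num.Theory.
Import numFieldNormedType.Exports.
Import Normc.

Local Open Scope classical_set_scope.
Local Open Scope ring_scope.
Local Open Scope complex_scope.

Section ComplexAnalysis.
Context {R : realType}.
(* [^o] gives access to the topology that [R[i]] carries as a normed module
   over itself. *)
Let C := (R[i])^o.

Definition locally_finite (A : set C) :=
  forall B : set C, bounded_set B -> finite_set (A `&` B).

(* Analytic functions on an open subset of the plane are total functions; their
   values outside of the subset are irrelevant because [analytic_at f z0] only
   depends on [f] in a neighbourhood of [z0]. *)
Definition analytic_at (f : C -> C) (z0 : C) :=
  exists c : nat -> C,
    \forall z \near z0, series (fun n => c n * (z - z0) ^+ n) @ \oo --> f z.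

(* The following notions only depend on [f] in a punctured neighbourhood of
   [z0]. *)
Definition isolated_singularity (f : C -> C) (z0 : C) :=
  \forall z \near z0^', analytic_at f z.

Definition removable (f : C -> C) (z0 : C) :=
  exists2 h : C -> C, analytic_at h z0 & \forall z \near z0^', f z = h z.

Definition pole (f : C -> C) (z0 : C) :=
  exists (n : nat) (h : C -> C),
    [/\ (0 < n)%N, analytic_at h z0, h z0 != 0 &
        \forall z \near z0^', f z = h z / (z - z0) ^+ n].

Definition essential_singularity (f : C -> C) (z0 : C) :=
  [/\ isolated_singularity f z0, ~ removable f z0 & ~ pole f z0].

End ComplexAnalysis.

Section Gabor.
Context {R : realType}.
Implicit Types (f g h k : R -> R[i]) (alpha beta : R).
Let mu := @lebesgue_measure R.

Definition cmeasurable_fun (D : set R) f :=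
  measurable_fun D (fun x => complex.Re (f x)) /\
  measurable_fun D (fun x => complex.Im (f x)).

Definition Linfty_on (D : set R) f :=
  cmeasurable_fun D f /\
  exists M : R, {ae mu, forall x, D x -> normc (f x) <= M}.

Definition norm2sq h : \bar R := (\int[mu]_x (normc (h x) ^+ 2)%:E)%E.

Definition L2 h := cmeasurable_fun setT h /\ (norm2sq h < +oo)%E.

Definition inner h k : R[i] :=
  (\int[mu]_x complex.Re (h x * conjc (k x))) +i*
  (\int[mu]_x complex.Im (h x * conjc (k x))).

Definition expi (theta : R) : R[i] := cos theta +i* sin theta.

Definition gabor_elt g alpha beta (m n : int) : R -> R[i] :=
  fun x => expi (2 * pi * beta * m%:~R * x) * g (x - alpha * n%:~R).

Definition gabor_frame g alpha beta :=
  L2 g /\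
  exists A0 B0 : R, [/\ 0 < A0, 0 < B0 &
    forall h, L2 h ->
      let S := (\esum_(mn in [set: int * int])
        (normc (inner h (gabor_elt g alpha beta mn.1 mn.2)) ^+ 2)%:E)%E in
      (A0%:E * norm2sq h <= S)%E /\ (S <= B0%:E * norm2sq h)%E].

End Gabor.

(* Main.v *)
(* Put gamma = 1/beta. For fixed n, the numbers (h, g_{m,n}) are the Fourier
   coefficients of the gamma-periodization of h times the conjugate of g(. - alpha n),
   so by Parseval the frame sum is gamma times the sum over n of the integral over a
   period of |sum_k h(x + k gamma) conj g(x + k gamma - alpha n)|^2. The upper bound
   follows because g is bounded with bounded support.

   For the lower bound these sums are read as linear equations for the values of h on
   x + gamma Z. Because alpha < gamma, one can choose as many equations as they have
   unknowns, so that the matrix of entries g(x + k gamma - alpha n) has nonzero diagonal.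
   Its entries are zeros and translates of f by pairwise distinct real shifts (alpha and
   gamma are incommensurable), and its determinant is not identically zero: f has one
   essential singularity z0 on a horizontal line, so at z0 minus the shift of a diagonal entry
   that entry alone is not meromorphic, hence its cofactor, a smaller determinant of
   the same kind, would vanish too. So on some interval of x the values of h at
   sufficiently many consecutive points of x + gamma Z are bounded by the data. One
   further equation, in which the next unknown meets g away from the ends of (a, b),
   extends the control by one step of gamma; translating by alpha Z and using the
   density of alpha Z + gamma Z gives, after boundedly many steps, a uniform local
   bound for |h(x)| at every x, which is then squared and integrated. *)

(* All shifts are real, so at the point chosen in the determinant argument every other entry is [f]
   near another point of the line through z0; this is where the uniqueness of the essential
   singularity on its line is used. That point is usually not real, whereas the determinant is only
   assumed to vanish along a real interval. The identity theorem, across the locally finite set of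
   singularities, carries the vanishing from one place to the other. Each propagation step enlarges
   the constants, so the number of steps has to be bounded independently of [x]. Density therefore
   enters in quantitative form: every point returns to the good interval, modulo alpha Z, after at
   most a fixed number of steps. The local bounds are stated pointwise, with a bound [eps] on
   finitely many rows. Taking for [eps] the square root of the sum of the squares of these rows
   makes the passage to integrals cost only the number of rows. Analyticity means having a local
   power series, so products, inverses, zeros and the identity theorem are all obtained from bounds
   on coefficients and partial sums. *)
Require Import Defs.
From HB Require Import structures.
From mathcomp Require Import all_boot all_order all_algebra.
From mathcomp Require Import finmap all_classical all_reals all_analysis.
From mathcomp Require Import measurable_realfun complex ring lra zify.
Set Implicit Arguments.
Unset Strict Implicit.
Unset Printing Implicit Defensive.
Import Order.TTheory GRing.Theory Num.Theory.
Import numFieldNormedType.Exports.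
Local Open Scope classical_set_scope.
Local Open Scope ring_scope.
Local Open Scope complex_scope.

Local Notation normc := Normc.normc.

(** * The complex modulus *)

Section Normc.
Context {R : realType}.
Implicit Types z w : R[i].

Lemma normc_ge0 z : 0 <= normc z.
Proof. by case: z => x y; rewrite sqrtr_ge0. Qed.

Lemma normc_eq0 z : (normc z == 0) = (z == 0).
Proof.
apply/eqP/eqP => [/Normc.eq0_normc //|->]; exact: Normc.normc0.
Qed.

Lemma normc_gt0 z : (0 < normc z) = (z != 0).
Proof. by rewrite lt_neqAle normc_ge0 andbT eq_sym normc_eq0. Qed.

Lemma ler_normcD z w : normc (z + w) <= normc z + normc w.
Proof. exact: le_normcD. Qed.

Lemma normcNE z : normc (- z) = normc z.
Proof. exact: normcN. Qed.

Lemma normcB z w : normc (z - w) = normc (w - z).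
Proof. by rewrite -normcNE opprB. Qed.

Lemma le_normcB z w : normc (z - w) <= normc z + normc w.
Proof. by rewrite -(normcNE w) ler_normcD. Qed.

Lemma ler_normc_sub z w : normc z - normc w <= normc (z - w).
Proof. by rewrite lerBlDr -[X in normc X <= _](subrK w) ler_normcD. Qed.

Lemma normcX z n : normc (z ^+ n) = normc z ^+ n.
Proof.
elim: n => [|n IH]; first by rewrite !expr0; exact: Normc.normc1.
by rewrite !exprS Normc.normcM IH.
Qed.

Lemma normc_real (x : R) : normc x%:C = `|x|.
Proof. by rewrite /= expr0n/= addr0 sqrtr_sqr. Qed.

Lemma normc_sum (I : Type) (s : seq I) (P : pred I) (F : I -> R[i]) :
  normc (\sum_(i <- s | P i) F i) <= \sum_(i <- s | P i) normc (F i).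
Proof.
elim/big_ind2 : _ => //; first by rewrite Normc.normc0.
by move=> x1 x2 y1 y2 h1 h2; apply: (le_trans (ler_normcD _ _)); exact: lerD.
Qed.

Lemma normc_prod (I : Type) (s : seq I) (P : pred I) (F : I -> R[i]) :
  normc (\prod_(i <- s | P i) F i) = \prod_(i <- s | P i) normc (F i).
Proof.
elim/big_ind2 : _ => //; first exact: Normc.normc1.
by move=> x1 x2 y1 y2 <- <-; rewrite Normc.normcM.
Qed.

Lemma normc_sqr z : normc z ^+ 2 = complex.Re z ^+ 2 + complex.Im z ^+ 2.
Proof. by case: z => x y /=; rewrite sqr_sqrtr// addr_ge0// sqr_ge0. Qed.

Lemma normc_conj z : normc z^*%C = normc z.
Proof. by case: z => x y /=; rewrite sqrrN. Qed.

Lemma normC_normc z : `|z| = (normc z)%:C.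
Proof. by rewrite normc_def; case: z. Qed.

End Normc.

Section NearC.
Context {R : realType}.
Let C := (R[i])^o.
Implicit Types (z : R[i]) (P : set R[i]).

Lemma gt0_normcE (e : R[i]) : 0 < e -> e = (complex.Re e)%:C /\ 0 < complex.Re e.
Proof.
rewrite ltcE => /andP[/eqP ie re]; split => //.
by case: e ie re => x y /= ->.
Qed.

Lemma near_normcP z0 P : (\forall z \near (z0 : C), P z) <->
  exists2 e : R, 0 < e & forall z, normc (z - z0) < e -> P z.
Proof.
split.
  move=> /nbhs_ballP[e /= e0 eP].
  have [ee re] := gt0_normcE e0.
  exists (complex.Re e) => // z ze; apply: eP.
  by rewrite /ball /= ee normC_normc ltcR normcB.
move=> [e e0 eP]; apply/nbhs_ballP; exists e%:C => /=; first by rewrite ltcR.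
by move=> z; rewrite /ball /= normC_normc ltcR normcB => /eP.
Qed.

Lemma near_dnormcP z0 P : (\forall z \near (z0 : C)^', P z) <->
  exists2 e : R, 0 < e & forall z, normc (z - z0) < e -> z != z0 -> P z.
Proof.
exact: (near_normcP z0 (fun z => z != z0 -> P z)).
Qed.

Lemma cvg_normcP (u : nat -> C) (l : C) : (u @ \oo --> l) <->
  forall e : R, 0 < e -> exists N, forall n, (N <= n)%N -> normc (u n - l) < e.
Proof.
split.
  move=> ul e e0.
  have e0' : (0 : C) < e%:C by rewrite ltcR.
  have /cvgrPdist_lt/(_ _ e0')[N _ NP] := ul.
  exists N => n Nn; have := NP n Nn.
  by rewrite /= normC_normc ltcR normcB.
move=> H; apply/cvgrPdist_lt => e /gt0_normcE[-> e0].
have [N NP] := H _ e0; exists N => // n /= /NP.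
by rewrite normC_normc ltcR normcB.
Qed.

End NearC.

(** * Power series and analytic functions *)

Section PowerSeries.
Context {R : realType}.
Let C := (R[i])^o.
Implicit Types (c d : nat -> R[i]) (u z w : R[i]) (f g h : R[i] -> R[i]).

Definition psum c n u := \sum_(i < n) c i * u ^+ i.

Lemma psumS c n u : psum c n.+1 u = psum c n u + c n * u ^+ n.
Proof. by rewrite /psum big_ord_recr. Qed.

Lemma psum_tail c u (M : R) :
  (forall i, normc (c i * u ^+ i) <= M / 8 ^+ i) ->
  forall m k, normc (psum c (m + k) u - psum c m u) <= k%:R * (M / 8 ^+ m).
Proof.
move=> cM m; have M0 : 0 <= M.
  by have := cM 0%N; rewrite expr0 divr1; exact: le_trans (normc_ge0 _).
elim=> [|k IH]; first by rewrite addn0 subrr Normc.normc0 mul0r.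
rewrite addnS psumS addrAC (le_trans (ler_normcD _ _))//.
rewrite -natr1 mulrDl mul1r lerD// (le_trans (cM _))//.
by rewrite ler_wpM2l// lef_pV2 ?posrE ?exprn_gt0// ler_weXn2l ?leq_addr// ler1n.
Qed.

Lemma psum_bound c u (M : R) n :
  (forall i, normc (c i * u ^+ i) <= M / 8 ^+ i) -> normc (psum c n u) <= 2 * M.
Proof.
move=> cM; have M0 : 0 <= M.
  by have := cM 0%N; rewrite expr0 divr1; exact: le_trans (normc_ge0 _).
have : normc (psum c n u) <= 2 * M - 2 * M / 8 ^+ n.
  elim: n => [|n IH]; first by rewrite /psum big_ord0 Normc.normc0 expr0 divr1 subrr.
  rewrite psumS (le_trans (ler_normcD _ _))//.
  apply: (le_trans (lerD IH (cM n))).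
  have h : 0 <= M / 8 ^+ n by rewrite divr_ge0// exprn_ge0.
  have e : 2 * M / 8 ^+ n.+1 = 2 * (M / 8 ^+ n) / 8.
    by rewrite exprS invfM; field; rewrite expf_neq0.
  rewrite e -mulrA; set y := M / 8 ^+ n in h *; lra.
move/le_trans; apply; rewrite gerBl divr_ge0// ?mulr_ge0// exprn_ge0//.
Qed.

Definition cauchy_prod c d n := \sum_(i < n.+1) c i * d (n - i)%N.

Lemma psum_cauchy_prod c d n u :
  psum (cauchy_prod c d) n u = \sum_(i < n) c i * u ^+ i * psum d (n - i) u.
Proof.
elim: n => [|n IH]; first by rewrite /psum !big_ord0.
rewrite psumS IH big_ord_recr /= subSn// subnn.
have -> : \sum_(i < n) c i * u ^+ i * psum d (n.+1 - i) u =
   \sum_(i < n) (c i * u ^+ i * psum d (n - i) u + c i * d (n - i)%N * u ^+ n).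
  apply: eq_bigr => i _; rewrite subSn ?psumS; last exact: ltnW.
  rewrite mulrDr; congr +%R.
  have -> : u ^+ n = u ^+ i * u ^+ (n - i) by rewrite -exprD subnKC// ltnW.
  ring.
rewrite big_split /= -addrA; congr +%R.
rewrite /cauchy_prod big_ord_recr /= subnn mulrDl mulr_suml; congr +%R.
by rewrite /psum big_ord1 expr0; ring.
Qed.

(** The error splits into [n] tails of at most [n] terms, each at most M M' / 8^n. Since n <= 2^n,
    the factor n^2 consumes two of the three factors 2^n of 8^n; hence the rate 8 for terms and 2
    for errors. *)
Lemma cauchy_prod_tail c d u (M M' : R) :
  (forall i, normc (c i * u ^+ i) <= M / 8 ^+ i) ->
  (forall i, normc (d i * u ^+ i) <= M' / 8 ^+ i) ->
  forall n, normc (psum c n u * psum d n u - psum (cauchy_prod c d) n u)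
     <= M * M' / 2 ^+ n.
Proof.
move=> cM dM n.
have M0 : 0 <= M.
  by have := cM 0%N; rewrite expr0 divr1; exact: le_trans (normc_ge0 _).
have M'0 : 0 <= M'.
  by have := dM 0%N; rewrite expr0 divr1; exact: le_trans (normc_ge0 _).
rewrite psum_cauchy_prod {1}/psum mulr_suml -sumrB.
apply: (le_trans (normc_sum _ _ _)).
have le1 (i : 'I_n) : normc (c i * u ^+ i * psum d n u - c i * u ^+ i * psum d (n - i) u)
    <= n%:R * (M * M' / 8 ^+ n).
  rewrite -mulrBr Normc.normcM.
  have := psum_tail dM (n - i) i; rewrite subnK; last exact: ltnW.
  move=> h; apply: (le_trans (ler_pM (normc_ge0 _) (normc_ge0 _) (cM i) h)).
  have -> : M / 8 ^+ i * (i%:R * (M' / 8 ^+ (n - i))) = i%:R * (M * M' / 8 ^+ n).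
    have -> : (8 : R) ^+ n = 8 ^+ i * 8 ^+ (n - i) by rewrite -exprD subnKC// ltnW.
    by field; rewrite !expf_neq0.
  rewrite ler_wpM2r// ?ler_nat ?(ltnW (ltn_ord _))//.
  by rewrite divr_ge0 ?mulr_ge0 ?exprn_ge0.
apply: (le_trans (ler_sum _ (fun i _ => le1 i))).
rewrite sumr_const card_ord -[X in X <= _]mulr_natl.
have e8 : (8 : R) ^+ n = 2 ^+ n * 2 ^+ n * 2 ^+ n.
  by rewrite -!exprMn; congr (_ ^+ _); ring.
have n2 : n%:R <= (2 : R) ^+ n.
  by rewrite -natrX ler_nat ltnW// ltn_expl.
have p2 : 0 < (2 : R) ^+ n by rewrite exprn_gt0.
have -> : n%:R * (n%:R * (M * M' / 8 ^+ n)) =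
   (n%:R / 2 ^+ n) * (n%:R / 2 ^+ n) * (M * M' / 2 ^+ n).
  by rewrite e8; field; rewrite lt0r_neq0.
rewrite ler_piMl ?divr_ge0 ?mulr_ge0 ?(ltW p2)//.
by rewrite mulr_ile1 ?divr_ge0 ?(ltW p2)// ler_pdivrMr// mul1r.
Qed.

(* The geometric rates replace radii of convergence: power series are then added,
   multiplied and inverted without summing any infinite series. *)
Definition fast_analytic f z0 := exists c (r M : R), [/\ 0 < r,
  forall n, normc (c n) * r ^+ n <= M / 8 ^+ n &
  forall z, normc (z - z0) < r -> forall n,
    normc (f z - psum c n (z - z0)) <= M * (normc (z - z0) / r) ^+ n / 2 ^+ n].

Lemma cvg_bounded (v : nat -> R[i]) (l : R[i]) : (v : nat -> C) @ \oo --> (l : C) ->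
  exists M, forall n, normc (v n) <= M.
Proof.
move=> /cvg_normcP/(_ 1 ltr01)[N NP].
exists (\sum_(i < N) normc (v i) + (1 + normc l)) => n.
have s0 : 0 <= \sum_(i < N) normc (v i) by apply: sumr_ge0 => i _; exact: normc_ge0.
have [nN|Nn] := ltnP n N.
  rewrite (bigD1 (Ordinal nN))//= -!addrA lerDl addr_ge0//.
    by apply: sumr_ge0 => i _; exact: normc_ge0.
  by rewrite addr_ge0// normc_ge0.
rewrite -[v n](subrK l) (le_trans (ler_normcD _ _))//.
have := NP _ Nn; lra.
Qed.

(** Convergence at the single point [z0 + r / 2] bounds the terms there; on the disc of radius
    [r / 16], eight times smaller, they decay like 8^-n, with an extra power of the relative
    distance [q] to the centre. *)
Lemma analytic_at_fast f z0 : analytic_at f z0 -> fast_analytic f z0.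
Proof.
move=> [c /near_normcP[r r0 rP]].
have [M cM] : exists M, forall n, normc (c n) * (r / 2) ^+ n <= M.
  have h : normc ((r / 2)%:C + z0 - z0) < r.
    by rewrite addrK normc_real ger0_norm; lra.
  have /cvg_bounded[M MP] := rP _ h.
  exists (M + M) => n.
  have : normc (series (fun n => c n * ((r / 2)%:C + z0 - z0) ^+ n) n.+1 -
       series (fun n => c n * ((r / 2)%:C + z0 - z0) ^+ n) n) <= M + M.
    by rewrite (le_trans (le_normcB _ _))// lerD.
  rewrite seriesSB addrK Normc.normcM normcX normc_real ger0_norm//; lra.
have M0 : 0 <= M.
  by have := cM 0%N; rewrite expr0 mulr1; exact: le_trans (normc_ge0 _).
have r16 : 0 < r / 16 by lra.
have cb n : normc (c n) * (r / 16) ^+ n <= M / 8 ^+ n.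
  rewrite ler_pdivlMr ?exprn_gt0// -mulrA -exprMn (_ : r / 16 * 8 = r / 2)//.
  by field.
exists c, (r / 16), (2 * M); split => //.
  move=> n; rewrite (le_trans (cb n))// ler_wpM2r ?invr_ge0 ?exprn_ge0//; lra.
move=> z zr n; set q := normc (z - z0) / (r / 16).
have q0 : 0 <= q by rewrite divr_ge0 ?normc_ge0// ltW.
have q1 : q <= 1 by rewrite ler_pdivrMr// mul1r ltW.
have tb i : normc (c i * (z - z0) ^+ i) <= M * q ^+ i / 8 ^+ i.
  rewrite Normc.normcM normcX.
  have -> : normc (z - z0) = r / 16 * q by rewrite /q mulrC divfK// lt0r_neq0.
  rewrite exprMn mulrA [X in _ <= X]mulrAC; apply: ler_wpM2r (cb i).
  by rewrite exprn_ge0.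
have tail k : normc (psum c (n + k) (z - z0) - psum c n (z - z0)) <=
   2 * M * q ^+ n / 2 ^+ n - 2 * M * q ^+ n / 2 ^+ (n + k).
  elim: k => [|k IH]; first by rewrite addn0 !subrr Normc.normc0.
  rewrite addnS psumS addrAC (le_trans (ler_normcD _ _))//.
  apply: (le_trans (lerD IH (tb _))).
  have -> : 2 * M * q ^+ n / 2 ^+ (n + k).+1 = M * q ^+ n / 2 ^+ (n + k).
    by rewrite exprS; field; rewrite expf_neq0.
  have : M * q ^+ (n + k) / 8 ^+ (n + k) <= M * q ^+ n / 2 ^+ (n + k).
    rewrite ler_pM ?invr_ge0 ?exprn_ge0 ?mulr_ge0 ?exprn_ge0//.
      by rewrite ler_wpM2l// exprD ler_piMr ?exprn_ge0// exprn_ile1.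
    rewrite lef_pV2 ?posrE ?exprn_gt0// lerXn2r ?nnegrE//; lra.
  have e (x y : R) : 2 * M * x / y = 2 * (M * x / y) by rewrite !mulrA.
  rewrite !e; lra.
have zr' : normc (z - z0) < r by lra.
have /cvg_normcP H := rP _ zr'.
apply/ler_addgt0Pr => e e0.
have [N NP] := H _ e0.
have := NP (n + N)%N (leq_addl _ _).
rewrite /series /= big_mkord -/(psum c (n + N) (z - z0)) normcB => h1.
have h2 := tail N.
rewrite -[f z - _](subrKA (psum c (n + N) (z - z0))).
apply: (le_trans (ler_normcD _ _)).
have : 0 <= 2 * M * q ^+ n / 2 ^+ (n + N).
  by rewrite ?mulr_ge0 ?invr_ge0 ?exprn_ge0.
lra.
Qed.

Lemma geo2_small (K e : R) : 0 < e -> exists N, forall n, (N <= n)%N -> K / 2 ^+ n < e.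
Proof.
move=> e0; exists (Num.truncn (`|K| / e)).+1 => n nN.
have p2 : 0 < (2 : R) ^+ n by rewrite exprn_gt0.
rewrite ltr_pdivrMr// (le_lt_trans (ler_norm K))// -ltr_pdivrMl// mulrC.
rewrite (lt_le_trans (real_truncnS_gt (num_real _)))//.
by rewrite -natrX ler_nat (leq_trans nN)// ltnW// ltn_expl.
Qed.

(** The constant [K] may depend on [z]: products and inverses produce constants that contain the
    values of the functions at [z]. *)
Lemma analytic_at_intro f z0 c (r : R) : 0 < r ->
  (forall z, normc (z - z0) < r -> exists K : R, forall n,
     normc (f z - psum c n (z - z0)) <= K / 2 ^+ n) -> analytic_at f z0.
Proof.
move=> r0 H; exists c; apply/near_normcP; exists r => // z /H[K KP].
apply/cvg_normcP => e /(geo2_small K)[N NP]; exists N => n /NP h.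
by rewrite /series /= big_mkord normcB; apply: le_lt_trans (KP n) h.
Qed.

Lemma analytic_at_cst (a : R[i]) z0 : analytic_at (fun=> a) z0.
Proof.
apply: (@analytic_at_intro _ _ (fun n => if n is 0%N then a else 0) 1) => // z _.
exists (normc a) => -[|n].
  by rewrite /psum big_ord0 subr0 expr0 divr1.
rewrite /psum big_ord_recl /= big1 => [|i _]; last by rewrite mul0r.
by rewrite expr0 mulr1 addr0 subrr Normc.normc0 divr_ge0 ?normc_ge0 ?exprn_ge0.
Qed.

Lemma analytic_at_X z0 : analytic_at id z0.
Proof.
apply: (@analytic_at_intro _ _ (fun n => if n is 0%N then z0 else (n == 1%N)%:R) 1) => // z z1.
exists (2 * (1 + normc z0)) => -[|[|n]].
- rewrite /psum big_ord0 subr0 expr0 divr1.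
  have := ler_normcD (z - z0) z0; rewrite subrK.
  have := normc_ge0 z0; lra.
- rewrite /psum big_ord1 expr0 mulr1 expr1 mulrC mulKf//.
  have := normc_ge0 z0; lra.
rewrite /psum !big_ord_recl /= big1 => [|i _]; last by rewrite mul0r.
rewrite expr0 expr1 mulr1 mul1r addr0 [z0 + _]addrC subrK subrr Normc.normc0.
have := normc_ge0 z0 => h; rewrite mulr_ge0 ?invr_ge0 ?exprn_ge0 //; lra.
Qed.

Lemma analytic_at_translate f z0 s : analytic_at f (z0 + s) ->
  analytic_at (fun z => f (z + s)) z0.
Proof.
move=> [c /near_normcP[r r0 rP]]; exists c; apply/near_normcP; exists r => // z zr.
have e : z + s - (z0 + s) = z - z0 by ring.
by have := rP (z + s); rewrite e; apply.
Qed.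

Lemma fast_coef_le c (r M : R) (n : nat) u :
   (forall n, normc (c n) * r ^+ n <= M / 8 ^+ n) -> normc u <= r ->
   normc (c n * u ^+ n) <= M / 8 ^+ n.
Proof.
move=> cM ur; rewrite Normc.normcM normcX (le_trans _ (cM n))//.
rewrite ler_wpM2l ?normc_ge0// lerXn2r// nnegrE ?normc_ge0//.
exact: le_trans (normc_ge0 _) ur.
Qed.

Lemma fast_rate f c z z0 (r M : R) n : 0 < r -> 0 <= M -> normc (z - z0) < r ->
  normc (f z - psum c n (z - z0)) <= M * (normc (z - z0) / r) ^+ n / 2 ^+ n ->
  normc (f z - psum c n (z - z0)) <= M / 2 ^+ n.
Proof.
move=> r0 M0 zr /le_trans; apply; rewrite ler_wpM2r ?invr_ge0 ?exprn_ge0//.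
rewrite ler_piMr// exprn_ile1// ?divr_ge0 ?normc_ge0 ?(ltW r0)//.
by rewrite ler_pdivrMr// mul1r ltW.
Qed.

Lemma coef_bound_ge0 c (r M : R) :
  (forall n, normc (c n) * r ^+ n <= M / 8 ^+ n) -> 0 <= M.
Proof.
by move/(_ 0%N); rewrite !expr0 divr1 mulr1; exact: le_trans (normc_ge0 _).
Qed.

Lemma analytic_atD f g z0 : analytic_at f z0 -> analytic_at g z0 ->
  analytic_at (fun z => f z + g z) z0.
Proof.
move=> /analytic_at_fast[c [r [M [r0 cM fM]]]] /analytic_at_fast[d [s [M' [s0 dM gM]]]].
have M0 := coef_bound_ge0 cM; have M'0 := coef_bound_ge0 dM.
apply: (@analytic_at_intro _ _ (fun n => c n + d n) (Num.min r s)).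
  by rewrite lt_min r0.
move=> z; rewrite lt_min => /andP[zr zs]; exists (M + M') => n.
have -> : psum (fun n => c n + d n) n (z - z0) = psum c n (z - z0) + psum d n (z - z0).
  by rewrite /psum -big_split; apply: eq_bigr => i _; rewrite mulrDl.
rewrite opprD addrACA (le_trans (ler_normcD _ _))// mulrDl lerD//.
  exact: fast_rate (fM z zr n).
exact: fast_rate (gM z zs n).
Qed.

Lemma analytic_atM f g z0 : analytic_at f z0 -> analytic_at g z0 ->
  analytic_at (fun z => f z * g z) z0.
Proof.
move=> /analytic_at_fast[c [r [M [r0 cM fM]]]] /analytic_at_fast[d [s [M' [s0 dM gM]]]].
have M0 := coef_bound_ge0 cM; have M'0 := coef_bound_ge0 dM.
apply: (@analytic_at_intro _ _ (cauchy_prod c d) (Num.min r s)).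
  by rewrite lt_min r0.
move=> z; rewrite lt_min => /andP[zr zs].
exists (M * M' + (normc (f z) * M' + M * (2 * M'))) => n.
set u := z - z0.
have cu i : normc (c i * u ^+ i) <= M / 8 ^+ i by apply: fast_coef_le cM (ltW zr).
have du i : normc (d i * u ^+ i) <= M' / 8 ^+ i by apply: fast_coef_le dM (ltW zs).
have h1 := cauchy_prod_tail cu du n.
have h2 := fast_rate r0 M0 zr (fM z zr n).
have h3 := fast_rate s0 M'0 zs (gM z zs n).
have h4 := psum_bound n du.
have -> : f z * g z - psum (cauchy_prod c d) n u =
  (psum c n u * psum d n u - psum (cauchy_prod c d) n u) +
  (f z * (g z - psum d n u) + (f z - psum c n u) * psum d n u) by ring.
rewrite (le_trans (ler_normcD _ _))// [X in _ <= X]mulrDl lerD//.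
rewrite (le_trans (ler_normcD _ _))// [X in _ <= X]mulrDl lerD// Normc.normcM.
  by rewrite -mulrA ler_wpM2l ?normc_ge0.
by rewrite mulrAC ler_pM ?normc_ge0.
Qed.

Lemma analytic_at_lip f z0 : analytic_at f z0 -> exists2 r : R, 0 < r &
  exists K : R, forall z, normc (z - z0) < r -> normc (f z - f z0) <= K * normc (z - z0).
Proof.
move=> /analytic_at_fast[c [r [M [r0 cM fM]]]]; exists r => //; exists (M / r / 2) => z zr.
(* At [z0] the error bound for n = 1 contains the factor 0, so it is an equality. *)
have f0 : f z0 = c 0%N.
  have := fM z0; rewrite subrr Normc.normc0 => /(_ r0 1%N).
  rewrite mul0r expr1 mulr0 mul0r /psum big_ord1 expr0 mulr1 => h.
  apply/eqP; rewrite -subr_eq0 -normc_eq0 eq_le h; exact: normc_ge0.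
have := fM z zr 1%N; rewrite /psum big_ord1 !expr1 expr0 mulr1 -f0 => /le_trans; apply.
by rewrite le_eqVlt; apply/orP; left; apply/eqP; field; rewrite lt0r_neq0.
Qed.

Lemma analytic_at_cont f z0 (e : R) : analytic_at f z0 -> 0 < e ->
  exists2 r : R, 0 < r & forall z, normc (z - z0) < r -> normc (f z - f z0) < e.
Proof.
move=> /analytic_at_lip[r r0 [K KP]] e0.
have K1 : 0 < `|K| + 1 by rewrite ltr_pwDr.
exists (Num.min r (e / (`|K| + 1))); first by rewrite lt_min r0 divr_gt0.
move=> z; rewrite lt_min => /andP[zr]; rewrite ltr_pdivlMr// mulrC.
apply: le_lt_trans; rewrite (le_trans (KP _ zr))// ler_wpM2r ?normc_ge0//.
rewrite (le_trans (ler_norm K))//; lra.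
Qed.

Lemma analytic_at_neq0 f z0 : analytic_at f z0 -> f z0 != 0 ->
  exists2 r : R, 0 < r & forall z, normc (z - z0) < r -> f z != 0.
Proof.
move=> fa; rewrite -normc_gt0 => /(analytic_at_cont fa)[r r0 rP].
exists r => // z /rP; apply: contraTneq => ->.
by rewrite sub0r normcNE ltxx.
Qed.

End PowerSeries.

(** * Inverses and zeros of analytic functions *)

Section Zeros.
Context {R : realType}.
Let C := (R[i])^o.
Implicit Types (c d : nat -> R[i]) (u z w : R[i]) (f g h : R[i] -> R[i]).

(** Coefficients of the formal inverse series. Each one depends on all earlier ones, so the
    recursion carries their list, in increasing order. *)
Fixpoint inv_coefs_seq c n : seq R[i] :=
  if n is m.+1 then let s := inv_coefs_seq c m in
    rcons s (- (c 0%N)^-1 * \sum_(i < m.+1) c i.+1 * s`_(m - i))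
  else [:: (c 0%N)^-1].

Definition inv_coefs c n := (inv_coefs_seq c n)`_n.

Lemma size_inv_coefs_seq c n : size (inv_coefs_seq c n) = n.+1.
Proof. by elim: n => //= n IH; rewrite size_rcons IH. Qed.

Lemma nth_inv_coefs_seq c n k : (k <= n)%N -> (inv_coefs_seq c n)`_k = inv_coefs c k.
Proof.
elim: n => [|n IH]; first by rewrite leqn0 => /eqP ->.
rewrite leq_eqVlt => /predU1P[-> //|]; rewrite ltnS => kn /=.
by rewrite nth_rcons size_inv_coefs_seq ltnS kn IH.
Qed.

Lemma inv_coefsS c n : inv_coefs c n.+1 =
  - (c 0%N)^-1 * \sum_(i < n.+1) c i.+1 * inv_coefs c (n - i).
Proof.
rewrite {1}/inv_coefs /= nth_rcons size_inv_coefs_seq ltnn eqxx.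
by congr (_ * _); apply: eq_bigr => i _; rewrite nth_inv_coefs_seq// leq_subr.
Qed.

Lemma cauchy_prod_inv c n : c 0%N != 0 ->
  cauchy_prod c (inv_coefs c) n = (n == 0%N)%:R.
Proof.
move=> c0; rewrite /cauchy_prod big_ord_recl subn0.
case: n => [|n]; first by rewrite big_ord0 addr0 /inv_coefs /= mulfV.
rewrite inv_coefsS mulrA mulrN mulfV// mulN1r addrC.
by rewrite (eq_bigr (fun i : 'I_n.+1 => c i.+1 * inv_coefs c (n - i))) ?subrr.
Qed.

(** Induction through the recursion: once the radius is scaled by [t], the convolution is at most D
    times the geometric sum of M t / 2^(i+1), hence at most D M t <= 1. *)
Lemma inv_coefs_bound c (r M : R) : 0 < r -> c 0%N != 0 ->
  (forall n, normc (c n) * r ^+ n <= M / 8 ^+ n) ->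
  exists2 s : R, 0 < s <= r & forall n, normc (inv_coefs c n) * s ^+ n <= normc (c 0%N)^-1.
Proof.
move=> r0 c0 cM; have M0 := coef_bound_ge0 cM.
set D := normc (c 0%N)^-1.
have D0 : 0 < D by rewrite normc_gt0 invr_neq0.
(* The scaling is chosen to make [D * M * t <= 1] and [t <= 1]. *)
set t := (D * M + 1)^-1.
have t1 : 0 < D * M + 1 by rewrite ltr_wpDl// mulr_ge0// ltW.
have t0 : 0 < t by rewrite invr_gt0.
have tle1 : t <= 1.
  by rewrite invf_le1// lerDr mulr_ge0// ltW.
have DMt : D * M * t <= 1 by rewrite ler_pdivrMr// mul1r lerDl.
clearbody t; exists (t * r).
  by rewrite mulr_gt0//= ler_piMl// ltW.
have cb j : normc (c j.+1) * (t * r) ^+ j.+1 <= M * t / 2 ^+ j.+1.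
  rewrite exprMn mulrCA.
  apply: (le_trans (ler_wpM2l _ (cM _))); first by rewrite exprn_ge0// ltW.
  rewrite mulrA.
  apply: ler_pM; rewrite ?mulr_ge0 ?exprn_ge0 ?invr_ge0 ?exprn_ge0 ?(ltW t0)//.
    rewrite [X in X <= _]mulrC ler_wpM2l// exprS ler_piMr ?(ltW t0)//.
    by rewrite exprn_ile1// ltW.
  by rewrite lef_pV2 ?posrE ?exprn_gt0// lerXn2r ?nnegrE//; lra.
elim/ltn_ind => -[|n] IH; first by rewrite expr0 mulr1 /inv_coefs /=.
rewrite inv_coefsS Normc.normcM normcNE -/D -mulrA.
have p0 : 0 <= (t * r) ^+ n.+1 by rewrite exprn_ge0// mulr_ge0// ltW.
have le1 : normc (\sum_(i < n.+1) c i.+1 * inv_coefs c (n - i)) * (t * r) ^+ n.+1 <=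
   \sum_(i < n.+1) M * t / 2 ^+ i.+1 * D.
  apply: (le_trans (ler_wpM2r p0 (normc_sum _ _ _))).
  rewrite mulr_suml; apply: ler_sum => i _.
  have := IH (n - i)%N; rewrite ltnS leq_subr => /(_ isT) h.
  have -> : (t * r) ^+ n.+1 = (t * r) ^+ i.+1 * (t * r) ^+ (n - i).
    by rewrite -exprD addSn subnKC// -ltnS.
  rewrite Normc.normcM mulrACA.
  by apply: ler_pM => //; rewrite ?mulr_ge0 ?normc_ge0 ?exprn_ge0 ?mulr_ge0 ?ltW.
have sum2 m : \sum_(i < m) M * t / 2 ^+ i.+1 * D = D * M * t - D * M * t / 2 ^+ m.
  elim: m => [|m IHm]; first by rewrite big_ord0 expr0 divr1 subrr.
  by rewrite big_ord_recr /= IHm exprS; field; rewrite expf_neq0.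
rewrite -[X in _ <= X]mulr1; apply: ler_wpM2l; first exact: ltW.
apply: (le_trans le1); rewrite sum2.
have : 0 <= D * M * t / 2 ^+ n.+1.
  by rewrite ?mulr_ge0 ?invr_ge0 ?exprn_ge0 ?(ltW D0) ?(ltW t0).
lra.
Qed.

(** With P and p the partial sums of the formal inverse and of [h], the error is -(1/h) ((h - p) P +
    (p P - 1)). The Cauchy product of the two series is 1, so [cauchy_prod_tail] bounds p P - 1. *)
Lemma analytic_atV h z0 : analytic_at h z0 -> h z0 != 0 ->
  analytic_at (fun z => (h z)^-1) z0.
Proof.
move=> ha h0; have [r' r'0 hN0] := analytic_at_neq0 ha h0.
have [c [r [M [r0 cM hM]]]] := analytic_at_fast ha.
have M0 := coef_bound_ge0 cM.
have c0 : c 0%N != 0.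
  have := hM z0; rewrite subrr Normc.normc0 => /(_ r0 1%N).
  rewrite mul0r expr1 mulr0 mul0r /psum big_ord1 expr0 mulr1 => e.
  suff -> : c 0%N = h z0 by [].
  by apply/eqP; rewrite eq_sym -subr_eq0 -normc_eq0 eq_le e; exact: normc_ge0.
have [s /andP[s0 sr] dM] := inv_coefs_bound r0 c0 cM.
set D := normc (c 0%N)^-1 in dM *.
have D0 : 0 <= D by exact: normc_ge0.
have s8 : 0 < s / 8 by rewrite divr_gt0.
apply: (@analytic_at_intro _ _ _ (inv_coefs c) (Num.min r' (s / 8))).
  by rewrite lt_min r'0.
move=> z; rewrite lt_min => /andP[/hN0 hz zs]; set u := z - z0.
have zr : normc u < r by rewrite /u; lra.
have cu i : normc (c i * u ^+ i) <= M / 8 ^+ i by apply: fast_coef_le cM (ltW zr).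
have du i : normc (inv_coefs c i * u ^+ i) <= D / 8 ^+ i.
  apply: (@fast_coef_le _ _ (s / 8)) => [m|]; last exact: ltW.
  by rewrite expr_div_n mulrA ler_wpM2r ?invr_ge0 ?exprn_ge0.
exists (normc (h z)^-1 * (1 + (M * (2 * D) + M * D))) => n.
(* For n = 0 the partial sum of the product series is empty, hence 0 and not 1. *)
have [->|n0] := posnP n.
  rewrite /psum big_ord0 subr0 expr0 divr1 ler_peMr ?normc_ge0//.
  by rewrite lerDl addr_ge0 ?mulr_ge0.
have h1 := cauchy_prod_tail cu du n.
have h2 := fast_rate r0 M0 zr (hM z zr n).
have h4 := psum_bound n du.
have e1 : psum (cauchy_prod c (inv_coefs c)) n u = 1.
  rewrite /psum; case: n n0 {h1 h2 h4} => // n _.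
  rewrite big_ord_recl cauchy_prod_inv// expr0 mulr1 big1 ?addr0// => i _.
  by rewrite cauchy_prod_inv// mul0r.
rewrite e1 in h1.
set P := psum (inv_coefs c) n u in h1 h4 *.
have -> : (h z)^-1 - P = - ((h z)^-1 * ((h z - psum c n u) * P + (psum c n u * P - 1))).
  by field.
rewrite normcNE Normc.normcM -[X in _ <= X]mulrA ler_wpM2l ?normc_ge0//.
rewrite (le_trans (ler_normcD _ _))//.
apply: (le_trans (lerD _ h1)).
  rewrite Normc.normcM; apply: ler_pM (normc_ge0 _) (normc_ge0 _) h2 h4.
have -> : M / 2 ^+ n * (2 * D) + M * D / 2 ^+ n = (M * (2 * D) + M * D) / 2 ^+ n by ring.
by rewrite ler_wpM2r ?invr_ge0 ?exprn_ge0// lerDr.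
Qed.

(** The order [m] is the index of the first nonzero coefficient, and [h] has the shifted series. If
    all coefficients vanish, the error bound gives |f z| <= M / 2^n for every n. *)
Lemma analytic_at_zeros f z0 : analytic_at f z0 ->
  (\forall z \near (z0 : C), f z = 0) \/
  exists (m : nat) h, [/\ analytic_at h z0, h z0 != 0 &
     \forall z \near (z0 : C), f z = (z - z0) ^+ m * h z].
Proof.
move=> /analytic_at_fast[c [r [M [r0 cM fM]]]]; have M0 := coef_bound_ge0 cM.
have [[k ck]|/forallNP c0] := pselect (exists k, c k != 0); last first.
  left; apply/near_normcP; exists r => // z zr.
  have h n : normc (f z) <= M / 2 ^+ n.
    have := fast_rate r0 M0 zr (fM z zr n).
    rewrite /psum big1 ?subr0// => i _.
    by have /negP/negPn/eqP -> := c0 i; rewrite mul0r.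
  apply/eqP; rewrite -normc_eq0 eq_le normc_ge0 andbT; apply/ler_addgt0Pr => e e0.
  have [N /(_ N (leqnn _)) NP] := geo2_small M e0.
  by rewrite add0r (le_trans (h N))// ltW.
right; have exc : exists k, c k != 0 by exists k.
case: (ex_minnP exc) => m cm mmin.
have cl i : (i < m)%N -> c i = 0.
  by move=> im; apply: contraTeq im => /mmin; rewrite -leqNgt.
pose c' n := c (m + n)%N.
have shift n u : psum c (m + n) u = u ^+ m * psum c' n u.
  elim: n => [|n IH]; last by rewrite addnS !psumS IH mulrDr exprD /c'; ring.
  by rewrite addn0 {2}/psum big_ord0 mulr0 /psum big1// => i _; rewrite cl ?mul0r.
pose h z := if z == z0 then c m else f z / (z - z0) ^+ m.
exists m, h; split.
- apply: (@analytic_at_intro _ _ _ c' r) => // z zr; rewrite /h.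
  have [->|zz0] := eqVneq z z0.
    exists (normc (c m)) => -[|n].
      by rewrite /psum big_ord0 subr0 expr0 divr1.
    rewrite /psum big_ord_recl /= big1 => [|i _]; last by rewrite subrr exprS mul0r mulr0.
    rewrite expr0 mulr1 addr0 /c' addn0 subrr Normc.normc0.
    by rewrite divr_ge0 ?normc_ge0 ?exprn_ge0.
  have u0 : z - z0 != 0 by rewrite subr_eq0.
  exists (normc ((z - z0) ^+ m)^-1 * M) => n.
  have := fast_rate r0 M0 zr (fM z zr (m + n)%N); rewrite shift => b.
  have -> : f z / (z - z0) ^+ m - psum c' n (z - z0) =
     ((z - z0) ^+ m)^-1 * (f z - (z - z0) ^+ m * psum c' n (z - z0)).
    by field; rewrite expf_neq0.
  rewrite Normc.normcM -mulrA ler_wpM2l ?normc_ge0// (le_trans b)//.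
  by rewrite ler_wpM2l// lef_pV2 ?posrE ?exprn_gt0// ler_weXn2l ?leq_addl// ler1n.
- by rewrite /h eqxx.
apply/near_normcP; exists r => // z zr; rewrite /h; case: eqVneq => [->|zz0]; last first.
  by rewrite mulrC divfK// expf_neq0// subr_eq0.
(* At the centre the claim reads [f z0 = 0 ^+ m * c m], which covers both m = 0 and m > 0 because
   [0 ^+ 0] is 1. *)
have := fM z0; rewrite subrr Normc.normc0 => /(_ r0 m.+1).
rewrite mul0r expr0n mulr0 mul0r psumS => b.
have -> : f z0 = psum c m 0 + c m * 0 ^+ m.
  by apply/eqP; rewrite -subr_eq0 -normc_eq0 eq_le b; exact: normc_ge0.
rewrite mulrC [psum _ _ _](_ : _ = 0) ?add0r//.
by rewrite /psum big1// => i _; rewrite cl ?mul0r.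
Qed.

Lemma analytic_at_isolated f z0 : analytic_at f z0 ->
  (\forall z \near (z0 : C), f z = 0) \/ (\forall z \near (z0 : C)^', f z != 0).
Proof.
move=> /analytic_at_zeros[|[m [h [ha h0 b]]]]; [by left|right].
move/near_normcP: b => [r r0 rP].
have [s s0 sP] := analytic_at_neq0 ha h0.
apply/near_dnormcP; exists (Num.min r s); first by rewrite lt_min r0.
move=> z; rewrite lt_min => /andP[/rP -> /sP hz] zz0.
by rewrite mulf_neq0// expf_neq0// subr_eq0.
Qed.

End Zeros.

(** * Meromorphic functions and determinants of translates *)

Opaque analytic_at.

Section Meromorphic.
Context {R : realType}.
Let C := (R[i])^o.
Implicit Types (u z w : R[i]) (f g h F G : R[i] -> R[i]).

(** Meromorphy at a point. [n] is any sufficient power rather than the exact order of the pole, so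
    sums and products are handled without cases. *)
Definition merom f w := exists (n : nat) h, analytic_at h w /\
  \forall z \near (w : C)^', f z * (z - w) ^+ n = h z.

Lemma analytic_at_exp f n w : analytic_at f w -> analytic_at (fun z => f z ^+ n) w.
Proof.
move=> fa; elim: n => [|n IH]; first exact: analytic_at_cst.
rewrite (_ : (fun z => _) = fun z => f z * f z ^+ n); first exact: analytic_atM.
by apply/funext => z; rewrite exprS.
Qed.

Lemma analytic_at_subX n w : analytic_at (fun z => (z - w) ^+ n) w.
Proof.
apply: analytic_at_exp; apply: analytic_atD; first exact: analytic_at_X.
exact: analytic_at_cst.
Qed.

Lemma near_dnbhs w (P : set R[i]) : (\forall z \near (w : C), P z) ->
  \forall z \near (w : C)^', P z.
Proof.
by move=> /near_normcP[e e0 eP]; apply/near_dnormcP; exists e => // z /eP.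
Qed.

Lemma near_neq w : \forall z \near (w : C)^', z != w.
Proof. by apply/near_dnormcP; exists 1. Qed.

Lemma analytic_merom f w : analytic_at f w -> merom f w.
Proof.
by move=> fa; exists 0%N, f; split => //; near=> z; rewrite expr0 mulr1.
Unshelve. all: by end_near. Qed.

Lemma merom_cst (a : R[i]) w : merom (fun=> a) w.
Proof. by apply: analytic_merom; exact: analytic_at_cst. Qed.

Lemma meromD f g w : merom f w -> merom g w -> merom (fun z => f z + g z) w.
Proof.
move=> [n [h [ha hn]]] [m [k [ka kn]]].
exists (n + m)%N, (fun z => h z * (z - w) ^+ m + k z * (z - w) ^+ n); split.
  exact: (analytic_atD (analytic_atM ha (analytic_at_subX m w))
                       (analytic_atM ka (analytic_at_subX n w))).
near=> z.
have <- : f z * (z - w) ^+ n = h z by near: z.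
have <- : g z * (z - w) ^+ m = k z by near: z.
by rewrite exprD; ring.
Unshelve. all: by end_near. Qed.

Lemma meromM f g w : merom f w -> merom g w -> merom (fun z => f z * g z) w.
Proof.
move=> [n [h [ha hn]]] [m [k [ka kn]]].
exists (n + m)%N, (fun z => h z * k z); split; first exact: analytic_atM.
near=> z.
have <- : f z * (z - w) ^+ n = h z by near: z.
have <- : g z * (z - w) ^+ m = k z by near: z.
by rewrite exprD; ring.
Unshelve. all: by end_near. Qed.

Lemma merom_translate f w s : merom f (w + s) -> merom (fun z => f (z + s)) w.
Proof.
move=> [n [h [ha /near_dnormcP[e e0 eP]]]].
exists n, (fun z => h (z + s)); split; first exact: analytic_at_translate.
apply/near_dnormcP; exists e => // z ze zw.
have d : z + s - (w + s) = z - w by ring.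
rewrite -eP ?d//; apply: contra_neq zw; exact: addIr.
Qed.

Lemma merom_near f g w : merom f w -> (\forall z \near (w : C)^', f z = g z) -> merom g w.
Proof.
move=> [n [h [ha hn]]] fg; exists n, h; split => //; near=> z.
have <- : f z = g z by near: z.
by near: z.
Unshelve. all: by end_near. Qed.

(** As [G] does not vanish identically near [w], it is there a power of z - w (possibly negative)
    times an invertible analytic function. *)
Lemma merom_div f F G w : merom F w -> merom G w ->
  ~ (\forall z \near (w : C)^', G z = 0) ->
  (\forall z \near (w : C)^', f z * G z = F z) -> merom f w.
Proof.
move=> [k [a [aa ak]]] [n [g [ga gn]]] GN fG.
have [g0|[m [g1 [g1a g10 gm]]]] := analytic_at_zeros ga.
  case: GN; move/near_dnbhs in g0; near=> z.
  have zw : z != w by near: z; exact: near_neq.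
  have : G z * (z - w) ^+ n = 0.
    have -> : G z * (z - w) ^+ n = g z by near: z.
    by near: z.
  by move/eqP; rewrite mulf_eq0 (negPf (expf_neq0 _ _)) ?subr_eq0// orbF => /eqP.
exists (m + k)%N, (fun z => a z * (z - w) ^+ n * (g1 z)^-1); split.
  exact: (analytic_atM (analytic_atM aa (analytic_at_subX n w)) (analytic_atV g1a g10)).
have : \forall z \near (w : C), g1 z != 0.
  by apply/near_normcP; have [r r0 rP] := analytic_at_neq0 g1a g10; exists r.
move=> /near_dnbhs g1N; move/near_dnbhs in gm; near=> z.
have <- : F z * (z - w) ^+ k = a z by near: z.
have <- : f z * G z = F z by near: z.
have g1z : g1 z != 0 by near: z.
have e : G z * (z - w) ^+ n = (z - w) ^+ m * g1 z.
  have -> : G z * (z - w) ^+ n = g z by near: z.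
  by near: z.
apply: (mulIf g1z); rewrite mulfVK// exprD.
transitivity (f z * (z - w) ^+ k * ((z - w) ^+ m * g1 z)); first by ring.
by rewrite -e; ring.
Unshelve. all: by end_near. Qed.

(** If [h] has a zero of order [m], comparing [m] with the exponent [n] gives a removable
    singularity or a pole of order [n - m]; [h = 0] is removable. *)
Lemma merom_not_essential f w : merom f w -> ~ essential_singularity f w.
Proof.
move=> [n [h [ha hn]]] [_ nrem npol].
have [h0|[m [h1 [h1a h10 hm]]]] := analytic_at_zeros ha.
  apply: nrem; exists (fun=> 0); first exact: analytic_at_cst.
  move/near_dnbhs in h0; near=> z.
  have zw : z != w by near: z; exact: near_neq.
  have : f z * (z - w) ^+ n = 0.
    have -> : f z * (z - w) ^+ n = h z by near: z.
    by near: z.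
  by move/eqP; rewrite mulf_eq0 (negPf (expf_neq0 _ _)) ?subr_eq0// orbF => /eqP.
move/near_dnbhs in hm.
have e : \forall z \near (w : C)^', z != w /\ f z * (z - w) ^+ n = (z - w) ^+ m * h1 z.
  near=> z; split; first by near: z; exact: near_neq.
  have -> : f z * (z - w) ^+ n = h z by near: z.
  by near: z.
have [nm|mn] := leqP n m.
  apply: nrem; exists (fun z => (z - w) ^+ (m - n) * h1 z).
    exact: (analytic_atM (analytic_at_subX (m - n) w) h1a).
  apply: filterS e => z [zw e].
  have zn : (z - w) ^+ n != 0 by rewrite expf_neq0// subr_eq0.
  apply: (mulIf zn); rewrite e -[in LHS](subnK nm) exprD; ring.
apply: npol; exists (n - m)%N, h1; split => //; first by rewrite subn_gt0.
apply: filterS e => z [zw e].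
have zn k : (z - w) ^+ k != 0 by rewrite expf_neq0// subr_eq0.
apply: (mulIf (zn (n - m)%N)); rewrite mulfVK//; apply: (mulIf (zn m)).
by rewrite -mulrA -exprD subnK 1?ltnW// e mulrC.
Unshelve. all: by end_near. Qed.

Lemma not_essential_merom f w : isolated_singularity f w ->
  ~ essential_singularity f w -> merom f w.
Proof.
move=> fi fe.
have [[h ha fh]|nrem] := pselect (removable f w).
  apply: (merom_near (analytic_merom ha)); near=> z.
  by apply/esym; near: z.
have [[n [h [n0 ha h0 fh]]]|npol] := pselect (pole f w); last by case: fe; split.
exists n, h; split => //; near=> z.
have -> : f z = h z / (z - w) ^+ n by near: z.
have zw : z != w by near: z; exact: near_neq.
by rewrite divfK// expf_neq0// subr_eq0.
Unshelve. all: by end_near. Qed.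

(** By the Leibniz formula a determinant is a polynomial in its entries. It is applied with [P]
    being analyticity and with [P] being meromorphy at a point. *)
Lemma det_closed (P : (R[i] -> R[i]) -> Prop) :
  (forall a, P (fun=> a)) ->
  (forall f g, P f -> P g -> P (fun z => f z + g z)) ->
  (forall f g, P f -> P g -> P (fun z => f z * g z)) ->
  forall n (M : R[i] -> 'M[R[i]]_n),
  (forall i j, P (fun z => M z i j)) -> P (fun z => \det (M z)).
Proof.
move=> Pc PD PM n M MP.
have Psum (I : Type) (s : seq I) (Q : pred I) (F : I -> R[i] -> R[i]) :
    (forall i, P (F i)) -> P (fun z => \sum_(i <- s | Q i) F i z).
  move=> FP; elim: s => [|i s IH].
    by rewrite (_ : (fun z => _) = fun=> 0)//; apply/funext => z; rewrite big_nil.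
  case Qi : (Q i).
    rewrite (_ : (fun z => _) = fun z => F i z + \sum_(i <- s | Q i) F i z); first exact: PD.
    by apply/funext => z; rewrite big_cons Qi.
  by rewrite (_ : (fun z => _) = fun z => \sum_(i <- s | Q i) F i z)//;
    apply/funext => z; rewrite big_cons Qi.
have Pprod (I : Type) (s : seq I) (F : I -> R[i] -> R[i]) :
    (forall i, P (F i)) -> P (fun z => \prod_(i <- s) F i z).
  move=> FP; elim: s => [|i s IH].
    by rewrite (_ : (fun z => _) = fun=> 1)//; apply/funext => z; rewrite big_nil.
  rewrite (_ : (fun z => _) = fun z => F i z * \prod_(i <- s) F i z); first exact: PM.
  by apply/funext => z; rewrite big_cons.
by apply: Psum => s; apply: PM; [exact: Pc|exact: Pprod].
Qed.

End Meromorphic.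

(** * The identity theorem off a locally finite set *)

Section Identity.
Context {R : realType}.
Let C := (R[i])^o.
Implicit Types (u z w : R[i]) (f g h F G : R[i] -> R[i]) (E : set R[i]).

Definition disc_finite E := forall r : R, finite_set (E `&` [set z | normc z <= r]).

Lemma locally_finite_disc E : locally_finite E -> disc_finite E.
Proof.
move=> Elf r; apply: Elf.
exists r%:C; split; first exact: ger0_real_complex || by rewrite complex_real.
move=> x rx z /= zr; rewrite normC_normc.
by rewrite (le_trans _ (ltW rx))// lecR.
Qed.

Lemma finite_set_sep (S : set R[i]) w : finite_set S ->
  exists2 e : R, 0 < e & forall z, S z -> z != w -> e <= normc (z - w).
Proof.
move=> /finite_seqP[s ->]; elim: s => [|x s [e e0 eP]].
  by exists 1 => // z /=; rewrite in_nil.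
exists (if x == w then e else Num.min e (normc (x - w))).
  by case: eqVneq => // xw; rewrite lt_min e0 normc_gt0 subr_eq0.
move=> z /=; rewrite inE => /orP[/eqP->|zs] zw.
  by rewrite (negPf zw) ge_min lexx orbT.
by case: ifP => _; rewrite ?ge_min eP.
Qed.

Lemma finite_set_gap (S : set R) (a b : R) : finite_set S -> a < b ->
  exists2 c, a < c <= b & forall x, a < x < c -> ~ S x.
Proof.
move=> /finite_seqP[s ->] ab; elim: s => [|y s [c /andP[ac cb] cP]].
  by exists b; [rewrite ab lexx|move=> x _ /=; rewrite in_nil].
exists (if a < y < c then y else c).
  by case: ifP => [/andP[ay yc]|_]; rewrite ?ac ?cb// ay (le_trans (ltW yc)).
move=> x; case: ifP => h /andP[ax xc] /=; rewrite inE => /orP[/eqP xy|].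
- by move: xc; rewrite xy ltxx.
- by apply: cP; rewrite ax (lt_trans xc)//; case/andP: h.
- by move: h; rewrite -xy ax xc.
- by apply: cP; rewrite ax.
Qed.

Lemma disc_finite_near E w : disc_finite E -> \forall z \near (w : C)^', ~ E z.
Proof.
move=> Elf; have [e e0 eP] := finite_set_sep w (Elf (normc w + 1)).
apply/near_dnormcP; exists (Num.min e 1); first by rewrite lt_min e0 ltr01.
move=> z; rewrite lt_min => /andP[ze z1] zw Ez.
suff : e <= normc (z - w) by lra.
apply: eP => //; split => //=; rewrite -(subrK w z).
by rewrite (le_trans (ler_normcD _ _))// addrC lerD2l ltW.
Qed.

Lemma near_near w (P : set R[i]) : (\forall z \near (w : C), P z) ->
  \forall y \near (w : C), \forall z \near (y : C), P z.
Proof.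
move=> /near_normcP[e e0 eP]; apply/near_normcP; exists (e / 2); first lra.
move=> y ye; apply/near_normcP; exists (e / 2); first lra.
move=> z ze; apply: eP; rewrite -(subrKA y) (le_lt_trans (ler_normcD _ _))//.
lra.
Qed.

(** The segments from [w] in the directions d (1 + i t) meet only at [w], so each point of [E]
    blocks at most one [t]; finitely many points are in reach, and a small unblocked t > 0
    remains. *)
Lemma segment_avoid E w z1 (r : R) : disc_finite E -> ~ E w -> z1 != w -> 0 < r ->
  exists v, [/\ v != 0, normc (w + v - z1) < r &
    forall s : R, 0 <= s <= 1 -> ~ E (w + s%:C * v)].
Proof.
move=> Elf Ew zw r0; set d := z1 - w.
have d0 : d != 0 by rewrite subr_eq0.
have nd : 0 < normc d by rewrite normc_gt0.
(* [slope e] is the only [t] whose segment can pass through [e]. *)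
pose slope e := complex.Im ((e - w) / d) / complex.Re ((e - w) / d).
have Sfin := finite_image slope (Elf (normc w + 2 * normc d)).
(* For t < 1 the segment has length at most 2 |d| and stays in the disc above; for t < r / |d| its
   end is within [r] of [z1]. *)
set t0 := Num.min 1 (r / normc d).
have t00 : 0 < t0 by rewrite lt_min ltr01 divr_gt0.
have [c /andP[c0 ct] cP] := finite_set_gap Sfin t00.
pose t := c / 2; have t1 : 0 < t < c by rewrite /t; lra.
have tt0 : t < t0 by rewrite (lt_le_trans _ ct)//; case/andP: t1.
have /andP[tp _] := t1.
pose v := d * (1 +i* t).
have nt : normc (1 +i* t) <= 2.
  have := ler_normcD 1%:C (0 +i* t); rewrite normc_real normr1.
  have -> : 1%:C + (0 +i* t) = 1 +i* t by apply/eqP; rewrite eq_complex /= addr0 add0r !eqxx.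
  rewrite [normc (0 +i* t)]/= expr0n/= add0r sqrtr_sqr gtr0_norm//.
  move/le_trans; apply; move: tt0; rewrite lt_min => /andP[]; lra.
exists v; split.
- by rewrite mulf_neq0// eq_complex /= oner_eq0.
- have -> : w + v - z1 = d * (0 +i* t).
    have -> : 0 +i* t = (1 +i* t) - 1%:C.
      by apply/eqP; rewrite eq_complex /= subrr subr0 !eqxx.
    by rewrite /v /d; ring.
  rewrite Normc.normcM [normc (0 +i* t)]/= expr0n/= add0r sqrtr_sqr gtr0_norm//.
  by rewrite mulrC -ltr_pdivlMr//; move: tt0; rewrite lt_min => /andP[].
move=> s /andP[s0 s1] Es.
have [s00|sn0] := eqVneq s 0; first by move: Es; rewrite s00 mul0r addr0.
apply: (cP t t1); exists (w + s%:C * v).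
  split => //=; rewrite (le_trans (ler_normcD _ _))// lerD2l Normc.normcM normc_real ger0_norm//.
  rewrite /v Normc.normcM mulrC -mulrA mulrC ler_wpM2r ?normc_ge0//.
  by rewrite -[X in _ <= X]mulr1 ler_pM// normc_ge0.
rewrite /slope (_ : (w + s%:C * v - w) / d = s%:C * (1 +i* t)).
  by rewrite /= !mul0r subr0 addr0 mulr1 mulrC mulKf.
by rewrite addrAC subrr add0r /v [d * _]mulrC mulrA mulfK.
Qed.

(** Continuation along a segment avoiding [E], from a point close to [z1] back to [w]: the infimum
    [m] of the parameters down to which [G] vanishes locally must be 0. Zeros accumulate at the
    point of parameter [m], so [G] vanishes near it and the vanishing extends further. *)
Lemma identity_theorem E G w z1 : disc_finite E -> (forall z, ~ E z -> analytic_at G z) ->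
  ~ E w -> (\forall z \near (z1 : C), G z = 0) -> \forall z \near (w : C), G z = 0.
Proof.
move=> Elf Ga Ew Gz1.
have [<-//|zw] := eqVneq z1 w.
have /near_near/near_normcP[r r0 rP] := Gz1.
have [v [v0 vr vE]] := segment_avoid Elf Ew zw r0.
pose Z z := \forall z' \near (z : C), G z' = 0.
pose T : set R := [set s | 0 <= s <= 1 /\ forall s', s <= s' <= 1 -> Z (w + s'%:C * v)].
have T1 : T 1.
  split; first by rewrite ler01 lexx.
  by move=> s'; rewrite andbC => /le_anti ->; rewrite mul1r; exact: rP.
have T0 : lbound T 0 by move=> s [/andP[]].
have Tinf : has_inf T by split; [exists 1|exists 0].
have m0 : 0 <= inf T by apply: lb_le_inf => //; exists 1.
have m1 : inf T <= 1 by apply: ge_inf => //; exists 0.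
set m := inf T in m0 m1 *.
have nv : 0 < normc v by rewrite normc_gt0.
have dist (s : R) : normc (w + s%:C * v - (w + m%:C * v)) = `|s - m| * normc v.
  have -> : w + s%:C * v - (w + m%:C * v) = (s - m)%:C * v by rewrite rmorphB; ring.
  by rewrite Normc.normcM normc_real.
have Gm : Z (w + m%:C * v).
  have /vE/Ga/analytic_at_isolated[//|] : 0 <= m <= 1 by rewrite m0 m1.
  move=> /near_dnormcP[e e0 eP].
  have [s Ts sm] := inf_adherent (divr_gt0 e0 nv) Tinf.
  have ms : m <= s by apply: ge_inf => //; exists 0.
  have Zs : Z (w + s%:C * v) by apply Ts.2; rewrite lexx/=; case/andP: Ts.1.
  have [->//|smN] := eqVneq m s.
  move: Zs => /near_normcP[e' e'0 /(_ (w + s%:C * v))].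
  rewrite subrr Normc.normc0 => /(_ e'0) Gs.
  have : G (w + s%:C * v) != 0.
    apply: eP; last first.
      rewrite -subr_eq0 -normc_eq0 dist mulf_neq0 ?(gt_eqF nv)// normr_eq0 subr_eq0 eq_sym //.
    rewrite dist -ltr_pdivlMr// ger0_norm ?subr_ge0// ltrBlDl//.
  by move/negP; case; apply/eqP; exact: Gs.
have /near_near/near_normcP[e e0 eP] := Gm.
(* A parameter still inside the disc where [G] vanishes locally; it is below [m] unless [m = 0]. *)
pose m' := Num.max 0 (m - e / normc v / 2).
have den : 0 < e / normc v by rewrite divr_gt0.
have m'm : m' <= m by rewrite ge_max m0/=; lra.
have Tm' : T m'.
  split; first by rewrite le_max lexx/= (le_trans m'm).
  move=> s /andP[m's s1].
  have [sm|ms] := leP s m.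
    apply: eP; rewrite dist -ltr_pdivlMr// distrC ger0_norm ?subr_ge0//.
    move: m's; rewrite ge_max => /andP[_]; lra.
  have sm0 : 0 < s - m by rewrite subr_gt0.
  have [x [_ xT] xs] := inf_adherent sm0 Tinf.
  by apply: xT; rewrite s1 andbT ltW//; move: xs; rewrite -/m addrC subrK.
have : m <= m' by apply: ge_inf => //; exists 0.
have [m'0 _|m'N] := eqVneq m' 0.
  have := Tm'.2 0; rewrite m'0 lexx ler01 => /(_ isT).
  by rewrite rmorph0 mul0r addr0.
move=> mm; exfalso; have [h|h] := leP 0 (m - e / normc v / 2); last first.
  by move/eqP: m'N; apply; rewrite /m' max_l// ltW.
by move: mm; rewrite /m' max_r// => mm; lra.
Qed.

End Identity.

Lemma merom_sum {R : realType} n (F : 'I_n -> R[i] -> R[i]) w : (forall i, merom (F i) w) ->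
  merom (fun z => \sum_(i < n) F i z) w.
Proof.
elim: n F => [|n IH] F Fm.
  rewrite (_ : (fun z => _) = fun=> 0); first exact: merom_cst.
  by apply/funext => z; rewrite big_ord0.
rewrite (_ : (fun z => _) = fun z => F ord0 z + \sum_(i < n) F (lift ord0 i) z).
  by apply: meromD; [exact: Fm|apply: IH => i; exact: Fm].
by apply/funext => z; rewrite big_ord_recl.
Qed.

(** * Determinants of real translates of f *)

Section TranslatesDet.
Context {R : realType}.
Let C := (R[i])^o.
Variables (A : set R[i]) (f : R[i] -> R[i]).
Hypothesis A_lf : disc_finite A.
Hypothesis f_an : forall z, ~ A z -> analytic_at f z.

(* [e i j = false] where the translate of the truncated window vanishes. *)
Definition translates_mx n (e : 'I_n -> 'I_n -> bool) (s : 'I_n -> 'I_n -> R) (z : R[i]) :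
  'M[R[i]]_n := \matrix_(i, j) if e i j then f (z + (s i j)%:C) else 0.

Definition translates_sing n (s : 'I_n -> 'I_n -> R) : set R[i] :=
  [set z | exists i j, A (z + (s i j)%:C)].

Lemma translates_sing_disc_finite n (s : 'I_n -> 'I_n -> R) :
  disc_finite (translates_sing s).
Proof.
move=> r.
have : finite_set (\bigcup_(i in [set: 'I_n]) \bigcup_(j in [set: 'I_n])
   ((fun z => z - (s i j)%:C) @` (A `&` [set z | normc z <= r + `|s i j|]))).
  apply: bigcup_finite => // i _; apply: bigcup_finite => // j _.
  by apply: finite_image; exact: A_lf.
apply: sub_finite_set => z [[i [j Aij]] /= zr].
exists i => //; exists j => //; exists (z + (s i j)%:C); last by rewrite addrK.
split => //=; rewrite (le_trans (ler_normcD _ _))// normc_real lerD2r//.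
Qed.

Lemma translates_mx_analytic n (e : 'I_n -> 'I_n -> bool) (s : 'I_n -> 'I_n -> R) z i j :
  ~ translates_sing s z -> analytic_at (fun z => translates_mx e s z i j) z.
Proof.
move=> sz; rewrite (_ : (fun z => _) = fun z => if e i j then f (z + (s i j)%:C) else 0).
  case: (e i j); last exact: analytic_at_cst.
  apply: analytic_at_translate; apply: f_an => As; apply: sz.
  by exists i, j.
by apply/funext => w; rewrite mxE.
Qed.

Lemma translates_det_analytic n (e : 'I_n -> 'I_n -> bool) (s : 'I_n -> 'I_n -> R) z :
  ~ translates_sing s z -> analytic_at (fun z => \det (translates_mx e s z)) z.
Proof.
move=> sz; apply: (@det_closed _ (fun g => analytic_at g z)).
- by move=> a; exact: analytic_at_cst.
- by move=> *; exact: analytic_atD.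
- by move=> *; exact: analytic_atM.
- by move=> i j; exact: translates_mx_analytic.
Qed.

Variable z0 : R[i].
Hypothesis z0_ess : essential_singularity f z0.
Hypothesis line_merom : forall z, complex.Im z = complex.Im z0 -> z <> z0 -> merom f z.

(* Each entry contributes the only essential singularity, at [z0 - s i j], that
   the determinant can have there; so the determinant vanishes only if all the
   relevant cofactors do. *)
Lemma translates_det_neq0 n (e : 'I_n -> 'I_n -> bool) (s : 'I_n -> 'I_n -> R) :
  (forall i, e i i) ->
  (forall i j i' j', s i j = s i' j' -> i = i' /\ j = j') ->
  forall z1 : R[i], ~ (\forall z \near (z1 : C), \det (translates_mx e s z) = 0).
Proof.
elim: n e s => [|n IH] e s ei s_inj z1 Dz1.
  have /near_normcP[r r0 /(_ z1)] := Dz1.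
  by rewrite subrr Normc.normc0 det_mx00 => /(_ r0)/eqP; rewrite oner_eq0.
pose F i j z := translates_mx e s z i j.
pose cof j z := cofactor (translates_mx e s z) ord0 j.
(* Near [p] the corner entry behaves like [f] near [z0]. The shifts being real and distinct, any
   other nonzero entry behaves like [f] near another point of the line of [z0], where [f] is
   meromorphic. *)
pose p := z0 - (s ord0 ord0)%:C.
have D0 : \forall z \near (p : C)^', \det (translates_mx e s z) = 0.
  have : \forall z \near (p : C)^', ~ translates_sing s z.
    exact: (disc_finite_near p (@translates_sing_disc_finite _ s)).
  apply: filterS => z sz.
  have /near_normcP[r r0 /(_ z)] := identity_theorem (@translates_sing_disc_finite _ s)
     (@translates_det_analytic _ e s) sz Dz1.
  by rewrite subrr Normc.normc0; apply.
have Fmerom i j : (i, j) <> (ord0, ord0) -> merom (F i j) p.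
  move=> ij; rewrite (_ : F i j = fun z => if e i j then f (z + (s i j)%:C) else 0); last first.
    by apply/funext => w; rewrite /F mxE.
  case: (e i j); last exact: merom_cst.
  apply: merom_translate; apply: line_merom.
    by rewrite /p; case: (z0) => x y /=; rewrite oppr0 !addr0.
  move=> /eqP; rewrite -subr_eq0 /p.
  have -> : z0 - (s ord0 ord0)%:C + (s i j)%:C - z0 = (s i j - s ord0 ord0)%:C.
    by rewrite rmorphB; ring.
  rewrite fmorph_eq0 subr_eq0 => /eqP /s_inj[i0 j0].
  by apply: ij; rewrite i0 j0.
have cof_merom j : merom (cof j) p.
  apply: meromM; first exact: merom_cst.
  apply: (@det_closed _ (fun g => merom g p)).
  - by move=> a; exact: merom_cst.
  - by move=> *; exact: meromD.
  - by move=> *; exact: meromM.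
  move=> i k.
  rewrite (_ : (fun z => _) = F (lift ord0 i) (lift j k)).
    by apply: Fmerom => -[].
  by apply/funext => z; rewrite !mxE /F mxE.
(* This cofactor is a smaller determinant of the same kind. Vanishing near [p] punctured gives
   vanishing on the disc of radius [r / 4] around [z2], which misses [p], against the induction
   hypothesis. *)
have cof0N : ~ (\forall z \near (p : C)^', cof ord0 z = 0).
  move=> /near_dnormcP[r r0 rP].
  pose z2 := p + (r / 2)%:C.
  apply: (IH (fun i j => e (lift ord0 i) (lift ord0 j))
             (fun i j => s (lift ord0 i) (lift ord0 j)) _ _ z2).
  - by move=> i; exact: ei.
  - by move=> i j i' j' /s_inj[] /lift_inj -> /lift_inj ->.
  apply/near_normcP; exists (r / 4); first by lra.
  move=> z zz2.
  have d : normc (z2 - p) = r / 2.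
    by rewrite /z2 addrAC subrr add0r normc_real ger0_norm//; lra.
  have zr : normc (z - p) < r.
    rewrite -(subrKA z2) (le_lt_trans (ler_normcD _ _))// d; lra.
  have zp : z != p.
    apply: contraTneq zz2 => ->; rewrite normcB d -leNgt; lra.
  have := rP z zr zp; rewrite /cof /cofactor expr0 mul1r => <-.
  by congr (\det _); apply/matrixP => i j; rewrite !mxE.
(* Expanding along the first row, the corner entry times its cofactor is minus a sum of meromorphic
   terms; dividing by the cofactor makes [f] meromorphic at [z0]. *)
have F0 : merom (F ord0 ord0) p.
  apply: (@merom_div _ _ (fun z => - 1 * \sum_(j < n) F ord0 (lift ord0 j) z * cof (lift ord0 j) z)
     (cof ord0) p) => //.
    apply: meromM; first exact: merom_cst.
    apply: merom_sum => j; apply: meromM; last exact: cof_merom.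
    by apply: Fmerom => -[].
  apply: filterS D0 => z; rewrite (expand_det_row _ ord0) big_ord_recl /=.
  move/eqP; rewrite addr_eq0 => /eqP ->.
  by rewrite mulN1r.
have : merom f z0.
  have : merom (fun z => F ord0 ord0 (z - (s ord0 ord0)%:C)) z0.
    exact: merom_translate.
  move=> h; apply: (merom_near h); apply/near_dnormcP; exists 1 => // z _ _.
  by rewrite /F mxE ei subrK.
by move/merom_not_essential; apply.
Qed.

(** If the determinant vanished on a whole real interval free of singularities, its zeros would not
    be isolated, so it would vanish on a disc. *)
Lemma translates_det_real n (e : 'I_n -> 'I_n -> bool) (s : 'I_n -> 'I_n -> R)
    (c d : R) : c < d -> (forall i, e i i) ->
  (forall i j i' j', s i j = s i' j' -> i = i' /\ j = j') ->
  exists2 x : R, c < x < d & ~ translates_sing s x%:C /\ \det (translates_mx e s x%:C) != 0.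
Proof.
move=> cd ei s_inj.
(* This disc contains the real interval from [c] to [d], so avoiding these finitely many real parts
   avoids all singularities there. *)
set S := (fun z : R[i] => complex.Re z) @` (translates_sing s `&` [set z | normc z <= `|c| + `|d|]).
have Sf : finite_set S by apply: finite_image; exact: translates_sing_disc_finite.
have [d' /andP[cd' d'd] d'P] := finite_set_gap Sf cd.
have xE x : c < x < d' -> ~ translates_sing s x%:C.
  move=> xcd sx; apply: (d'P x xcd); exists x%:C => //; split => //=.
  rewrite [Num.sqrt _]normc_real.
  case/andP: xcd => cx xd.
  have := ler_norm d; have := ler_norm (- c); have := normr_ge0 c; have := normr_ge0 d.
  by rewrite normrN ler_norml => *; lra.
apply: contrapT => noex.
pose x0 := (c + d') / 2.
have x0cd : c < x0 < d' by rewrite /x0; lra.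
have Dzero x : c < x < d' -> \det (translates_mx e s x%:C) = 0.
  move=> xcd; apply: contrapT => /eqP D; apply: noex; exists x.
    by case/andP: xcd => -> h /=; rewrite (lt_le_trans h).
  by split => //; exact: xE.
have [|/near_dnormcP[r r0 rP]] := analytic_at_isolated (@translates_det_analytic _ e s _ (xE _ x0cd)).
  exact: translates_det_neq0.
pose x1 := x0 + Num.min (r / 2) ((d' - c) / 4).
have m0 : 0 < Num.min (r / 2) ((d' - c) / 4) by rewrite lt_min; lra.
have [mr md] : Num.min (r / 2) ((d' - c) / 4) <= r / 2 /\ Num.min (r / 2) ((d' - c) / 4) <= (d' - c) / 4.
  by rewrite !ge_min !lexx orbT.
have x1cd : c < x1 < d' by rewrite /x1 /x0; lra.
have : \det (translates_mx e s x1%:C) != 0.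
  have e1 : x1%:C - x0%:C = (x1 - x0)%:C by rewrite rmorphB.
  apply: rP; first by rewrite e1 normc_real /x1 addrAC subrr add0r ger0_norm; lra.
  by rewrite -subr_eq0 e1 fmorph_eq0 /x1 addrAC subrr add0r gt_eqF.
by rewrite Dzero// eqxx.
Qed.

End TranslatesDet.

(** * Solving for h along a window *)

Section Rows.
Context {R : realType}.
Variables (alpha gamma : R).
Implicit Types (h u : R -> R[i]).

(** A finitely supported sum, with value 0 when infinitely many terms are nonzero. Periodicity then
    holds for every [u], and [persumE] computes the sum when the support is bounded. *)
Definition persum u x : R[i] := \sum_(k \in [set: int]) u (x + k%:~R * gamma).

Lemma persumE u x (lo : int) (m : nat) :
  (forall k : int, k < lo \/ lo + m%:Z <= k -> u (x + k%:~R * gamma) = 0) ->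
  persum u x = \sum_(j < m) u (x + (lo + j%:Z)%:~R * gamma).
Proof.
move=> u0; pose r := [seq lo + j%:Z | j <- iota 0 m].
have ur : uniq r.
  by rewrite map_inj_uniq ?iota_uniq// => i j /addrI[].
rewrite /persum -(@fsbig_widen _ _ _ _ [set` r] [set: int])//; last first.
  move=> k [_ /= /negP kr]; apply: u0; have [kl|lk] := ltP k lo; [by left|right].
  rewrite leNgt; apply: contra kr => km; apply/mapP; exists `|k - lo|%N.
    by rewrite mem_iota /=; lia.
  lia.
by rewrite -fsbig_seq// big_map -[m in iota 0 m]subn0 -/(index_iota 0 m) big_mkord.
Qed.

Lemma persum_shift u x (k : int) : persum u (x + k%:~R * gamma) = persum u x.
Proof.
rewrite /persum [RHS](reindex_fsbigT (fun i => i + k)) /=.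
  by apply: eq_fsbigr => i _; rewrite intrD mulrDl addrAC addrA.
by exists (fun i => i - k) => i; rewrite ?addrK ?subrK.
Qed.

Lemma persum_translate u x y : persum (fun z => u (z + y)) x = persum u (x + y).
Proof. by rewrite /persum; apply: eq_fsbigr => i _; rewrite addrAC. Qed.

Variables (g : R -> R[i]) (a b M : R).
Hypotheses (alpha0 : 0 < alpha) (alpha_gamma : alpha < gamma) (alpha_ab : alpha < b - a).
Hypothesis g_supp : forall x, ~~ (a < x < b) -> g x = 0.
Hypothesis g_le : forall x, normc (g x) <= M.
Hypothesis g_ge : forall c d, a < c -> d < b ->
  exists2 delta, 0 < delta & forall x, c <= x <= d -> delta <= normc (g x).
Hypothesis incommens : forall m n : int, m%:~R * alpha = n%:~R * gamma -> m = 0 /\ n = 0.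

(** [g] is not conjugated, so that the matrix entries are translates of the analytic [f]; the rows
    will be applied to the conjugate of the function under study. *)
Definition gabor_row h (n : int) x := persum (fun y => h y * g (y - n%:~R * alpha)) x.

(* The lower frame inequality, localized at [x] and in the sup norm: the values
   [gabor_row h n x] with [n alpha] near [x] control [h x]. *)
Definition determined (N C x : R) := forall h eps, 0 <= eps ->
  (forall n : int, `|n%:~R * alpha - x| <= N -> normc (gabor_row h n x) <= eps) ->
  normc (h x) <= C * eps.

Lemma gabor_row_shift h n x (k : int) : gabor_row h n (x + k%:~R * gamma) = gabor_row h n x.
Proof. exact: persum_shift. Qed.

Lemma determined_le N C N' C' x : N <= N' -> C <= C' ->
  determined N C x -> determined N' C' x.
Proof.
move=> NN CC D h eps eps0 H; apply: (@le_trans _ _ (C * eps)).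
  by apply: D => // n nN; apply: H; exact: le_trans NN.
by rewrite ler_wpM2r.
Qed.

(** Translating [h] by [m alpha] renumbers the rows by [m]. Only translates by gamma Z therefore
    have to be reached by solving equations. *)
Lemma determined_translate N C x (m : int) :
  determined N C x -> determined N C (x + m%:~R * alpha).
Proof.
move=> D h eps eps0 H; apply: (D (fun y => h (y + m%:~R * alpha))) => // n nN.
have -> : gabor_row (fun y => h (y + m%:~R * alpha)) n x = gabor_row h (n + m) (x + m%:~R * alpha).
  rewrite /gabor_row -persum_translate; congr persum; apply/funext => y.
  congr (_ * g _); rewrite intrD; ring.
apply: H; apply: le_trans nN; rewrite le_eqVlt; apply/orP; left; apply/eqP; congr (`| _ |).
by rewrite intrD; ring.
Qed.

Variable L : nat.
Hypothesis L_ab : b - a <= L%:R * gamma.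

(* When [window N C x] holds, a row in which [h x] meets a value of [g] close to
   the right end of its support involves, besides [h x], only determined values. *)
Definition window N C x := forall j : nat, (0 < j <= L)%N ->
  determined N C (x - j%:R * gamma).

Lemma floor_itv_ex (c d x : R) : c < d ->
  exists n : int, c < x - n%:~R * (d - c) <= d.
Proof.
move=> cd; have dc : 0 < d - c by rewrite subr_gt0.
exists (Num.ceil ((x - d) / (d - c))).
have /andP[h1 h2] := real_ceil_itv (num_real ((x - d) / (d - c))).
apply/andP; split.
  by move: h1; rewrite intrB ltr_pdivlMr// => h1; lra.
by move: h2; rewrite ler_pdivrMr// => h2; lra.
Qed.

(** In a row where [x] falls near, but not at, the right end of the support, x + gamma falls beyond
    that end. The row thus expresses [h x] through the [L] preceding values, with a coefficient
    bounded away from 0. *)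
Lemma propagate : exists N0 C0 C1 : R, [/\ 0 <= N0, 0 <= C0, 0 <= C1 &
  forall N C x, 0 <= N -> 0 <= C -> window N C x -> determined (N + N0) (C0 + C1 * C) x].
Proof.
have [hal [hag hab]] := (conj alpha0 (conj alpha_gamma alpha_ab)).
have hL := L_ab.
have gamma0 : 0 < gamma by exact: lt_trans alpha_gamma.
have M0 : 0 <= M by apply: le_trans (g_le 0); exact: normc_ge0.
(* [y] will range over the interval from b - alpha - e0 to b - e0. It has length alpha, so some row
   hits it; it lies inside (a, b) as e0 < b - a - alpha; and y + gamma > b as e0 < gamma - alpha. *)
pose e0 := Num.min (gamma - alpha) (b - a - alpha) / 2.
have [e00 [e01 e02]] : 0 < e0 /\ e0 < gamma - alpha /\ e0 < b - a - alpha.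
  have m0 : 0 < Num.min (gamma - alpha) (b - a - alpha) by rewrite lt_min !subr_gt0 alpha_gamma.
  have : Num.min (gamma - alpha) (b - a - alpha) <= gamma - alpha by rewrite ge_min lexx.
  have : Num.min (gamma - alpha) (b - a - alpha) <= b - a - alpha by rewrite ge_min lexx orbT.
  by move=> h1 h2; rewrite /e0; lra.
have [d d0 gd] := @g_ge (b - alpha - e0) (b - e0) ltac:(lra) ltac:(lra).
exists (L%:R * gamma + (`|a| + `|b|)), d^-1, (d^-1 * (L%:R * M)).
split=> [|||N C x N0 C0 W].
- by rewrite addr_ge0 ?addr_ge0// mulr_ge0// ltW.
- by rewrite invr_ge0 ltW.
- by rewrite mulr_ge0 ?mulr_ge0// invr_ge0 ltW.
move=> h eps eps0 H.
have [n nx] := @floor_itv_ex (b - alpha - e0) (b - e0) x ltac:(lra).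
have ea : b - e0 - (b - alpha - e0) = alpha by ring.
rewrite ea in nx; set y := x - n%:~R * alpha in nx.
have /andP[y1 y2] := nx.
have hj (j : nat) : (0 < j <= L)%N -> normc (h (x - j%:R * gamma)) <= C * eps.
  move=> jL; apply: (W j jL) => // m mN.
  have -> : x - j%:R * gamma = x + (- j%:Z)%:~R * gamma by rewrite rmorphN mulNr.
  (* Rows are gamma-periodic, so the rows at [x - j gamma] are those at [x]; only the range of their
     indices moves, by at most [L gamma]. *)
  rewrite gabor_row_shift; apply: H.
  have -> : m%:~R * alpha - x = (m%:~R * alpha - (x - j%:R * gamma)) - j%:R * gamma by ring.
  rewrite (le_trans (ler_normB _ _))//; rewrite lerD//.
  rewrite ger0_norm ?mulr_ge0 ?(ltW gamma0)//.
  apply: (@le_trans _ _ (L%:R * gamma)); last by rewrite lerDl addr_ge0.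
  by rewrite ler_wpM2r ?(ltW gamma0)// ler_nat; case/andP: jL.
have rowE : gabor_row h n x = \sum_(j < L) h (x - j.+1%:R * gamma) * g (y - j.+1%:R * gamma)
    + h x * g y.
  rewrite /gabor_row (@persumE _ _ (- L%:Z) L.+1); last first.
    move=> k [kL|Lk]; rewrite g_supp ?mulr0//; apply/negP => /andP[ga gb].
      have : (k + 1)%:~R <= (- L%:Z)%:~R :> R by rewrite ler_int lezD1.
      rewrite intrD rmorphN /= => kL'.
      have : (k%:~R + 1) * gamma <= (- L%:R) * gamma by rewrite ler_wpM2r ?(ltW gamma0).
      by rewrite /y in y2; lra.
    have : 1%:~R <= k%:~R :> R by rewrite ler_int; move: Lk; rewrite -addn1 PoszD addKr.
    rewrite -[X in X <= _]/(1 : R) => k1.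
    have : 1 * gamma <= k%:~R * gamma by rewrite ler_wpM2r ?(ltW gamma0).
    by rewrite /y in y1; lra.
  rewrite big_ord_recr /= addNr mul0r addr0; congr (_ + _ * g _).
  rewrite (reindex_inj rev_ord_inj) /=; apply: eq_bigr => j _.
  have -> : (- L%:Z + (L - j.+1)%N%:Z) = - j.+1%:Z by rewrite -subzn ?ltn_ord// addKr.
  rewrite rmorphN /= mulNr; congr (_ * g _); rewrite /y; ring.
have Hn : normc (gabor_row h n x) <= eps.
  apply: H; rewrite distrC -/y.
  have -> : `|y| <= N + (L%:R * gamma + (`|a| + `|b|)) = true; last by [].
  have := ler_norm b; have := ler_norm (- a); rewrite normrN.
  have := normr_ge0 a; have := normr_ge0 b.
  have : 0 <= L%:R * gamma by rewrite mulr_ge0// ltW.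
  by rewrite ler_norml => *; apply/andP; split; lra.
have gy : d <= normc (g y) by apply: gd; rewrite (ltW y1).
have : normc (h x * g y) <= eps + L%:R * (C * eps * M).
  have -> : h x * g y = gabor_row h n x -
      \sum_(j < L) h (x - j.+1%:R * gamma) * g (y - j.+1%:R * gamma).
    by rewrite rowE addrC addKr.
  rewrite (le_trans (le_normcB _ _))// lerD// (le_trans (normc_sum _ _ _))//.
  rewrite mulr_natl -[X in _ *+ X]card_ord -sumr_const; apply: ler_sum => j _.
  by rewrite Normc.normcM ler_pM ?normc_ge0// hj//=.
rewrite Normc.normcM => hg.
have : normc (h x) * d <= eps + L%:R * (C * eps * M).
  by apply: le_trans hg; rewrite ler_wpM2l ?normc_ge0.
rewrite -ler_pdivlMr// => /le_trans; apply; rewrite le_eqVlt; apply/orP; left.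
by apply/eqP; field; rewrite gt_eqF.
Qed.

(** The constants depend on the number of steps [k] but not on [x]. *)
Lemma window_propagate N C : 0 <= N -> 0 <= C -> forall k : nat, exists N' C',
  [/\ 0 <= N', 0 <= C' & forall x, window N C x ->
    forall j, (j <= k)%N -> window N' C' (x + j%:R * gamma)].
Proof.
move=> N0 C0; have [D [E [F [D0 E0 F0 prop]]]] := propagate.
elim=> [|k [N' [C' [N'0 C'0 IH]]]].
  exists N, C; split => // x W j; rewrite leqn0 => /eqP ->.
  by rewrite mul0r addr0.
exists (N' + D), (C' + (E + F * C')); split=> [||x W j].
- exact: addr_ge0.
- by rewrite !addr_ge0 ?mulr_ge0.
have NN : N' <= N' + D by rewrite lerDl.
have CC : C' <= C' + (E + F * C') by rewrite lerDl addr_ge0 ?mulr_ge0.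
rewrite leq_eqVlt => /predU1P[->|]; last first.
  by rewrite ltnS => /(IH x W) h i iL; apply: determined_le NN CC _; exact: h.
have Wk := IH x W k (leqnn k).
move=> i /andP[i0 iL].
have -> : x + k.+1%:R * gamma - i%:R * gamma = x + k%:R * gamma - i.-1%:R * gamma.
  by rewrite -{1}(prednK i0) -!natr1; ring.
(* The window moved one step contains one new point, for i = 1, given by [propagate]; the other
   points belong to the previous window. *)
have [i1|i1] := posnP i.-1.
  rewrite i1 mul0r subr0; apply: (determined_le (lexx _) _ (prop _ _ _ N'0 C'0 Wk)).
  by rewrite lerDr.
by apply: determined_le NN CC _; apply: Wk; rewrite i1 (leq_trans (leq_pred i)).
Qed.

(** Dirichlet's pigeonhole argument: among the m + 1 fractional parts of j gamma / alpha two share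
    one of [m] bins. Incommensurability makes the difference nonzero. *)
Lemma small_combination (e : R) : 0 < e -> exists (q : nat) (p : int),
  0 < `|q%:R * gamma - p%:~R * alpha| < e.
Proof.
have [hal [hag hab]] := (conj alpha0 (conj alpha_gamma alpha_ab)).
move=> e0.
pose m := (Num.truncn (alpha / e)).+1.
have m0 : 0 < m%:R :> R by rewrite ltr0n.
have me : alpha / m%:R < e.
  rewrite ltr_pdivrMr// mulrC -ltr_pdivrMr//; exact: real_truncnS_gt (num_real _).
pose fr (j : nat) : R := j%:R * gamma / alpha - (Num.floor (j%:R * gamma / alpha))%:~R.
have fr01 j : 0 <= fr j < 1.
  have /andP[] := real_floor_itv (num_real (j%:R * gamma / alpha)).
  by rewrite intrD /fr => *; apply/andP; split; lra.
have binm (j : 'I_m.+1) : (Num.truncn (fr j * m%:R) < m)%N.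
  have /andP[f0 f1] := fr01 j.
  rewrite truncn_lt_nat ?mulr_ge0//; by rewrite -[X in _ < X]mul1r ltr_pM2r.
pose bin (j : 'I_m.+1) : 'I_m := Ordinal (binm j).
have [i [j [ij bij]]] : exists i j : 'I_m.+1, (i < j)%N /\ bin i = bin j.
  apply: contrapT => noij.
  have binj : injective bin.
    move=> i j bij; apply: val_inj => /=; case: (ltngtP i j) => // ij; case: noij.
      by exists i, j.
    by exists j, i.
  by have := leq_card bin binj; rewrite !card_ord ltnn.
pose fl (j : nat) := Num.floor (j%:R * gamma / alpha).
exists (j - i)%N, (fl j - fl i).
have -> : (j - i)%:R * gamma - (fl j - fl i)%:~R * alpha = (fr j - fr i) * alpha.
  by rewrite natrB 1?ltnW// intrB /fr /fl; field; rewrite gt_eqF.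
have dfr : `|fr j - fr i| < m%:R^-1.
  have : Num.truncn (fr i * m%:R) = Num.truncn (fr j * m%:R) by case: bij.
  have /andP[i0 _] := fr01 i; have /andP[j0 _] := fr01 j.
  have := truncn_itv (mulr_ge0 i0 (ltW m0)); have := truncn_itv (mulr_ge0 j0 (ltW m0)).
  set ti := Num.truncn _; set tj := Num.truncn _ => /andP[h1 h2] /andP[h3 h4] tij.
  rewrite tij -natr1 in h3 h4; rewrite -natr1 in h2.
  rewrite -[_^-1]mul1r ltr_pdivlMr// -(ger0_norm (ltW m0)) -normrM mulrBl.
  by rewrite ltr_norml; apply/andP; split; lra.
rewrite normrM (ger0_norm (ltW alpha0)); apply/andP; split; last first.
  by apply: le_lt_trans me; rewrite mulrC ler_wpM2l// ltW.
rewrite mulr_gt0// normr_gt0; apply/eqP => h.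
have : (j - i)%:Z%:~R * gamma = (fl j - fl i)%:~R * alpha.
  have d : (j - i)%:Z%:~R * gamma - (fl j - fl i)%:~R * alpha = (fr j - fr i) * alpha.
    by rewrite -pmulrn natrB 1?ltnW// intrB /fr /fl; field; rewrite gt_eqF.
  by apply/eqP; rewrite -subr_eq0 d h mul0r.
move/esym/incommens => [_ /eqP]; rewrite eqz_nat subn_eq0 leqNgt ij.
by [].
Qed.

(** Density with a uniform step count: subtracting multiples of a combination [t] with 0 < |t| < d -
    c moves a point by steps too short to jump over (c, d), across a distance below alpha. The sign
    of [t] decides on which side of (c, d) to start. *)
Lemma bounded_return (c d : R) : c < d -> exists K : nat, forall x, exists (k : nat) (n : int),
  (k <= K)%N /\ c < x - k%:R * gamma - n%:~R * alpha < d.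
Proof.
have [hal [hag hab]] := (conj alpha0 (conj alpha_gamma alpha_ab)).
move=> cd; have [|q [p /andP[t0 tdc]]] := @small_combination (d - c); first by rewrite subr_gt0.
set t := q%:R * gamma - p%:~R * alpha in t0 tdc.
exists (q * (Num.truncn (alpha / `|t|)).+1)%N => x.
have step (y : R) : 0 <= y < alpha -> exists i : nat, (i <= (Num.truncn (alpha / `|t|)).+1)%N /\
    0 < i%:R * `|t| - y <= `|t|.
  move=> /andP[y0 ya]; exists (Num.truncn (y / `|t|)).+1.
  have yt : 0 <= y / `|t| by rewrite divr_ge0// ltW.
  split; first by rewrite ltnS le_truncn// ler_wpM2r ?invr_ge0 ?(ltW t0)// ltW.
  have /andP[h1 h2] := truncn_itv yt.
  rewrite ltr_pdivrMr// in h2; rewrite ler_pdivlMr// in h1.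
  by rewrite -natr1 in h2 *; lra.
have [tp|tn] := leP 0 t.
  have [n /andP[n1 n2]] := @floor_itv_ex (- (alpha + d)) (- d) (- x) ltac:(lra).
  have [|i [iK /andP[i1 i2]]] := step (x + n%:~R * alpha - d); first by lra.
  exists (q * i)%N, (- (p * i%:Z) - n); split; first by rewrite leq_mul2l iK orbT.
  have e : x - (q * i)%:R * gamma - (- (p * i%:Z) - n)%:~R * alpha =
      x + n%:~R * alpha - i%:R * t.
    by rewrite intrB rmorphN /= intrM natrM /t; ring.
  by rewrite e -(ger0_norm tp); lra.
have [n /andP[n1 n2]] := @floor_itv_ex (c - alpha) c x ltac:(lra).
have [|i [iK /andP[i1 i2]]] := step (c - (x - n%:~R * alpha)); first by lra.
exists (q * i)%N, (n - p * i%:Z); split; first by rewrite leq_mul2l iK orbT.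
have e : x - (q * i)%:R * gamma - (n - p * i%:Z)%:~R * alpha =
    x - n%:~R * alpha + i%:R * (- t).
  by rewrite intrB intrM natrM /t; ring.
by rewrite e -(ltr0_norm tn); lra.
Qed.

Lemma window_determined (c d N C : R) : c < d -> 0 <= N -> 0 <= C ->
  (forall x, c < x < d -> window N C x) ->
  exists N' C', 0 <= N' /\ 0 <= C' /\ forall x, determined N' C' x.
Proof.
move=> cd N0 C0 W; have [K KP] := bounded_return cd.
have [D [E [F [D0 E0 F0 prop]]]] := propagate.
have [N' [C' [N'0 C'0 W']]] := window_propagate N0 C0 K.
exists (N' + D), (E + F * C'); split; [|split] => [||x].
- exact: addr_ge0.
- by rewrite addr_ge0 ?mulr_ge0.
(* A window at [x] controls only x - j gamma with j > 0; this last propagation step reaches [x]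
   itself. *)
apply: prop => //; have [k [n [kK /W kn]]] := KP x.
move=> j jL; have := W' _ kn k kK j jL.
move/(@determined_translate _ _ _ n).
have -> : x - k%:R * gamma - n%:~R * alpha + k%:R * gamma - j%:R * gamma + n%:~R * alpha =
    x - j%:R * gamma by ring.
exact.
Qed.

End Rows.

Lemma normc_det_le {R : realType} n (B : 'M[R[i]]_n) (M : R) :
  (forall i j, normc (B i j) <= M) -> normc (\det B) <= n`!%:R * M ^+ n.
Proof.
move=> BM; rewrite (le_trans (normc_sum _ _ _))//.
rewrite -perm.card_Sn mulr_natl -sumr_const; apply: ler_sum => s _.
rewrite Normc.normcM normcX normcNE Normc.normc1 expr1n mul1r normc_prod.
rewrite -[X in M ^+ X]card_ord -prodr_const.
by apply: ler_prod => i _; rewrite normc_ge0 BM.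
Qed.

Lemma normc_adj_le {R : realType} n (B : 'M[R[i]]_n) (M : R) :
  (forall i j, normc (B i j) <= M) -> forall i j,
  normc ((\adj B) i j) <= (n.-1)`!%:R * M ^+ n.-1.
Proof.
move=> BM i j; rewrite mxE Normc.normcM normcX normcNE Normc.normc1 expr1n mul1r.
by apply: normc_det_le => k l; rewrite !mxE.
Qed.

(** * A first interval of determined windows *)

Section Window.
Context {R : realType}.

(* [phi] matches the points [x0 + k gamma] injectively with rows [n], so that
   the matched entries of the window lie on the diagonal. *)
Lemma spread_matching (alpha gamma l : R) (m : nat) : 0 < alpha -> alpha < l ->
  l - alpha <= m%:R * (gamma - alpha) -> exists phi : R -> nat,
  forall w, 0 < w < alpha * m%:R + l - alpha ->
    [/\ (phi w < m)%N, 0 < w - (phi w)%:R * alpha < l &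
        forall w', w + gamma <= w' -> (phi w < phi w')%N].
Proof.
(* [Q] is the length of the union of the intervals n alpha + (0, l) for n < m. Cut into [m] equal
   pieces, its n-th piece lies in the n-th interval, and a piece is no longer than gamma by [mg]; so
   [phi w] is the number of the piece of [w]. *)
move=> a0 al mg; set Q := alpha * m%:R + l - alpha.
have Q0 : 0 < Q by rewrite /Q -addrA ltr_wpDl ?mulr_ge0 ?subr_gt0// ltW.
exists (fun w => Num.truncn (m%:R * w / Q)) => w /andP[w0 wQ].
have z0 : 0 <= m%:R * w / Q by rewrite divr_ge0 ?mulr_ge0// ltW.
have /andP[t1 t2] := truncn_itv z0.
set phi := Num.truncn _ in t1 t2 *.
have h1 : alpha * (m%:R * w / Q) = w - w * (l - alpha) / Q.
  by rewrite /Q; field; rewrite gt_eqF.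
have h2 : 0 < w * (l - alpha) / Q by rewrite divr_gt0// mulr_gt0// subr_gt0.
have h3 : w * (l - alpha) / Q < l - alpha.
  by rewrite ltr_pdivrMr// [X in _ < X]mulrC ltr_pM2r// subr_gt0.
have h4 : alpha * phi%:R <= alpha * (m%:R * w / Q) by rewrite ler_wpM2l// ltW.
have h5 : alpha * (m%:R * w / Q) < alpha * phi.+1%:R by rewrite ltr_pM2l.
rewrite -natr1 mulrDr mulr1 in h5.
have mpos : 0 < m%:R :> R.
  rewrite ltr0n lt0n; apply/eqP => m0; move: mg; rewrite m0 mul0r; lra.
split.
- rewrite truncn_lt_nat// ltr_pdivrMr// ltr_pM2l//.
- by rewrite (mulrC phi%:R); apply/andP; split; lra.
move=> w' ww'; rewrite truncn_gt_nat -natr1.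
have : m%:R * (w + gamma) / Q <= m%:R * w' / Q.
  by rewrite ler_wpM2r ?invr_ge0 ?(ltW Q0)// ler_wpM2l.
have : 1 <= m%:R * gamma / Q by rewrite ler_pdivlMr// mul1r /Q; lra.
rewrite mulrDr [X in _ -> X <= _ -> _]mulrDl; lra.
Qed.

Lemma nat_ub (X Y : R) : exists m : nat, X <= m%:R /\ Y <= m%:R.
Proof.
exists (Num.truncn (`|X| + `|Y|)).+1.
have := real_truncnS_gt (num_real (`|X| + `|Y|)).
have := ler_norm X; have := ler_norm Y; have := normr_ge0 X; have := normr_ge0 Y.
by move=> *; split; lra.
Qed.

Variables (A : set R[i]) (f : R[i] -> R[i]) (z0 : R[i]).
Hypothesis A_lf : disc_finite A.
Hypothesis f_an : forall z, ~ A z -> analytic_at f z.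
Hypothesis z0_ess : essential_singularity f z0.
Hypothesis line_merom : forall z, complex.Im z = complex.Im z0 -> z <> z0 -> merom f z.

(** A square system: [K] unknowns h (x + k gamma) and [K] matched rows. Its determinant is nonzero
    at some real point, hence bounded below on an interval, where the adjugate solves the system
    with uniform constants. *)
Lemma window_exists (alpha gamma a b M : R) (g : R -> R[i]) (L : nat) :
  0 < alpha -> alpha < gamma -> alpha < b - a ->
  (forall x, g x = if a < x < b then f x%:C else 0) ->
  (forall x, normc (g x) <= M) ->
  (forall m n : int, m%:~R * alpha = n%:~R * gamma -> m = 0 /\ n = 0) ->
  exists c d N C, [/\ c < d, 0 <= N, 0 <= C &
    forall x, c < x < d -> window alpha gamma g L N C x].
Proof.
move=> al0 ag aab gE gM incommens.
have ga0 : 0 < gamma by exact: lt_trans ag.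
have M0 : 0 <= M by apply: le_trans (gM 0); exact: normc_ge0.
(* The first bound is the hypothesis of [spread_matching]; the second makes the system contain at
   least [L] unknowns. *)
have [m [m1 m2]] := nat_ub ((b - a - alpha) / (gamma - alpha))
   (((L%:R + 1) * gamma + alpha) / alpha).
rewrite ler_pdivrMr ?subr_gt0// in m1.
rewrite ler_pdivrMr// in m2.
have [phi phiP] := spread_matching al0 aab m1.
pose T := b + (m%:R - 1) * alpha.
pose Kb := (Num.truncn ((T - a) / gamma)).+1.
(* The endpoints of the supports of the rows, moved back by k gamma. On an interval free of them the
   pattern of zero entries is the same for all [x]. *)
pose S := \bigcup_(n in `I_m) \bigcup_(k in `I_Kb.+1)
  [set a + n%:R * alpha - k%:R * gamma; b + n%:R * alpha - k%:R * gamma].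
have Sfin : finite_set S.
  apply: bigcup_finite => [|n _]; first exact: finite_II.
  apply: bigcup_finite => [|k _]; first exact: finite_II.
  exact: finite_set2.
have aga : a < a + gamma by rewrite ltrDl.
have [c /andP[ac cg] cP] := finite_set_gap Sfin aga.
have sideS x y q : a < x < c -> a < y < c -> S q -> (q < x) = (q < y) /\ (x < q) = (y < q).
  move=> /andP[ax xc] /andP[ay yc] Sq.
  have qN : ~~ (a < q < c) by apply/negP => /cP.
  by rewrite negb_and -!leNgt in qN; case/orP: qN => h; split;
    apply/idP/idP => h'; lra.
have S1 (n k : nat) : (n < m)%N -> (k <= Kb)%N -> S (a + n%:R * alpha - k%:R * gamma).
  by move=> nm kK; exists n => //; exists k => //; left.
have S2 (n k : nat) : (n < m)%N -> (k <= Kb)%N -> S (b + n%:R * alpha - k%:R * gamma).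
  by move=> nm kK; exists n => //; exists k => //; right.
pose x0 := (a + c) / 2.
have x0ac : a < x0 < c by rewrite /x0; lra.
have /andP[ax0 x0c] := x0ac.
have mpos : (0 < m)%N.
  rewrite lt0n; apply/eqP => m0; move: m2; rewrite m0 mul0r.
  have : 0 <= (L%:R + 1) * gamma by rewrite mulr_ge0 ?addr_ge0// ltW.
  lra.
have Tx0 : L%:R * gamma < T - x0 by rewrite /T; lra.
have Tx00 : 0 <= (T - x0) / gamma.
  rewrite divr_ge0 ?(ltW ga0)// (le_trans _ (ltW Tx0))// mulr_ge0// ltW//.
(* The number of points x0 + k gamma, k >= 0, not beyond the right end [T] of the last support.
   Points with k < 0 lie left of [a], since c <= a + gamma. *)
pose K := (Num.truncn ((T - x0) / gamma)).+1.
have /andP[K1 K2] := truncn_itv Tx00.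
rewrite -/K ltr_pdivrMr// in K2; rewrite ler_pdivlMr// in K1.
have KKb : (K <= Kb)%N.
  rewrite ltnS le_truncn// ler_wpM2r ?invr_ge0 ?(ltW ga0)//; lra.
have LK : (L <= K)%N.
  have : L%:R * gamma < K%:R * gamma by lra.
  by rewrite ltr_pM2r// ltr_nat => /ltnW.
have mT : T = b + m.-1%:R * alpha by rewrite /T -{1}(prednK mpos) -natr1; ring.
pose w (k : nat) := x0 + k%:R * gamma - a.
have wP (k : 'I_K) : 0 < w k < alpha * m%:R + (b - a) - alpha.
  have kg : 0 <= k%:R * gamma by rewrite mulr_ge0// ltW.
  apply/andP; split; first by rewrite /w; lra.
  have kK : k%:R * gamma <= (Num.truncn ((T - x0) / gamma))%:R * gamma.
    by rewrite ler_wpM2r ?(ltW ga0)// ler_nat -ltnS.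
  rewrite lt_neqAle; apply/andP; split; last by rewrite /w; move: K1; rewrite /T; lra.
  (* Equality would put x0 itself in [S]. *)
  apply/eqP => wE; apply: (cP x0 x0ac).
  rewrite (_ : x0 = b + m.-1%:R * alpha - k%:R * gamma).
    by apply: S2; [rewrite prednK|apply: leq_trans KKb; exact: ltnW].
  by move: wE; rewrite -mT /T /w; lra.
pose ph (k : 'I_K) := phi (w k).
have ph1 (k : 'I_K) : (ph k < m)%N by case: (phiP _ (wP k)).
have ph2 (k : 'I_K) : 0 < w k - (ph k)%:R * alpha < b - a by case: (phiP _ (wP k)).
have ph_mono (k k' : 'I_K) : (k < k')%N -> (ph k < ph k')%N.
  move=> kk'; have [_ _] := phiP _ (wP k); apply.
  have : k.+1%:R * gamma <= k'%:R * gamma by rewrite ler_wpM2r ?(ltW ga0)// ler_nat.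
  by rewrite -natr1 /w; lra.
have ph_inj (k k' : 'I_K) : ph k = ph k' -> k = k'.
  move=> pkk; apply: val_inj; case: (ltngtP k k') => // /ph_mono; rewrite pkk ltnn//.
pose s (i k : 'I_K) := k%:R * gamma - (ph i)%:R * alpha.
pose e (i k : 'I_K) := a < x0 + s i k < b.
have ei i : e i i.
  by rewrite /e /s; have := ph2 i; rewrite /w => /andP[h1 h2]; apply/andP; split; lra.
have s_inj (i j i' j' : 'I_K) : s i j = s i' j' -> i = i' /\ j = j'.
  rewrite /s => h.
  have : ((ph i)%:Z - (ph i')%:Z)%:~R * alpha = (j%:Z - j'%:Z)%:~R * gamma.
    by rewrite !intrB -!pmulrn; lra.
  move/incommens => [/eqP + /eqP]; rewrite !subr_eq0 !eqz_nat => /eqP/ph_inj -> /eqP.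
  by move/val_inj.
have eE x (i k : 'I_K) : a < x < c -> (a < x + s i k < b) = e i k.
  move=> xac; have kK : (k <= Kb)%N by apply: leq_trans KKb; exact: ltnW.
  have [h1 _] := sideS x x0 _ xac x0ac (S1 _ _ (ph1 i) kK).
  have [_ h2] := sideS x x0 _ xac x0ac (S2 _ _ (ph1 i) kK).
  have rl (y : R) : (a < y + s i k < b) =
     (a + (ph i)%:R * alpha - k%:R * gamma < y) && (y < b + (ph i)%:R * alpha - k%:R * gamma).
    by rewrite /s; apply/idP/idP => /andP[? ?]; apply/andP; split; lra.
  by rewrite /e !rl h1 h2.
have mxE' x : a < x < c -> forall i k : 'I_K,
    translates_mx f e s x%:C i k = g (x + k%:R * gamma - (ph i)%:R * alpha).
  move=> xac i k; rewrite mxE gE -addrA -/(s i k) eE//.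
  by rewrite (rmorphD _ x (s i k)).
have [x1 x1ac [x1S x1D]] :=
  translates_det_real A_lf f_an z0_ess line_merom ac ei s_inj.
set D := \det _ in x1D.
have D0 : 0 < normc D by rewrite normc_gt0.
(* On this neighbourhood of [x1] the determinant keeps at least half of its modulus. *)
have [r r0 rP] := analytic_at_cont (translates_det_analytic f_an e x1S)
   (divr_gt0 D0 (ltr0n _ 2)).
pose Cb : R := (K.-1)`!%:R * M ^+ K.-1.
have Cb0 : 0 <= Cb by rewrite mulr_ge0// exprn_ge0.
pose N := m%:R * alpha + (`|a| + `|c|) + K%:R * gamma.
have N0 : 0 <= N by rewrite !addr_ge0// mulr_ge0// ltW.
have /andP[ax1 x1c] := x1ac.
exists (Num.max a (x1 - r) + K%:R * gamma), (Num.min c (x1 + r) + K%:R * gamma),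
  N, (K%:R * Cb / (normc D / 2)).
split => //.
- rewrite ltrD2r gt_max !lt_min.
  by apply/andP; split; apply/andP; split; lra.
- by rewrite !mulr_ge0 ?invr_ge0 ?mulr_ge0 ?exprn_ge0 ?normc_ge0.
move=> x' x'cd.
pose x := x' - K%:R * gamma.
have /andP[xm xM] : Num.max a (x1 - r) < x < Num.min c (x1 + r) by rewrite /x; lra.
rewrite gt_max in xm; rewrite lt_min in xM.
have [/andP[ax xr] /andP[xc xr']] := (xm, xM).
have xac : a < x < c by rewrite ax.
have Dx : normc D / 2 <= normc (\det (translates_mx f e s x%:C)).
  have := rP x%:C; rewrite -rmorphB normc_real ltr_norml => h.
  have /h : (- r < x - x1) && (x - x1 < r) by apply/andP; split; lra.
  rewrite -/D normcB => h'; have := ler_normc_sub D (\det (translates_mx f e s x%:C)).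
  by lra.
have Krow h i : gabor_row alpha gamma g h (ph i)%:Z x =
    \sum_(k < K) g (x + k%:R * gamma - (ph i)%:R * alpha) * h (x + k%:R * gamma).
  rewrite /gabor_row (@persumE _ _ _ _ 0 K); first by apply: eq_bigr => k _; rewrite mulrC add0r.
  move=> k; rewrite add0r gE => -[k0|Kk]; rewrite ifF ?mulr0//; apply/negP => /andP[ga gb].
    have : (k + 1)%:~R <= 0%:~R :> R by rewrite ler_int lezD1.
    rewrite intrD -[0%:~R]/(0 : R) -[1%:~R]/(1 : R) => k1.
    have : (k%:~R + 1) * gamma <= 0 * gamma by rewrite ler_wpM2r ?(ltW ga0).
    have : 0 <= (ph i)%:Z%:~R * alpha by rewrite -pmulrn mulr_ge0// ltW.
    by lra.
  have : K%:Z%:~R <= k%:~R :> R by rewrite ler_int.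
  rewrite -pmulrn => Kk'.
  have : K%:R * gamma <= k%:~R * gamma by rewrite ler_wpM2r ?(ltW ga0).
  have : (ph i)%:Z%:~R * alpha <= m.-1%:R * alpha.
    by rewrite -pmulrn ler_wpM2r ?(ltW al0)// ler_nat -ltnS prednK.
  have mm : (m.-1 < m)%N by rewrite prednK.
  (* [T - K gamma] is a point of [S] to the left of [x0], hence to the left of [x]: the point x + K
     gamma is beyond every support. *)
  have [+ _] := sideS x x0 _ xac x0ac (S2 m.-1 K mm KKb).
  rewrite -mT.
  have -> : T - K%:R * gamma < x0 by lra.
  by move=> hx; rewrite mT in hx; lra.
move=> j /andP[j0 jL].
have jK : (K - j < K)%N by rewrite ltn_subLR ?(leq_trans jL)// addnC -ltn_subLR// subnn.
pose k0 : 'I_K := Ordinal jK.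
have -> : x' - j%:R * gamma = x + k0%:R * gamma.
  by rewrite /x /= natrB ?(leq_trans jL)//; ring.
move=> h eps eps0 H.
have rowle i : normc (gabor_row alpha gamma g h (ph i)%:Z x) <= eps.
  rewrite -(gabor_row_shift _ _ _ _ _ _ k0%:Z) -pmulrn; apply: H.
  rewrite -pmulrn.
  have : 0 <= (ph i)%:R * alpha <= m%:R * alpha.
    by rewrite mulr_ge0 ?(ltW al0)//= ler_wpM2r ?(ltW al0)// ler_nat ltnW.
  have : 0 <= k0%:R * gamma <= K%:R * gamma.
    by rewrite mulr_ge0 ?(ltW ga0)//= ler_wpM2r ?(ltW ga0)// ler_nat ltnW.
  have := ler_norm c; have := ler_norm (- a); rewrite normrN.
  have := normr_ge0 a; have := normr_ge0 c.
  move=> ? ? ? ? /andP[? ?] /andP[? ?].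
  by rewrite /N ler_norml; apply/andP; split; lra.
set B := translates_mx f e s x%:C in Dx.
have BM i k : normc (B i k) <= M by rewrite /B mxE'.
have sol : \det B * h (x + k0%:R * gamma) =
    \sum_i (\adj B) k0 i * gabor_row alpha gamma g h (ph i)%:Z x.
  pose hv : 'cV[R[i]]_K := \col_k h (x + k%:R * gamma).
  have := congr1 (fun X : 'M[R[i]]_K => (X *m hv) k0 ord0) (mul_adj_mx B).
  rewrite -mulmxA mul_scalar_mx !mxE => <-; apply: eq_bigr => i _; congr (_ * _).
  by rewrite Krow mxE; apply: eq_bigr => k _; rewrite /B mxE'// mxE.
have : normc (\det B * h (x + k0%:R * gamma)) <= K%:R * Cb * eps.
  rewrite sol (le_trans (normc_sum _ _ _))//.
  rewrite -mulrA mulr_natl -[X in _ *+ X]card_ord -sumr_const; apply: ler_sum => i _.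
  by rewrite Normc.normcM ler_pM ?normc_ge0// normc_adj_le.
rewrite Normc.normcM => Dh.
rewrite mulrAC ler_pdivlMr ?divr_gt0// mulrC; apply: le_trans Dh.
by rewrite ler_wpM2r ?normc_ge0.
Qed.

End Window.

(** * Translations and partitions of the Lebesgue integral *)

Section Translation.
Context {R : realType}.
Let mu := @lebesgue_measure R.
Implicit Types (c d s t : R).

Lemma measurable_fun_translate s : measurable_fun [set: R] (fun x : R => x + s).
Proof. by apply: measurable_funD => //; exact: measurable_cst. Qed.

Lemma preimage_translate_itv s c d :
  (fun x => x + s) @^-1` `[c + s, d + s[ = `[c, d[%classic.
Proof.
by apply/seteqP; split => x /=; rewrite !in_itv /= lerD2r ltrD2r.
Qed.

(** By uniqueness: the pushforward under the translation agrees with Lebesgue measure on half-open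
    intervals. *)
Lemma lebesgue_measure_translate s (A : set R) : measurable A ->
  pushforward mu (fun x : R => x + s : measurableTypeR R) A = mu A.
Proof.
move=> mA; apply/esym.
have mphi : measurable_fun [set: R] (fun x : R => x + s : measurableTypeR R).
  exact: measurable_fun_translate.
pose phi_mixin := isMeasurableFun.Build _ _ _ _ _ mphi.
pose phi : {mfun _ >-> _} := HB.pack (fun x : R => x + s : measurableTypeR R) phi_mixin.
apply: (@lebesgue_measure_unique R (pushforward mu phi)) => //= _ [[a b]] _ <-.
rewrite /pushforward /=.
rewrite [X in _ = mu X](_ : _ = `]a - s, b - s]%classic); last first.
  by apply/seteqP; split => x /=; rewrite !in_itv /= ltrBlDr lerBrDr.
rewrite /mu !lebesgue_measure_itv /= !lte_fin ltrD2r; case: ifP => // _.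
by rewrite -!EFinB; congr (_%:E); ring.
Qed.

Lemma ge0_integral_translate_preimage (f : R -> \bar R) (D : set (measurableTypeR R)) s :
  measurable D -> measurable_fun [set: R] f -> (forall x, 0 <= f x)%E ->
  (\int[mu]_(x in (fun x : R => (x + s)%R : measurableTypeR R) @^-1` D) f (x + s)%R =
   \int[mu]_(x in D) f x)%E.
Proof.
move=> mD mf f0.
have mphi : measurable_fun [set: R] (fun x : R => x + s : measurableTypeR R).
  exact: measurable_fun_translate.
transitivity (\int[mu]_(x in (fun x : R => (x + s)%R : measurableTypeR R) @^-1` D)
   (f \o (fun x : R => (x + s)%R : measurableTypeR R)) x)%E; first by [].
rewrite -ge0_integral_pushforward//=; last exact: measurable_funS mf.
by apply: eq_measure_integral => A mA _; exact: lebesgue_measure_translate.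
Qed.

Lemma ge0_integral_translate (f : R -> \bar R) c d s : measurable_fun [set: R] f ->
  (forall x, 0 <= f x)%E ->
  (\int[mu]_(x in `[c, d[) f (x + s)%R = \int[mu]_(x in `[(c + s)%R, (d + s)%R[) f x)%E.
Proof.
move=> mf f0; rewrite -(@ge0_integral_translate_preimage f _ s _ mf f0)//.
by rewrite preimage_translate_itv.
Qed.

Lemma integral_translate_preimage (f : R -> \bar R) (D : set (measurableTypeR R)) s :
  measurable D -> measurable_fun [set: R] f ->
  (\int[mu]_(x in (fun x : R => (x + s)%R : measurableTypeR R) @^-1` D) f (x + s)%R =
   \int[mu]_(x in D) f x)%E.
Proof.
move=> mD mf; rewrite integralE [RHS]integralE.
rewrite -(ge0_integral_translate_preimage s mD (measurable_funepos mf)); last first.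
  by move=> x; exact: funepos_ge0.
rewrite -(ge0_integral_translate_preimage s mD (measurable_funeneg mf)).
  by congr (_ - _)%E; apply: eq_integral => x _; rewrite ?funeposE ?funenegE.
by move=> x; exact: funeneg_ge0.
Qed.

Lemma integral_translate (f : R -> \bar R) c d s : measurable_fun [set: R] f ->
  (\int[mu]_(x in `[c, d[) f (x + s)%R = \int[mu]_(x in `[(c + s)%R, (d + s)%R[) f x)%E.
Proof.
move=> mf; rewrite -(@integral_translate_preimage f _ s _ mf)//.
by rewrite preimage_translate_itv.
Qed.

(** An enumeration of the integers that turns sums over [int] into series, to which countable
    additivity of the integral applies. *)
Definition int_of_nat (k : nat) : int := if odd k then Negz k./2 else Posz k./2.

Lemma int_of_nat_bij : set_bij [set: nat] [set: int] int_of_nat.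
Proof.
rewrite setTT_bijective.
exists (fun z => match z with Posz n => n.*2 | Negz n => n.*2.+1 end).
  move=> k; rewrite /int_of_nat; case: ifP => ok; rewrite -[RHS]odd_double_half ok//.
case=> n; rewrite /int_of_nat /= odd_double //=; first by rewrite doubleK.
by rewrite uphalf_double.
Qed.

Lemma esum_int (a : int -> \bar R) : (forall i, 0 <= a i)%E ->
  (\esum_(i in [set: int]) a i = \sum_(k <oo) a (int_of_nat k))%E.
Proof.
by move=> a0; rewrite (reindex_esum _ _ _ _ int_of_nat_bij) nneseries_esumT.
Qed.

Lemma ge0_integral_int_partition (f : R -> \bar R) c alpha : 0 < alpha ->
  measurable_fun [set: R] f -> (forall x, 0 <= f x)%E ->
  (\int[mu]_x f x = \esum_(n in [set: int])
     \int[mu]_(x in `[c, (c + alpha)%R[) f (x + n%:~R * alpha)%R)%E.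
Proof.
move=> al0 mf f0.
rewrite esum_int; last by move=> i; apply: integral_ge0.
pose F k := `[c + (int_of_nat k)%:~R * alpha, c + alpha + (int_of_nat k)%:~R * alpha[%classic.
have FT : \bigcup_k F k = [set: R].
  apply/seteqP; split => // x _.
  pose n := Num.floor ((x - c) / alpha).
  have [k _ kn] : [set int_of_nat k | k in [set: nat]] n.
    by case: int_of_nat_bij => _ _; apply.
  exists k => //; rewrite /F /= kn in_itv /=.
  have /andP[h1 h2] := real_floor_itv (num_real ((x - c) / alpha)).
  rewrite ler_pdivlMr// in h1; rewrite intrD ltr_pdivrMr// in h2.
  by rewrite -/n in h1 h2; apply/andP; split; lra.
rewrite -FT ge0_integral_bigcup//.
- by apply: eq_eseriesr => k _; rewrite ge0_integral_translate.
- by move=> k; exact: measurable_itv.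
- by rewrite FT.
apply/trivIsetP => i j _ _ ij; apply/seteqP; split => // x /= [].
rewrite /F /= !in_itv /= => /andP[i1 i2] /andP[j1 j2].
move/eqP: ij; apply; have [_ + _] := int_of_nat_bij; apply; [exact: mem_set|exact: mem_set|].
move: i1 i2 j1 j2; set p := int_of_nat i; set q := int_of_nat j => i1 i2 j1 j2.
have aux (u v : int) : c + u%:~R * alpha <= x -> x < c + alpha + v%:~R * alpha -> u <= v.
  move=> h1 h2; rewrite -ltzD1 -(@ltr_int R) intrD.
  rewrite -(ltr_pM2r al0) mulrDl mul1r; lra.
have pq := aux p q i1 j2.
have qp := aux q p j1 i2.
by apply: le_anti; rewrite pq qp.
Qed.

Lemma ge0_integral_itv_split (f : R -> \bar R) c gamma m : 0 < gamma ->
  measurable_fun [set: R] f -> (forall x, 0 <= f x)%E ->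
  (\int[mu]_(x in `[c, (c + m%:R * gamma)%R[) f x = \sum_(j < m)
     \int[mu]_(x in `[c, (c + gamma)%R[) f (x + j%:R * gamma)%R)%E.
Proof.
move=> g0 mf f0; elim: m => [|m IH].
  by rewrite big_ord0 mul0r addr0 set_itvco0 integral_set0.
have mg0 : 0 <= m%:R * gamma by rewrite mulr_ge0// ltW.
have e : c + m.+1%:R * gamma = c + gamma + m%:R * gamma by rewrite -natr1; ring.
rewrite big_ord_recr -IH /= ge0_integral_translate// -e.
rewrite -ge0_integral_setU//=.
- congr (integral _ _ _); apply/seteqP; split => x /=; rewrite !in_itv /=.
    move=> /andP[cx xc]; case: (ltP x (c + m%:R * gamma)) => h; [left|right].
      by rewrite cx.
    by rewrite xc.
  by case => /andP[h1 h2]; apply/andP; split => //; lra.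
- exact: measurable_funTS.
by apply/disj_setPS => x [] /=; rewrite !in_itv /= => /andP[_ h1] /andP[h2 _]; lra.
Qed.

Lemma Rintegral_itv_split (f : R -> R) c gamma m : 0 < gamma ->
  measurable_fun [set: R] f ->
  mu.-integrable `[c, c + m%:R * gamma[ (EFin \o f) ->
  (\int[mu]_(x in `[c, c + m%:R * gamma[) f x = \sum_(j < m)
     \int[mu]_(x in `[c, c + gamma[) f (x + j%:R * gamma))%R.
Proof.
move=> g0 mf; elim: m => [|m IH] fi.
  by rewrite big_ord0 mul0r addr0 set_itvco0 Rintegral_set0.
have mg0 : 0 <= m%:R * gamma by rewrite mulr_ge0// ltW.
have e : c + m.+1%:R * gamma = c + gamma + m%:R * gamma by rewrite -natr1; ring.
have sU : `[c, c + m.+1%:R * gamma[%classic =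
   `[c, c + m%:R * gamma[ `|` `[c + m%:R * gamma, c + m.+1%:R * gamma[.
  apply/seteqP; split => x /=; rewrite !in_itv /=.
    move=> /andP[cx xc]; case: (ltP x (c + m%:R * gamma)) => h; [left|right].
      by rewrite cx.
    by rewrite xc.
  by case => /andP[h1 h2]; apply/andP; split => //; lra.
rewrite big_ord_recr -IH /=; last first.
  by apply: integrableS fi => //; rewrite sU; exact: subsetUl.
rewrite sU Rintegral_setU//=.
- congr (_ + fine _); rewrite e.
  by rewrite (integral_translate c (c + gamma) (m%:R * gamma) (f := EFin \o f))//; exact/measurable_EFinP.
- by rewrite -sU.
by apply/disj_setPS => x [] /=; rewrite !in_itv /= => /andP[_ h1] /andP[h2 _]; lra.
Qed.

End Translation.

(** * Complex-valued square-integrable functions *)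

Section ComplexMeasurable.
Context {R : realType}.
Let mu := @lebesgue_measure R.
Implicit Types (D : set R) (F G : R -> R[i]) (c : R[i]).

Lemma cmeasurable_cst D c : cmeasurable_fun D (fun=> c).
Proof. by split; exact: measurable_cst. Qed.

Lemma cmeasurableD D F G : cmeasurable_fun D F -> cmeasurable_fun D G ->
  cmeasurable_fun D (fun x => F x + G x).
Proof.
move=> [F1 F2] [G1 G2]; split.
  by apply: (eq_measurable_fun _ _ (measurable_funD F1 G1)) => x _ /=; case: (F x); case: (G x).
by apply: (eq_measurable_fun _ _ (measurable_funD F2 G2)) => x _ /=; case: (F x); case: (G x).
Qed.

Lemma cmeasurableM D F G : cmeasurable_fun D F -> cmeasurable_fun D G ->
  cmeasurable_fun D (fun x => F x * G x).
Proof.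
move=> [F1 F2] [G1 G2]; split.
  apply: (eq_measurable_fun _ _ (measurable_funB (measurable_funM F1 G1) (measurable_funM F2 G2))).
  by move=> x _ /=; case: (F x); case: (G x).
apply: (eq_measurable_fun _ _ (measurable_funD (measurable_funM F1 G2) (measurable_funM F2 G1))).
by move=> x _ /=; case: (F x); case: (G x).
Qed.

Lemma cmeasurable_conj D F : cmeasurable_fun D F -> cmeasurable_fun D (fun x => (F x)^*%C).
Proof.
move=> [F1 F2]; split.
  by apply: (eq_measurable_fun _ _ F1) => x _ /=; case: (F x).
apply: (eq_measurable_fun _ _ (measurable_funN F2)) => x _ /=; by case: (F x).
Qed.

Lemma cmeasurable_sum D (I : Type) (s : seq I) (F : I -> R -> R[i]) :
  (forall i, cmeasurable_fun D (F i)) -> cmeasurable_fun D (fun x => \sum_(i <- s) F i x).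
Proof.
move=> mF; elim: s => [|i s IH].
  rewrite (_ : (fun x => _) = fun=> 0); first exact: cmeasurable_cst.
  by apply/funext => x; rewrite big_nil.
rewrite (_ : (fun x => _) = fun x => F i x + \sum_(i <- s) F i x); first exact: cmeasurableD.
by apply/funext => x; rewrite big_cons.
Qed.

Lemma cmeasurable_real D (f : R -> R) : measurable_fun D f -> cmeasurable_fun D (fun x => (f x)%:C).
Proof. by move=> mf; split => //; exact: measurable_cst. Qed.

Lemma cmeasurableS D D' F : measurable D' -> D `<=` D' -> cmeasurable_fun D' F ->
  cmeasurable_fun D F.
Proof.
by move=> mD' DD [F1 F2]; split; [exact: measurable_funS F1|exact: measurable_funS F2].
Qed.

Lemma cmeasurable_translate F s : cmeasurable_fun setT F ->
  cmeasurable_fun setT (fun x => F (x + s)).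
Proof.
move=> [F1 F2]; split.
  exact: (measurableT_comp F1 (measurable_fun_translate s)).
exact: (measurableT_comp F2 (measurable_fun_translate s)).
Qed.

Lemma measurable_normc2 D F : cmeasurable_fun D F ->
  measurable_fun D (fun x => normc (F x) ^+ 2).
Proof.
move=> [F1 F2].
apply: (eq_measurable_fun _ _ (measurable_funD (measurable_funX 2 F1) (measurable_funX 2 F2))).
by move=> x _ /=; rewrite normc_sqr.
Qed.

Definition nsq D F : \bar R := (\int[mu]_(x in D) (normc (F x) ^+ 2)%:E)%E.

Lemma nsq_ge0 D F : (0 <= nsq D F)%E.
Proof. by apply: integral_ge0 => x _; rewrite lee_fin sqr_ge0. Qed.

Lemma emeasurable_normc2 D F : cmeasurable_fun D F ->
  measurable_fun D (fun x => (normc (F x) ^+ 2)%:E).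
Proof. by move=> mF; apply/measurable_EFinP; exact: measurable_normc2. Qed.

Lemma le_nsq D F (g : R -> R) : measurable D -> cmeasurable_fun D F -> measurable_fun D g ->
  (forall x, D x -> normc (F x) ^+ 2 <= g x) ->
  (nsq D F <= \int[mu]_(x in D) (g x)%:E)%E.
Proof.
move=> mD mF mg Fg; apply: ge0_le_integral => //.
- by move=> x _; rewrite lee_fin sqr_ge0.
- exact: emeasurable_normc2.
- exact/measurable_EFinP.
Qed.

Lemma normc_sqD (z w : R[i]) : normc (z + w) ^+ 2 <= 2 * normc z ^+ 2 + 2 * normc w ^+ 2.
Proof.
have := ler_normcD z w; have := normc_ge0 z; have := normc_ge0 w; have := normc_ge0 (z + w).
set a := normc (z + w); set b := normc z; set c := normc w => a0 c0 b0 abc.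
have h : a ^+ 2 <= (b + c) ^+ 2 by rewrite lerXn2r// nnegrE// addr_ge0.
by have := sqr_ge0 (b - c); rewrite !expr2 in h *; lra.
Qed.

(** A substitute for Minkowski's inequality; its factors 2 are why approximation errors are later
    split into quarters. *)
Lemma nsqD D F G : measurable D -> cmeasurable_fun D F -> cmeasurable_fun D G ->
  (nsq D (fun x => (F x + G x)%R) <= 2%:E * nsq D F + 2%:E * nsq D G)%E.
Proof.
move=> mD mF mG.
have m2 H : cmeasurable_fun D H -> measurable_fun D (fun x => 2 * normc (H x) ^+ 2).
  by move=> mH; apply: measurable_funM; [exact: measurable_cst|exact: measurable_normc2].
apply: (@le_trans _ _ (\int[mu]_(x in D) (2 * normc (F x) ^+ 2 + 2 * normc (G x) ^+ 2)%:E)%E).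
  apply: le_nsq => //; first exact: cmeasurableD.
    by apply: measurable_funD; exact: m2.
  by move=> x _; exact: normc_sqD.
under eq_integral do rewrite EFinD.
rewrite ge0_integralD//; first last.
- by apply/measurable_EFinP; exact: m2.
- by move=> x _; rewrite lee_fin mulr_ge0// sqr_ge0.
- by apply/measurable_EFinP; exact: m2.
- by move=> x _; rewrite lee_fin mulr_ge0// sqr_ge0.
under eq_integral do rewrite EFinM.
under [X in (_ + X <= _)%E]eq_integral do rewrite EFinM.
rewrite !ge0_integralZl_EFin// ?lexx//; try exact: emeasurable_normc2;
  by move=> x _; rewrite lee_fin sqr_ge0.
Qed.

Lemma nsqZ D F c : measurable D -> cmeasurable_fun D F ->
  nsq D (fun x => c * F x)%R = ((normc c ^+ 2)%:E * nsq D F)%E.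
Proof.
move=> mD mF; rewrite /nsq -ge0_integralZl_EFin//.
- by apply: eq_integral => x _; rewrite Normc.normcM exprMn EFinM.
- by move=> x _; rewrite lee_fin sqr_ge0.
- exact: emeasurable_normc2.
exact: sqr_ge0.
Qed.

Lemma nsq_sequence_small D F (F_ : nat -> R -> R[i]) (g : R -> R) : measurable D ->
  cmeasurable_fun D F -> (forall n, cmeasurable_fun D (F_ n)) ->
  mu.-integrable D (EFin \o g) ->
  (forall x, D x -> (fun n => normc (F x - F_ n x) ^+ 2) @ \oo --> (0 : R)) ->
  (forall n x, D x -> normc (F x - F_ n x) ^+ 2 <= g x) ->
  forall e : R, 0 < e -> exists n, (nsq D (fun x => F x - F_ n x)%R <= e%:E)%E.
Proof.
move=> mD mF mF_ ig cvgF dom e e0.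
have mdiff n : cmeasurable_fun D (fun x => F x - F_ n x)%R.
  apply: (@cmeasurableD _ F (fun x => - F_ n x)) => //.
  rewrite (_ : (fun x => _) = fun x => -1 * F_ n x)%R.
    by apply: cmeasurableM => //; exact: cmeasurable_cst.
  by apply/funext => x; rewrite mulN1r.
pose f_ n x : \bar R := (normc (F x - F_ n x) ^+ 2)%:E.
have cv : {ae mu, forall x, D x -> f_ ^~ x @ \oo --> (cst 0 : R -> \bar R) x}.
  apply: aeW => x Dx; apply/fine_cvgP; split; [exact: nearW|exact: cvgF].
have dm : {ae mu, forall x n, D x -> (`|f_ n x| <= (EFin \o g) x)%E}.
  by apply: aeW => x n Dx; rewrite gee0_abs ?lee_fin ?sqr_ge0//; exact: dom.
have [_ _] := @dominated_convergence _ _ _ mu D mD f_ (cst 0) (EFin \o g)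
  (fun n => emeasurable_normc2 (mdiff n)) (measurable_cst _) cv ig dm.
rewrite integral0 => /fine_cvgP[fin cvf].
have [N _ /(_ N (leqnn N)) [/= finN ltN]] : \forall n \near \oo,
    nsq D (fun x => F x - F_ n x) \is a fin_num /\ fine (nsq D (fun x => F x - F_ n x)) < e.
  by near=> n; split; near: n; [exact: fin|exact: (cvgr_lt _ cvf)].
by exists N; rewrite -(fineK finN) lee_fin ltW.
Unshelve. all: by end_near. Qed.

End ComplexMeasurable.

Section Expi.
Context {R : realType}.
Implicit Types (x y : R).

Lemma expi0 : expi (0 : R) = 1.
Proof. by rewrite /expi cos0 sin0. Qed.

Lemma expiD x y : expi (x + y) = expi x * expi y.
Proof.
rewrite /expi cosD sinD; apply/eqP; rewrite eq_complex /=; apply/andP; split; apply/eqP => //.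
by rewrite addrC [sin x * _]mulrC addrC mulrC.
Qed.

Lemma expiN x : expi (- x) = (expi x)^*%C.
Proof. by rewrite /expi cosN sinN. Qed.

Lemma normc_expi x : normc (expi x) = 1.
Proof. by rewrite /= cos2Dsin2 sqrtr1. Qed.

Lemma expi_periodic x : expi (x + pi *+ 2) = expi x.
Proof. by rewrite /expi cosD2pi sinD2pi. Qed.

Lemma expi_2pi_int (k : int) : expi (2 * pi * k%:~R) = 1 :> R[i].
Proof.
have nat (n : nat) : expi (2 * pi * n%:R) = 1 :> R[i].
  elim: n => [|n IH]; first by rewrite mulr0 expi0.
  by rewrite -(natr1 n) mulrDr mulr1 [2 * pi]mulr_natl expi_periodic -mulr_natl.
case: k => n; first exact: nat.
by rewrite NegzE rmorphN /= mulrN expiN -pmulrn nat; apply/eqP; rewrite eq_complex /= oppr0 !eqxx.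
Qed.

Lemma measurable_expi (w : R) : cmeasurable_fun setT (fun x => expi (w * x)).
Proof.
have mw : measurable_fun [set: R] (fun x : R => w * x) by exact: mulrl_measurable.
split; apply: (@measurableT_comp _ _ _ _ _ _ _ _ _ _ mw); apply: continuous_measurable_fun.
  exact: continuous_cos.
exact: continuous_sin.
Qed.

End Expi.

(** * Density of trigonometric polynomials *)

Section Threshold.
Context {R : realType}.
Implicit Types (y q : R).

Lemma bernoulli_add y k : 0 <= y -> 1 + k%:R * y <= (1 + y) ^+ k.
Proof.
move=> y0; elim: k => [|k IH]; first by rewrite mul0r addr0 expr0.
have h : 0 <= 1 + y by rewrite addr_ge0.
rewrite exprS; apply: le_trans (ler_wpM2l h IH).
have : 0 <= k%:R * y * y by rewrite mulr_ge0// mulr_ge0.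
by rewrite -natr1; lra.
Qed.

Lemma bernoulli_sub y k : 0 <= y <= 1 -> 1 - k%:R * y <= (1 - y) ^+ k.
Proof.
move=> /andP[y0 y1]; elim: k => [|k IH]; first by rewrite mul0r subr0 expr0.
have h : 0 <= 1 - y by rewrite subr_ge0.
rewrite exprS; apply: le_trans (ler_wpM2l h IH).
have : 0 <= k%:R * y * y by rewrite mulr_ge0// mulr_ge0.
by rewrite -natr1; lra.
Qed.

(* [N 2^N y^N] tends to [0] below the threshold [1/2], and at least like [N] above. *)
Definition threshold (N : nat) y := (1 - y ^+ N) ^+ (N * 2 ^ N).

Lemma threshold_ge0le1 N y : 0 <= y <= 1 -> 0 <= threshold N y <= 1.
Proof.
move=> /andP[y0 y1]; have yN0 : 0 <= y ^+ N by rewrite exprn_ge0.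
have yN1 : y ^+ N <= 1 by rewrite exprn_ile1.
by rewrite /threshold exprn_ge0 ?subr_ge0// exprn_ile1// ?subr_ge0// lerBlDr lerDl.
Qed.

(** With v = y^N, the product of (1 - v)^(2^N) and (1 + v)^(2^N) is at most 1, and the second factor
    is at least 1 + 2^N v >= 2 by Bernoulli; so the first is at most 1/2. *)
Lemma threshold_ge N y : 1 / 2 <= y <= 1 -> threshold N y <= (1 / 2) ^+ N.
Proof.
move=> /andP[y2 y1]; have y0 : 0 <= y by lra.
have yN0 : 0 <= y ^+ N by rewrite exprn_ge0.
have yN1 : y ^+ N <= 1 by rewrite exprn_ile1.
rewrite /threshold mulnC exprM lerXn2r ?nnegrE ?exprn_ge0 ?subr_ge0//.
have h1 : (1 - y ^+ N) ^+ (2 ^ N) * (1 + y ^+ N) ^+ (2 ^ N) <= 1.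
  rewrite -exprMn exprn_ile1//; have := sqr_ge0 (y ^+ N); rewrite expr2; [|lra].
  by have : y ^+ N * y ^+ N <= 1 by [rewrite mulr_ile1|]; lra.
have h2 : 2 <= (1 + y ^+ N) ^+ (2 ^ N).
  apply: le_trans (bernoulli_add _ yN0).
  rewrite natrX -exprMn.
  have : 1 <= (2 * y) ^+ N by rewrite exprn_ege1//; lra.
  by lra.
set u := (1 - y ^+ N) ^+ (2 ^ N) in h1 *.
have u0 : 0 <= u by rewrite exprn_ge0// subr_ge0.
have : u * 2 <= u * (1 + y ^+ N) ^+ (2 ^ N) by rewrite ler_wpM2l.
lra.
Qed.

Lemma threshold_lt N y : 0 <= y <= 1 -> 1 - N%:R * (2 * y) ^+ N <= threshold N y.
Proof.
move=> /andP[y0 y1].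
have yN0 : 0 <= y ^+ N by rewrite exprn_ge0.
have yN1 : y ^+ N <= 1 by rewrite exprn_ile1.
apply: le_trans (bernoulli_sub _ _); last by rewrite yN0.
by rewrite natrM natrX exprMn mulrA.
Qed.

(** Write q = s^2: Bernoulli's inequality for 1/s bounds N s^N, and one factor s^N is left. *)
Lemma cvg_n_geometric q : 0 <= q < 1 -> (fun N : nat => N%:R * q ^+ N) @ \oo --> (0 : R).
Proof.
move=> /andP[q0 q1].
have [->|qN0] := eqVneq q 0.
  rewrite (_ : (fun N : nat => _) = fun=> 0); first exact: cvg_cst.
  by apply/funext => -[|N]; rewrite ?mul0r// exprS mul0r mulr0.
pose s := Num.sqrt q.
have qp : 0 < q by rewrite lt_neqAle eq_sym qN0.
have s0 : 0 < s by rewrite sqrtr_gt0.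
have s1 : s < 1 by rewrite -sqrtr1 ltr_sqrt.
have s2 : q = s * s by rewrite -expr2 sqr_sqrtr.
pose d := s^-1 - 1.
have d0 : 0 < d by rewrite subr_gt0 invf_gt1.
have bnd N : N%:R * q ^+ N <= d^-1 * s ^+ N.
  rewrite s2 exprMn mulrA ler_wpM2r ?exprn_ge0 ?(ltW s0)//.
  have h := bernoulli_add N (ltW d0).
  have -> : s = (1 + d)^-1 by rewrite /d addrC subrK invrK.
  have d1 : 0 < 1 + d by exact: addr_gt0.
  rewrite exprVn ler_pdivrMr ?exprn_gt0//.
  by rewrite mulrC ler_pdivlMr//; lra.
apply: (@squeeze_cvgr _ _ _ _ (fun=> 0) (fun N => d^-1 * s ^+ N)).
- by near=> N; rewrite bnd mulr_ge0// exprn_ge0// ltW.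
- exact: cvg_cst.
rewrite -(mulr0 d^-1); apply: cvgM; first exact: cvg_cst.
by apply: cvg_expr; rewrite ger0_norm// ltW.
Unshelve. all: by end_near. Qed.

Lemma threshold_cvg y : 0 <= y <= 1 ->
  threshold ^~ y @ \oo --> (if y < 1 / 2 then 1 else 0 : R).
Proof.
move=> /[dup] y01 /andP[y0 y1]; case: ltP => y2.
  apply: (@squeeze_cvgr _ _ _ _ (fun N => 1 - N%:R * (2 * y) ^+ N) (fun=> 1)).
  - by near=> N; rewrite threshold_lt//; have /andP[] := threshold_ge0le1 N y01.
  - rewrite -[X in _ --> X]subr0; apply: cvgB; first exact: cvg_cst.
    by apply: cvg_n_geometric; apply/andP; split; lra.
  - exact: cvg_cst.
apply: (@squeeze_cvgr _ _ _ _ (fun=> 0) (fun N => (1 / 2) ^+ N)).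
- by near=> N; rewrite threshold_ge ?y2//; have /andP[->] := threshold_ge0le1 N y01.
- exact: cvg_cst.
by apply: cvg_expr; rewrite ger0_norm; lra.
Unshelve. all: by end_near. Qed.

End Threshold.

Section Trig.
Context {R : realType}.
Variable beta : R.
Implicit Types (F G : R -> R[i]) (s t : seq (R[i] * int)).

Definition expmode (m : int) (x : R) : R[i] := expi (2 * pi * beta * m%:~R * x).

Lemma expmode0 x : expmode 0 x = 1.
Proof. by rewrite /expmode mulr0 mul0r expi0. Qed.

Lemma expmodeD m n x : expmode (m + n) x = expmode m x * expmode n x.
Proof. by rewrite /expmode -expiD intrD; congr expi; ring. Qed.

Lemma expmodeN m x : expmode (- m) x = (expmode m x)^*%C.
Proof. by rewrite /expmode -expiN rmorphN; congr expi; ring. Qed.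

Lemma expmode_add m x y : expmode m (x + y) = expmode m x * expmode m y.
Proof. by rewrite /expmode -expiD; congr expi; ring. Qed.

Lemma normc_expmode m x : normc (expmode m x) = 1.
Proof. exact: normc_expi. Qed.

Lemma cmeasurable_expmode m : cmeasurable_fun setT (expmode m).
Proof. exact: measurable_expi. Qed.

Definition trig s x : R[i] := \sum_(p <- s) p.1 * expmode p.2 x.

Definition istrig F := exists s, F = trig s.

Lemma istrig_cmeasurable F : istrig F -> cmeasurable_fun setT F.
Proof.
move=> [s ->]; apply: cmeasurable_sum => p; apply: cmeasurableM.
  exact: cmeasurable_cst.
exact: cmeasurable_expmode.
Qed.

Lemma istrig_expmode m : istrig (expmode m).
Proof. by exists [:: (1, m)]; apply/funext => x; rewrite /trig big_seq1 mul1r. Qed.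

Lemma istrig_cst (c : R[i]) : istrig (fun=> c).
Proof. by exists [:: (c, 0)]; apply/funext => x; rewrite /trig big_seq1 expmode0 mulr1. Qed.

Lemma istrigD F G : istrig F -> istrig G -> istrig (fun x => F x + G x).
Proof.
by move=> [s ->] [t ->]; exists (s ++ t); apply/funext => x; rewrite /trig big_cat.
Qed.

Lemma istrigM F G : istrig F -> istrig G -> istrig (fun x => F x * G x).
Proof.
move=> [s ->] [t ->].
exists [seq (p.1 * q.1, p.2 + q.2) | p <- s, q <- t]; apply/funext => x.
rewrite /trig big_allpairs_dep /= mulr_suml; apply: eq_bigr => p _.
by rewrite mulr_sumr; apply: eq_bigr => q _; rewrite expmodeD; ring.
Qed.

Lemma istrigX F n : istrig F -> istrig (fun x => F x ^+ n).
Proof.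
move=> tF; elim: n => [|n IH]; first exact: istrig_cst.
rewrite (_ : (fun x => _) = fun x => F x * F x ^+ n); first exact: istrigM.
by apply/funext => x; rewrite exprS.
Qed.

Lemma istrig_cos c0 : istrig (fun x => (cos (2 * pi * beta * (x - c0)))%:C).
Proof.
rewrite (_ : (fun x => _) = fun x => (1 / 2)%:C * (expmode 1 (- c0) * expmode 1 x +
   expmode (-1) (- c0) * expmode (-1) x)).
  apply: istrigM; first exact: istrig_cst.
  by apply: istrigD; apply: istrigM; try exact: istrig_cst; exact: istrig_expmode.
apply/funext => x; rewrite -!expmode_add expmodeN /expmode mulr1 addrC.
rewrite /expi; apply/eqP; rewrite eq_complex /=.
by apply/andP; split; apply/eqP; field.
Qed.

(** For fixed [N] the threshold is a polynomial, so it approximates an indicator function without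
    leaving the trigonometric polynomials. *)
Lemma istrig_threshold (u : R -> R) N : istrig (fun x => (u x)%:C) ->
  istrig (fun x => (threshold N (u x))%:C).
Proof.
move=> tF; rewrite (_ : (fun x => _) = fun x => (1 + (-1) * (u x)%:C ^+ N) ^+ (N * 2 ^ N)).
  apply: istrigX; apply: istrigD; first exact: istrig_cst.
  by apply: istrigM; [exact: istrig_cst|exact: istrigX].
by apply/funext => x; rewrite rmorphXn rmorphB rmorphXn /= mulN1r.
Qed.

End Trig.

Section TrigApprox.
Context {R : realType}.
Let mu := @lebesgue_measure R.
Variables (beta gamma c : R).
Hypothesis gamma0 : 0 < gamma.
Hypothesis beta_gamma : beta * gamma = 1.
Implicit Types (F G : R -> R[i]).

Let I := `[c, c + gamma[%classic.

Lemma measurable_period : measurable I.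
Proof. exact: measurable_itv. Qed.
Let mI := measurable_period.

Definition trig_approx F := cmeasurable_fun I F /\ forall e : R, 0 < e ->
  exists2 T, istrig beta T & (nsq I (fun x => F x - T x)%R <= e%:E)%E.

Lemma istrig_cmeasurable_period T : istrig beta T -> cmeasurable_fun I T.
Proof. by move=> /istrig_cmeasurable; apply: cmeasurableS. Qed.

Lemma cmeasurableB (D : set R) F G : cmeasurable_fun D F -> cmeasurable_fun D G ->
  cmeasurable_fun D (fun x => F x - G x).
Proof.
move=> mF mG; rewrite (_ : (fun x => _) = fun x => F x + -1 * G x).
  by apply: cmeasurableD => //; apply: cmeasurableM => //; exact: cmeasurable_cst.
by apply/funext => x; rewrite mulN1r.
Qed.

Lemma nsq_ext (D : set R) F G : (forall x, D x -> F x = G x) -> nsq D F = nsq D G.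
Proof. by move=> FG; apply: eq_integral => x /[!inE] Dx; rewrite FG. Qed.

Lemma trig_approx_istrig T : istrig beta T -> trig_approx T.
Proof.
move=> tT; split; first exact: istrig_cmeasurable_period.
move=> e e0; exists T => //; rewrite (@nsq_ext _ _ (fun=> 0)); last by move=> x _; rewrite subrr.
rewrite /nsq Normc.normc0 expr0n /= integral0 lee_fin; exact: ltW.
Qed.

Lemma trig_approxD F G : trig_approx F -> trig_approx G -> trig_approx (fun x => F x + G x).
Proof.
move=> [mF aF] [mG aG]; split; first exact: cmeasurableD.
move=> e e0; have e4 : 0 < e / 4 by rewrite divr_gt0.
have [T tT hT] := aF _ e4; have [S tS hS] := aG _ e4.
exists (fun x => T x + S x); first exact: istrigD.
rewrite (@nsq_ext _ _ (fun x => (F x - T x) + (G x - S x))); last first.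
  by move=> x _; rewrite opprD addrACA.
have mT := istrig_cmeasurable_period tT; have mS := istrig_cmeasurable_period tS.
apply: (le_trans (nsqD _ (cmeasurableB mF mT) (cmeasurableB mG mS))) => //.
have -> : e%:E = (2%:E * (e / 4)%:E + 2%:E * (e / 4)%:E)%E.
  by rewrite -EFinM -EFinD; congr _%:E; field.
by apply: leeD; rewrite lee_pmul2l.
Qed.

Lemma trig_approxZ F (a : R[i]) : trig_approx F -> trig_approx (fun x => a * F x).
Proof.
move=> [mF aF].
have maF : cmeasurable_fun I (fun x => a * F x).
  by apply: cmeasurableM => //; exact: cmeasurable_cst.
split => // e e0; have [a0|a0] := eqVneq a 0.
  have [|_ /(_ e e0)[T tT hT]] := @trig_approx_istrig (fun=> 0); first exact: istrig_cst.
  exists T => //; apply: le_trans hT; rewrite (@nsq_ext _ _ (fun x => 0 - T x)) ?lexx//.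
  by move=> x _; rewrite a0 mul0r.
have na : 0 < normc a ^+ 2 by rewrite exprn_gt0// normc_gt0.
have [T tT hT] := aF _ (divr_gt0 e0 na).
exists (fun x => a * T x); first by apply: istrigM => //; exact: istrig_cst.
rewrite (@nsq_ext _ _ (fun x => a * (F x - T x))); last by move=> x _; rewrite mulrBr.
rewrite nsqZ//; last by apply: cmeasurableB => //; exact: istrig_cmeasurable_period.
have -> : e%:E = ((normc a ^+ 2)%:E * (e / normc a ^+ 2)%:E)%E.
  by rewrite -EFinM mulrC divfK// gt_eqF.
by rewrite lee_pmul2l.
Qed.

Lemma trig_approx_sum (J : Type) (s : seq J) (F : J -> R -> R[i]) :
  (forall j, trig_approx (F j)) -> trig_approx (fun x => \sum_(j <- s) F j x).
Proof.
move=> aF; elim: s => [|j s IH].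
  rewrite (_ : (fun x => _) = fun=> 0); first by apply: trig_approx_istrig; exact: istrig_cst.
  by apply/funext => x; rewrite big_nil.
rewrite (_ : (fun x => _) = fun x => F j x + \sum_(j <- s) F j x); first exact: trig_approxD.
by apply/funext => x; rewrite big_cons.
Qed.

Lemma trig_approx_ext F G : trig_approx F -> cmeasurable_fun I G ->
  (forall x, I x -> F x = G x) -> trig_approx G.
Proof.
move=> [mF aF] mG FG; split => // e /aF[T tT hT]; exists T => //.
by apply: le_trans hT; rewrite (@nsq_ext _ _ (fun x => F x - T x)) ?lexx// => x /FG ->.
Qed.

Lemma trig_approx_lim F : cmeasurable_fun I F ->
  (forall e : R, 0 < e -> exists2 G, trig_approx G & (nsq I (fun x => F x - G x)%R <= e%:E)%E) ->
  trig_approx F.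
Proof.
move=> mF H; split => // e e0; have e4 : 0 < e / 4 by rewrite divr_gt0.
have [G [mG aG] hG] := H _ e4; have [T tT hT] := aG _ e4.
exists T => //; rewrite (@nsq_ext _ _ (fun x => (F x - G x) + (G x - T x))); last first.
  by move=> x _; rewrite addrA subrK.
have mT := istrig_cmeasurable_period tT.
apply: (le_trans (nsqD _ (cmeasurableB mF mG) (cmeasurableB mG mT))) => //.
have -> : e%:E = (2%:E * (e / 4)%:E + 2%:E * (e / 4)%:E)%E.
  by rewrite -EFinM -EFinD; congr _%:E; field.
by apply: leeD; rewrite lee_pmul2l.
Qed.

Lemma period_measure : mu I = gamma%:E.
Proof.
rewrite /mu /I lebesgue_measure_itv /= lte_fin ltrDl gamma0 -EFinB.
by rewrite addrAC subrr add0r.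
Qed.

Lemma period_finite : (mu I < +oo)%E.
Proof. by rewrite period_measure ltry. Qed.

Lemma integrable_period_cst (K : R) : mu.-integrable I (EFin \o (fun=> K)).
Proof.
apply: measurable_bounded_integrable => //; first exact: period_finite.
exists `|K|; split; first exact: num_real.
by move=> M KM x _; exact: ltW.
Qed.

Lemma trig_approx_bounded_lim F (F_ : nat -> R -> R[i]) (K : R) :
  cmeasurable_fun I F -> (forall n, trig_approx (F_ n)) ->
  (forall x, I x -> (fun n => normc (F x - F_ n x) ^+ 2) @ \oo --> (0 : R)) ->
  (forall n x, I x -> normc (F x - F_ n x) ^+ 2 <= K) -> trig_approx F.
Proof.
move=> mF aF cF bF; apply: trig_approx_lim => // e e0.
have [n hn] := nsq_sequence_small mI mF (fun n => (aF n).1) (integrable_period_cst K) cF bF e0.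
by exists (F_ n).
Qed.

(* On a period starting at [c], the points to the left of [t] are those where
   the cosine centred at the midpoint of [c] and [t] exceeds its value at [t]. *)
Lemma cos_arc (t x : R) : c < t < c + gamma -> c < x < c + gamma ->
  (cos (2 * pi * beta * (t - (c + t) / 2)) < cos (2 * pi * beta * (x - (c + t) / 2))) = (x < t).
Proof.
move=> /andP[ct tg] /andP[cx xg].
set w := 2 * pi * beta; set m := (c + t) / 2.
have pi0 : 0 < pi :> R by exact: pi_gt0.
have beta0 : 0 < beta by rewrite -(pmulr_lgt0 _ gamma0) beta_gamma.
have w0 : 0 < w by rewrite mulr_gt0// mulr_gt0.
have wg : w * gamma = 2 * pi by rewrite /w -mulrA beta_gamma mulr1.
have th0 : 0 <= w * (t - m) <= pi.
  rewrite mulr_ge0 ?(ltW w0)//= /m; last by lra.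
  have : w * (t - (c + t) / 2) <= w * (gamma / 2) by rewrite ler_wpM2l ?(ltW w0)//; lra.
  by rewrite mulrA wg; lra.
have [xt|tx] := ltP x t.
  rewrite -(cos_norm (w * (x - m))) normrM (ger0_norm (ltW w0)).
  have h : `|x - m| < t - m by rewrite ltr_norml /m; apply/andP; split; lra.
  have h' : w * `|x - m| < w * (t - m) by rewrite ltr_pM2l.
  rewrite ltr_cos ?h' // in_itv /=//.
  by rewrite mulr_ge0 ?(ltW w0)//=; case/andP: th0 => _; apply: le_trans; exact: ltW.
apply/negbTE; rewrite -leNgt.
have [h|h] := leP (w * (x - m)) pi.
  have h1 : w * (t - m) <= w * (x - m) by rewrite ler_wpM2l ?(ltW w0)//; lra.
  rewrite le_eqVlt; have [->|ne] := eqVneq (w * (x - m)) (w * (t - m)); first by rewrite eqxx.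
  apply/orP; right; rewrite ltr_cos ?in_itv /=.
  - by rewrite lt_neqAle eq_sym ne.
  - exact: th0.
  - by rewrite h andbT (le_trans _ h1)//; case/andP: th0.
have -> : cos (w * (x - m)) = cos (2 * pi - w * (x - m)).
  by rewrite -[RHS]cosN opprB -[RHS]cosD2pi -[pi *+ 2]mulr_natl subrK.
have h2 : w * (t - m) <= 2 * pi - w * (x - m).
  have : w * ((t - m) + (x - m)) <= w * gamma.
    by rewrite ler_wpM2l ?(ltW w0)// /m; lra.
  by rewrite wg mulrDr; lra.
rewrite le_eqVlt; have [->|ne] := eqVneq (2 * pi - w * (x - m)) (w * (t - m)).
  by rewrite eqxx.
apply/orP; right; rewrite ltr_cos ?in_itv /=.
- by rewrite lt_neqAle eq_sym ne.
- exact: th0.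
- by rewrite (le_trans _ h2)/=; [lra|case/andP: th0].
Qed.

Lemma cmeasurable_indic (E : set R) : measurable E ->
  cmeasurable_fun I (fun x => (\1_E x : R)%:C).
Proof. by move=> mE; apply: cmeasurable_real; exact: measurable_indic. Qed.

Lemma trig_approx_ray (t : R) : trig_approx (fun x => (\1_(`]-oo, t[%classic) x : R)%:C).
Proof.
have mE : measurable (`]-oo, t[%classic : set R) by exact: measurable_itv.
have mF := cmeasurable_indic mE.
have indE (x : R) : \1_(`]-oo, t[%classic) x = (x < t)%R%:R :> R.
  rewrite indicE (_ : (x \in _) = (x < t)%R)//; apply/idP/idP.
    by rewrite inE /= in_itv.
  by move=> xt; rewrite inE /= in_itv.
have [tc|ct] := leP t c.
  apply: (@trig_approx_ext (fun=> 0)) => //; first by apply: trig_approx_istrig; exact: istrig_cst.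
  by move=> x; rewrite /I /= in_itv /= => /andP[cx _]; rewrite indE ltNge (le_trans tc).
have [tg|gt] := ltP t (c + gamma); last first.
  apply: (@trig_approx_ext (fun=> 1)) => //; first by apply: trig_approx_istrig; exact: istrig_cst.
  by move=> x; rewrite /I /= in_itv /= => /andP[_ xg]; rewrite indE (lt_le_trans xg).
pose m := (c + t) / 2.
(* The difference of cosines is at most 2 in modulus, so dividing by 8 keeps [y] in [0, 1];
   [y x < 1/2] is the comparison of cosines in [cos_arc]. *)
pose y x := 1 / 2 - (cos (2 * pi * beta * (x - m)) - cos (2 * pi * beta * (t - m))) / 8.
have y01 x : 0 <= y x <= 1.
  have := cos_le1 (2 * pi * beta * (x - m)); have := cos_geN1 (2 * pi * beta * (x - m)).
  have := cos_le1 (2 * pi * beta * (t - m)); have := cos_geN1 (2 * pi * beta * (t - m)).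
  by rewrite /y => *; apply/andP; split; lra.
have ty : istrig beta (fun x => (y x)%:C).
  rewrite (_ : (fun x => _) = fun x => (1 / 2 + cos (2 * pi * beta * (t - m)) / 8)%:C +
     (- 1 / 8)%:C * (cos (2 * pi * beta * (x - m)))%:C).
    apply: istrigD; first exact: istrig_cst.
    by apply: istrigM; [exact: istrig_cst|exact: istrig_cos].
  by apply/funext => x; rewrite -rmorphM -rmorphD /=; congr (_%:C); rewrite /y; field.
have tN N : istrig beta (fun x => (threshold N (y x))%:C) by exact: istrig_threshold.
have mF_ N := istrig_cmeasurable_period (tN N).
have mF' : cmeasurable_fun I (fun x => (if y x < 1 / 2 then 1 else 0 : R)%:C).
  apply: cmeasurable_real.
  have my : measurable_fun I y.
    by have [] := istrig_cmeasurable_period ty.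
  apply: measurable_fun_if => //.
  by apply: measurable_fun_ltr => //; exact: measurable_cst.
have aF : trig_approx (fun x => (if y x < 1 / 2 then 1 else 0 : R)%:C).
  apply: (@trig_approx_bounded_lim _ (fun N x => (threshold N (y x))%:C) 1) => //.
  - by move=> N; exact: trig_approx_istrig.
  - move=> x _.
    rewrite (_ : (fun n : nat => _) = fun N => (threshold N (y x) - (if y x < 1 / 2 then 1 else 0)) ^+ 2).
      set v := if _ then _ else _.
      have cv : (fun N => threshold N (y x) - v) @ \oo --> v - v.
        by apply: cvgB; [exact: threshold_cvg|exact: cvg_cst].
      by rewrite subrr in cv; have := cvgM cv cv; rewrite mulr0; exact.
    apply/funext => N; rewrite -rmorphB normc_real real_normK ?num_real//.
    by rewrite -sqrrN opprB.
  move=> N x _; rewrite -rmorphB normc_real real_normK ?num_real//.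
  have /andP[h1 h2] := threshold_ge0le1 N (y01 x).
  set u := threshold N (y x) in h1 h2 *.
  rewrite -real_normK ?num_real// exprn_ile1// ler_norml.
  by case: ifP => _; apply/andP; split; lra.
split => // e /(aF.2)[T tT hT]; exists T => //; apply: le_trans hT.
have mT := istrig_cmeasurable_period tT.
rewrite le_eqVlt; apply/orP; left; apply/eqP.
rewrite /nsq /I.
(* At x = c the cosine equals its value at [t], and the two indicators differ there; the integrals
   over the open interval do not see this point. *)
have sub : `]c, c + gamma[%classic `<=` I.
  by move=> x; rewrite /I /= !in_itv /= => /andP[/ltW -> ->].
have mS G : cmeasurable_fun I G ->
    measurable_fun `]c, c + gamma[%classic (fun x => (normc (G x - T x) ^+ 2)%:E).
  by move=> mG; exact: (measurable_funS mI sub (emeasurable_normc2 (cmeasurableB mG mT))).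
rewrite -(integral_itv_obnd_cbnd (mS _ mF)) -(integral_itv_obnd_cbnd (mS _ mF')).
apply: eq_integral => x; rewrite inE /= in_itv /= => xc.
have yx : (y x < 1 / 2) = (x < t).
  rewrite -(@cos_arc t x)//; last by rewrite ct.
  by rewrite /y /m; apply/idP/idP; lra.
by rewrite indE yx; case: (x < t).
Qed.

End TrigApprox.

Section Density.
Import HBNNSimple.
Context {R : realType}.
Let mu := @lebesgue_measure R.
Variables (beta gamma c : R).
Hypothesis gamma0 : 0 < gamma.
Hypothesis beta_gamma : beta * gamma = 1.
Implicit Types (F G : R -> R[i]).

Let I := `[c, c + gamma[%classic.
Let mI : measurable I := measurable_period _ _.
Let approx := trig_approx beta gamma c.

(** Dynkin's theorem: the open left rays are stable under intersection and generate the Borel sets,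
    and the approximable sets are closed under complements and disjoint unions. *)
Lemma trig_approx_set (E : set R) : measurable E -> approx (fun x => (\1_E x : R)%:C).
Proof.
rewrite [measurable](@RGenInftyO.measurableE R).
apply: (@dynkin_induction _ (measurableTypeR R) (@RGenInftyO.G R)
  (fun E => approx (fun x => (\1_E x : R)%:C))).
- exact: RGenInftyO.measurableE.
- move=> _ _ [x ->] [y ->]; exists (Num.min x y); apply/seteqP; split => z /=.
    by rewrite !in_itv /= lt_min => -[-> ->].
  by rewrite !in_itv /= lt_min => /andP.
- apply: (@trig_approx_ext _ beta _ _ (fun=> 1)).
  + by apply: trig_approx_istrig; exact: istrig_cst.
  + exact: cmeasurable_indic.
  + by move=> x _; rewrite indicT.
- by move=> _ [x ->]; exact: trig_approx_ray.
- move=> S mS aS.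
  apply: (@trig_approx_ext _ beta _ _ (fun x => 1 + -1 * (\1_S x : R)%:C)).
  + apply: trig_approxD; last exact: trig_approxZ.
    by apply: trig_approx_istrig; exact: istrig_cst.
  + by apply: cmeasurable_indic; exact: measurableC.
  + by move=> x _; rewrite mulN1r !indicE in_setC; case: (x \in S); rewrite ?subrr ?subr0.
move=> F mF tF aF.
have mU : measurable (\bigcup_k F k : set (measurableTypeR R)) by exact: bigcup_measurable.
pose S n x : R := \sum_(k < n) \1_(F k) x.
(* By disjointness at most one indicator is nonzero at [x], so the partial sum either is exact or
   misses a single 1. *)
have SE n x : (\1_(\bigcup_k F k) x - S n x = 0) \/
    (exists k, (n <= k)%N /\ F k x) /\ \1_(\bigcup_k F k) x - S n x = 1.
  have [[k _ Fk]|nF] := pselect ((\bigcup_k F k) x); last first.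
    left; rewrite indicE memNset// /S big1 ?subr0// => k _.
    by rewrite indicE memNset// => Fk; apply: nF; exists k.
  have F0 j : j != k -> \1_(F j) x = 0 :> R.
    move=> jk; rewrite indicE memNset// => Fj; move/eqP: jk; apply.
    by apply: (tF j k) => //; exists x.
  have F1 : \1_(F k) x = 1 :> R by rewrite indicE mem_set.
  rewrite indicE mem_set; last by exists k.
  have [kn|nk] := ltnP k n; [left|right; split; first by exists k].
    rewrite /S (bigD1 (Ordinal kn))//= F1 big1 ?addr0 ?subrr// => j jk.
    by apply: F0.
  rewrite /S big1 ?subr0// => j _; apply: F0.
  by rewrite neq_ltn (leq_trans (ltn_ord j)).
have nS n x : normc ((\1_(\bigcup_k F k) x : R)%:C - (S n x)%:C) ^+ 2 =
    (\1_(\bigcup_k F k) x - S n x) ^+ 2.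
  by rewrite -rmorphB normc_real real_normK ?num_real.
apply: (@trig_approx_bounded_lim _ beta _ _ gamma0 _ (fun n x => (S n x)%:C) 1).
- exact: cmeasurable_indic.
- move=> n; rewrite (_ : (fun x => _) = fun x => \sum_(k < n) (\1_(F k) x : R)%:C).
    by apply: trig_approx_sum => k; exact: aF.
  by apply/funext => x; rewrite /S rmorph_sum.
- move=> x _; have [[k _ Fk]|nF] := pselect ((\bigcup_k F k) x); last first.
    rewrite (_ : (fun n : nat => _) = fun=> 0); first exact: cvg_cst.
    apply/funext => n; rewrite nS.
    have [->|[[k [_ Fk]] _]] := SE n x; first by rewrite expr0n.
    by case: nF; exists k.
  apply: (@cvg_trans _ ((fun=> 0 : R) @ \oo)); last exact: cvg_cst.
  apply: near_eq_cvg; exists k.+1 => // n /= kn; rewrite nS.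
  have [->|[[j [nj Fj]] _]] := SE n x; first by rewrite expr0n.
  have jk : j = k by apply: (tF j k) => //; exists x.
  by move: nj; rewrite jk leqNgt kn.
- move=> n x _; rewrite nS.
  by have [->|[_ ->]] := SE n x; rewrite ?expr0n ?expr1n.
Qed.

(** Simple functions increase to [f]; the squared error is dominated by the integrable square of
    [f]. *)
Lemma trig_approx_ge0 (f : R -> R) : measurable_fun I f -> (forall x, I x -> 0 <= f x) ->
  (nsq I (fun x => (f x)%:C) < +oo)%E -> approx (fun x => (f x)%:C).
Proof.
move=> mf f0 foo.
have mfE : measurable_fun I (EFin \o f) by exact/measurable_EFinP.
pose f_ n := nnsfun_approx mI mfE n.
have fle n x : I x -> f_ n x <= f x.
  move=> Ix; have := @le_approx _ _ _ I (EFin \o f) n x _ Ix.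
  rewrite /f_ nnsfun_approxE lee_fin; apply.
  by move=> y Iy; rewrite lee_fin f0.
have nE n x : normc ((f x)%:C - (f_ n x)%:C) ^+ 2 = (f x - f_ n x) ^+ 2.
  by rewrite -rmorphB normc_real real_normK ?num_real.
apply: trig_approx_lim; first exact: cmeasurable_real.
move=> e e0.
have [|||||n hn] := @nsq_sequence_small R I (fun x => (f x)%:C) (fun n x => (f_ n x)%:C)
    (fun x => f x ^+ 2) mI _ _ _ _ _ e e0.
- exact: cmeasurable_real.
- by move=> n; apply: cmeasurable_real; exact: measurable_funTS.
- apply/integrableP; split; first by apply/measurable_EFinP; exact: measurable_funX.
  apply: le_lt_trans foo; rewrite le_eqVlt; apply/orP; left; apply/eqP.
  apply: eq_integral => x _.
  by rewrite normc_real real_normK ?num_real//= ger0_norm ?sqr_ge0.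
- move=> x Ix; under eq_fun do rewrite nE.
  have /fine_cvgP[_ cv] : EFin \o f_ ^~ x @ \oo --> (f x)%:E.
    by apply: (cvg_nnsfun_approx mI mfE) => // y Iy; rewrite lee_fin f0.
  have cv' : (fun n => f x - f_ n x) @ \oo --> f x - f x.
    by apply: cvgB; [exact: cvg_cst|exact: cv].
  by rewrite subrr in cv'; have := cvgM cv' cv'; rewrite mulr0; exact.
- move=> n x Ix; rewrite nE.
  have h1 := fle n x Ix; have h2 : 0 <= f_ n x by [].
  rewrite lerXn2r ?nnegrE ?subr_ge0// ?f0// gerBl//.
exists (fun x => (f_ n x)%:C) => //.
rewrite (_ : (fun x => _) = fun x => \sum_(i < #|` fset_set (range (f_ n))|)
   ((fset_set (range (f_ n)))`_i)%:C *
   (\1_(f_ n @^-1` [set (fset_set (range (f_ n)))`_i]) x : R)%:C); last first.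
  by apply/funext => x; rewrite fimfunEord rmorph_sum; apply: eq_bigr => i _; rewrite rmorphM.
apply: trig_approx_sum => i; apply: trig_approxZ => //; apply: trig_approx_set.
exact: measurable_sfunP.
Qed.

Lemma trig_dense F : cmeasurable_fun I F -> (nsq I F < +oo)%E -> approx F.
Proof.
move=> mF Foo; have [F1 F2] := mF.
have part (f : R -> R) : measurable_fun I f -> (forall x, I x -> 0 <= f x) ->
   (forall x, f x ^+ 2 <= normc (F x) ^+ 2) -> approx (fun x => (f x)%:C).
  move=> mf f0 fF; apply: trig_approx_ge0 => //; apply: le_lt_trans Foo.
  apply: le_nsq => //; first exact: measurable_normc2.
  by move=> x _; rewrite normc_real real_normK ?num_real.
have sq_pos (u : R) : Num.max u 0 ^+ 2 <= u ^+ 2.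
  by have [h|h] := leP u 0; rewrite ?expr0n ?sqr_ge0 ?lexx.
pose a := (fun x => complex.Re (F x)); pose b := (fun x => complex.Im (F x)).
have sqF x : normc (F x) ^+ 2 = a x ^+ 2 + b x ^+ 2 by rewrite normc_sqr.
have max0 u : 0 <= Num.max u 0 :> R by rewrite le_max lexx orbT.
have mx (u : R -> R) : measurable_fun I u -> measurable_fun I (fun x => Num.max (u x) 0).
  by move=> mu'; apply: measurable_maxr => //; exact: measurable_cst.
have aux (u : R -> R) : measurable_fun I u -> (forall x, u x ^+ 2 <= normc (F x) ^+ 2) ->
    approx (fun x => (u x)%:C).
  move=> mu' uF.
  apply: (@trig_approx_ext _ beta _ _
    (fun x => (Num.max (u x) 0)%:C + -1 * (Num.max (- u x) 0)%:C)).
  - apply: trig_approxD => //.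
      apply: part => //; first exact: mx.
      by move=> x; apply: le_trans (uF x).
    apply: trig_approxZ => //; apply: part => //.
      by apply: (mx (fun x => - u x)); exact: measurable_funN.
    by move=> x; apply: le_trans (sq_pos _) _; rewrite sqrrN.
  - exact: cmeasurable_real.
  move=> x _; rewrite mulN1r -rmorphN -rmorphD /=; congr (_%:C).
  by rewrite /Num.max; case: ifP => h1; case: ifP => h2; lra.
apply: (@trig_approx_ext _ beta _ _ (fun x => (a x)%:C + 'i * (b x)%:C)) => //.
  apply: trig_approxD => //; first by apply: aux => // x; rewrite sqF lerDl sqr_ge0.
  by apply: trig_approxZ => //; apply: aux => // x; rewrite sqF lerDr sqr_ge0.
by move=> x _; rewrite [RHS]complexE.
Qed.

End Density.

(** * Parseval's identity *)

Section ComplexIntegral.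
Context {R : realType}.
Let mu := @lebesgue_measure R.
Implicit Types (D : set (measurableTypeR R)) (F G : R -> R[i]).

(** The complex integral, taken componentwise; over [setT] it unfolds to [inner] for a product with
    a conjugate. *)
Definition cint D F : R[i] :=
  (\int[mu]_(x in D) complex.Re (F x)) +i* (\int[mu]_(x in D) complex.Im (F x)).

Definition cintegrable D F :=
  mu.-integrable D (EFin \o (fun x => complex.Re (F x))) /\
  mu.-integrable D (EFin \o (fun x => complex.Im (F x))).

Lemma cint_ext D F G : (forall x, D x -> F x = G x) -> cint D F = cint D G.
Proof.
by move=> FG; congr (_ +i* _); apply: eq_Rintegral => x /set_mem Dx; rewrite FG.
Qed.

Lemma ReD (z w : R[i]) : complex.Re (z + w) = complex.Re z + complex.Re w.
Proof. by case: z; case: w. Qed.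
Lemma ImD (z w : R[i]) : complex.Im (z + w) = complex.Im z + complex.Im w.
Proof. by case: z; case: w. Qed.
Lemma ReM (z w : R[i]) : complex.Re (z * w) = complex.Re z * complex.Re w - complex.Im z * complex.Im w.
Proof. by case: z; case: w. Qed.
Lemma ImM (z w : R[i]) : complex.Im (z * w) = complex.Re z * complex.Im w + complex.Im z * complex.Re w.
Proof. by case: z; case: w. Qed.

Lemma le_Re_normc (z : R[i]) : `|complex.Re z| <= normc z.
Proof.
by rewrite -sqrtr_sqr; case: z => x y /=; rewrite ler_wsqrtr// lerDl sqr_ge0.
Qed.

Lemma le_Im_normc (z : R[i]) : `|complex.Im z| <= normc z.
Proof.
by rewrite -sqrtr_sqr; case: z => x y /=; rewrite ler_wsqrtr// lerDr sqr_ge0.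
Qed.

Lemma cintegrable_le D F (g : R -> R) : measurable D -> cmeasurable_fun D F ->
  mu.-integrable D (EFin \o g) -> (forall x, D x -> normc (F x) <= g x) -> cintegrable D F.
Proof.
move=> mD [F1 F2] ig Fg; split; apply: le_integrable ig => //.
- exact/measurable_EFinP.
- move=> x Dx /=; rewrite lee_fin (le_trans (le_Re_normc _))// (le_trans (Fg x Dx))//.
  exact: ler_norm.
- exact/measurable_EFinP.
- move=> x Dx /=; rewrite lee_fin (le_trans (le_Im_normc _))// (le_trans (Fg x Dx))//.
  exact: ler_norm.
Qed.

Lemma cintegrableD D F G : measurable D -> cintegrable D F -> cintegrable D G ->
  cintegrable D (fun x => F x + G x).
Proof.
move=> mD [F1 F2] [G1 G2]; split.
  by apply: (eq_integrable mD _ _ _ (integrableD mD F1 G1)) => // x _ /=; rewrite ReD EFinD.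
by apply: (eq_integrable mD _ _ _ (integrableD mD F2 G2)) => // x _ /=; rewrite ImD EFinD.
Qed.

Lemma cintegrableZ D F (a : R[i]) : measurable D -> cintegrable D F ->
  cintegrable D (fun x => a * F x).
Proof.
move=> mD [F1 F2]; split.
  apply: (eq_integrable mD _ _ _ (integrableB mD (integrableZl mD (complex.Re a) F1)
    (integrableZl mD (complex.Im a) F2))) => // x _ /=; by rewrite ReM EFinB !EFinM.
apply: (eq_integrable mD _ _ _ (integrableD mD (integrableZl mD (complex.Re a) F2)
  (integrableZl mD (complex.Im a) F1))) => // x _ /=; by rewrite ImM EFinD !EFinM.
Qed.

Lemma cintD D F G : measurable D -> cintegrable D F -> cintegrable D G ->
  cint D (fun x => F x + G x) = cint D F + cint D G.
Proof.
move=> mD [F1 F2] [G1 G2].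
have -> : cint D F + cint D G =
  (\int[mu]_(x in D) complex.Re (F x) + \int[mu]_(x in D) complex.Re (G x)) +i*
  (\int[mu]_(x in D) complex.Im (F x) + \int[mu]_(x in D) complex.Im (G x)) by [].
rewrite -!RintegralD//; congr (_ +i* _); apply: eq_Rintegral => x _.
  exact: ReD.
exact: ImD.
Qed.

Lemma cintZ D F (a : R[i]) : measurable D -> cintegrable D F ->
  cint D (fun x => a * F x) = a * cint D F.
Proof.
move=> mD [F1 F2]; apply/eqP; rewrite eq_complex ReM ImM /=.
rewrite -!RintegralZl//.
have int4 (k : R) (f : R -> R) : mu.-integrable D (EFin \o f) ->
    mu.-integrable D (EFin \o (fun x => k * f x)).
  by move=> fi; apply: (eq_integrable mD _ _ _ (integrableZl mD k fi)) => // x _ /=; rewrite EFinM.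
rewrite -RintegralB ?int4// -RintegralD ?int4//.
apply/andP; split; apply/eqP; apply: eq_Rintegral => x _; [exact: ReM|exact: ImM].
Qed.

Lemma cint0 D : cint D (fun=> 0) = 0.
Proof. by apply/eqP; rewrite eq_complex /= /Rintegral !integral0 /= eqxx. Qed.

Lemma cintegrable0 D : measurable D -> cintegrable D (fun=> 0).
Proof. by move=> mD; split; exact: integrable0. Qed.

Lemma cint_sum (J : Type) (s : seq J) D (F : J -> R -> R[i]) : measurable D ->
  (forall j, cintegrable D (F j)) ->
  cintegrable D (fun x => \sum_(j <- s) F j x) /\
  cint D (fun x => \sum_(j <- s) F j x) = \sum_(j <- s) cint D (F j).
Proof.
move=> mD iF; elim: s => [|j s [IH1 IH2]].
  rewrite big_nil (_ : (fun x => _) = fun=> 0).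
    by split; [exact: cintegrable0|exact: cint0].
  by apply/funext => x; rewrite big_nil.
rewrite (_ : (fun x => _) = fun x => F j x + \sum_(j <- s) F j x); last first.
  by apply/funext => x; rewrite big_cons.
by rewrite big_cons cintD// IH2; split => //; exact: cintegrableD.
Qed.

Lemma cint_conj D F : measurable D -> cintegrable D F ->
  cintegrable D (fun x => (F x)^*%C) /\ cint D (fun x => (F x)^*%C) = (cint D F)^*%C.
Proof.
move=> mD [F1 F2].
have reJ x : complex.Re (F x)^*%C = complex.Re (F x) by case: (F x).
have imJ x : complex.Im (F x)^*%C = -1 * complex.Im (F x) by case: (F x) => u v /=; rewrite mulN1r.
split.
  split; first by apply: (eq_integrable mD _ _ _ F1) => // x _ /=; rewrite reJ.
  by apply: (eq_integrable mD _ _ _ (integrableZl mD (-1) F2)) => // x _ /=; rewrite imJ EFinM.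
rewrite /cint /=; congr (_ +i* _); first by apply: eq_Rintegral => x _; rewrite reJ.
rewrite -mulN1r -RintegralZl//; by apply: eq_Rintegral => x _; rewrite imJ.
Qed.

Lemma cintegrableS D D' F : measurable D -> measurable D' -> D `<=` D' ->
  cintegrable D' F -> cintegrable D F.
Proof. by move=> mD mD' DD [F1 F2]; split; [exact: integrableS F1|exact: integrableS F2]. Qed.

Lemma sum_complex (J : Type) (s : seq J) (a b : J -> R) :
  \sum_(j <- s) (a j +i* b j) = (\sum_(j <- s) a j) +i* (\sum_(j <- s) b j).
Proof.
elim: s => [|j s IH]; first by rewrite !big_nil.
by rewrite !big_cons IH.
Qed.

Lemma cint_itv_split F c gamma m : 0 < gamma -> cmeasurable_fun setT F ->
  cintegrable `[c, c + m%:R * gamma[ F ->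
  cint `[c, c + m%:R * gamma[ F = \sum_(j < m) cint `[c, c + gamma[ (fun x => F (x + j%:R * gamma)).
Proof.
move=> g0 [m1 m2] [i1 i2]; rewrite sum_complex /cint.
congr (_ +i* _).
  by rewrite (Rintegral_itv_split (f := fun x => complex.Re (F x))).
by rewrite (Rintegral_itv_split (f := fun x => complex.Im (F x))).
Qed.

Lemma nsq_cint D F : cint D (fun x => F x * (F x)^*%C) = (fine (nsq D F))%:C.
Proof.
apply/eqP; rewrite eq_complex /=; apply/andP; split; apply/eqP.
  rewrite /nsq /Rintegral; congr fine; apply: eq_integral => x _; congr (_%:E).
  by rewrite normc_sqr; case: (F x) => u v /=; rewrite mulrN opprK !expr2.
rewrite (@eq_Rintegral _ _ _ _ _ (fun=> 0)) ?/Rintegral ?integral0// => x _.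
by case: (F x) => u v /=; rewrite mulrN mulrC addrC subrr.
Qed.

End ComplexIntegral.

Section Conj.
Context {R : realType}.
Implicit Types z w : R[i].

Lemma conjcM z w : (z * w)^*%C = z^*%C * w^*%C.
Proof. exact: rmorphM. Qed.

Lemma conjcB z w : (z - w)^*%C = z^*%C - w^*%C.
Proof. exact: rmorphB. Qed.

Lemma conjc_sum (J : Type) (s : seq J) (F : J -> R[i]) :
  (\sum_(j <- s) F j)^*%C = \sum_(j <- s) (F j)^*%C.
Proof. exact: rmorph_sum. Qed.

End Conj.

Section Parseval.
Context {R : realType}.
Let mu := @lebesgue_measure R.
Variables (beta gamma c : R).
Hypothesis gamma0 : 0 < gamma.
Hypothesis beta_gamma : beta * gamma = 1.

Let I : set (measurableTypeR R) := `[c, c + gamma[%classic.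
Let mI : measurable I := measurable_period _ _.
Let e := @expmode R beta.

Lemma expi_pi_nat (j : nat) : expi (pi * j%:R) = (-1) ^+ j :> R[i].
Proof.
elim: j => [|j IH]; first by rewrite mulr0 expi0.
rewrite -(natr1 j) mulrDr mulr1 expiD IH exprS mulrC; congr (_ * _).
by rewrite /expi cospi sinpi; apply/eqP; rewrite eq_complex /= oppr0 !eqxx.
Qed.

Lemma sum_alternating k : \sum_(j < k.*2) (-1) ^+ j = 0 :> R[i].
Proof.
elim: k => [|k IH]; first by rewrite big_ord0.
by rewrite doubleS !big_ord_recr /= IH add0r exprS mulN1r subrr.
Qed.

Lemma cintegrable_bounded (F : R -> R[i]) (K : R) : cmeasurable_fun I F ->
  (forall x, I x -> normc (F x) <= K) -> cintegrable I F.
Proof.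
move=> mF FK; apply: (@cintegrable_le _ I F (fun=> K)) => //.
exact: integrable_period_cst.
Qed.

Lemma cmeasurable_expmode_period m : cmeasurable_fun I (e m).
Proof. by apply: (@cmeasurableS _ _ setT) => //; exact: cmeasurable_expmode. Qed.

(** Orthogonality without antiderivatives: moving by half a wavelength multiplies the mode by -1,
    and the period consists of an even number of half wavelengths. *)
Lemma cint_expmode m : cint I (e m) = if m == 0 then gamma%:C else 0.
Proof.
have [->|m0] := eqVneq m 0.
  rewrite (@cint_ext _ _ _ (fun=> 1)); last by move=> x _; exact: expmode0.
  apply/eqP; rewrite eq_complex /=; apply/andP; split; apply/eqP.
    rewrite Rintegral_cst// mul1r.
    exact: (congr1 fine (period_measure c gamma0)).
  by rewrite Rintegral_cst// mul0r.
pose k := `|m|%N; have k0 : (0 < k)%N by rewrite absz_gt0.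
pose g' := gamma / (k.*2)%:R.
have M0 : 0 < (k.*2)%:R :> R by rewrite ltr0n double_gt0.
have g'0 : 0 < g' by rewrite divr_gt0.
have IE : I = `[c, c + (k.*2)%:R * g'[%classic.
  by rewrite /g' mulrC divfK// gt_eqF.
have ie : cintegrable `[c, c + (k.*2)%:R * g'[ (e m).
  rewrite -IE; apply: (@cintegrable_bounded _ 1); first exact: cmeasurable_expmode_period.
  by move=> x _; rewrite normc_expmode.
rewrite IE cint_itv_split//; last exact: cmeasurable_expmode.
have shift (j : nat) x : e m (x + j%:R * g') = (-1) ^+ j * e m x.
  rewrite /e expmode_add mulrC; congr (_ * _).
  have kE : k%:R = `|m%:~R| :> R by rewrite -intr_norm /k; case: (m).
  have km0 : k%:R != 0 :> R by rewrite pnatr_eq0 -lt0n.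
  rewrite /expmode /g' -muln2 natrM.
  have [mp|mn] := leP 0 m.
    rewrite -expi_pi_nat; congr expi.
    have -> : m%:~R = k%:R :> R by rewrite kE ger0_norm// ler0z.
    transitivity (beta * gamma * (pi * j%:R)); last by rewrite beta_gamma mul1r.
    by field.
  rewrite -[RHS]conjcK rmorphXn rmorphN1 -expi_pi_nat -expiN; congr expi.
  have -> : m%:~R = - k%:R :> R by rewrite kE ltr0_norm ?ltrz0// opprK.
  transitivity (- (beta * gamma * (pi * j%:R))); last by rewrite beta_gamma mul1r.
  by field.
have ie' : cintegrable `[c, c + g'[ (e m).
  apply: cintegrableS ie => //.
  move=> x /=; rewrite !in_itv /= => /andP[-> h] /=; apply: (lt_le_trans h).
  rewrite lerD2l ler_peMl ?(ltW g'0)// ler1n double_gt0//.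
under eq_bigr => j _.
  rewrite (@cint_ext _ _ _ (fun x => (-1) ^+ j * e m x)); last by move=> x _; exact: shift.
  rewrite cintZ//.
  over.
by rewrite -mulr_suml sum_alternating mul0r.
Qed.

Variable P : R -> R[i].
Hypothesis mP : cmeasurable_fun I P.
Hypothesis Poo : (nsq I P < +oo)%E.

Definition fourier_coef m := cint I (fun x => P x * (e m x)^*%C).

Lemma cintegrable_mode m : cintegrable I (fun x => P x * (e m x)^*%C).
Proof.
have mPe : cmeasurable_fun I (fun x => P x * (e m x)^*%C).
  by apply: cmeasurableM => //; apply: cmeasurable_conj; exact: cmeasurable_expmode_period.
(* On a set of finite measure |P| <= 1 + |P|^2 yields integrability from square integrability. *)
apply: (@cintegrable_le _ I _ (fun x => 1 + normc (P x) ^+ 2)) => //.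
  have i1 : mu.-integrable I (EFin \o (fun=> 1)) := integrable_period_cst c gamma0 1.
  have isq : mu.-integrable I (fun x => (normc (P x) ^+ 2)%:E).
    apply/integrableP; split; first exact: emeasurable_normc2.
    apply: le_lt_trans Poo; rewrite le_eqVlt; apply/orP; left; apply/eqP.
    by apply: eq_integral => x _; rewrite gee0_abs// lee_fin sqr_ge0.
  by apply: (eq_integrable mI _ _ _ (integrableD mI i1 isq)) => x _; rewrite /= EFinD.
move=> x _; rewrite Normc.normcM normc_conj normc_expmode mulr1.
have := sqr_ge0 (normc (P x) - 1); have := sqr_ge0 (normc (P x)).
by rewrite !expr2; lra.
Qed.

Lemma cintegrable_sq : cintegrable I (fun x => P x * (P x)^*%C).
Proof.
have mPe : cmeasurable_fun I (fun x => P x * (P x)^*%C).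
  by apply: cmeasurableM => //; exact: cmeasurable_conj.
apply: (@cintegrable_le _ I _ (fun x => normc (P x) ^+ 2)) => //.
  apply/integrableP; split; first exact: emeasurable_normc2.
  apply: le_lt_trans Poo; rewrite le_eqVlt; apply/orP; left; apply/eqP.
  by apply: eq_integral => x _; rewrite gee0_abs// lee_fin sqr_ge0.
by move=> x _; rewrite Normc.normcM normc_conj expr2.
Qed.

(** Completing the square around the best coefficients. Those coefficients for [t] give Bessel's
    inequality; the coefficients of an approximating polynomial give the converse estimate. *)
Lemma bessel_identity (r : seq int) (t : int -> R[i]) : uniq r ->
  (fine (nsq I (fun x => P x - \sum_(m <- r) t m * e m x)))%:C =
  (fine (nsq I P))%:C - gamma^-1%:C * (\sum_(m <- r) fourier_coef m * (fourier_coef m)^*%C) +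
  gamma%:C * (\sum_(m <- r) (t m - gamma^-1%:C * fourier_coef m) *
     (t m - gamma^-1%:C * fourier_coef m)^*%C).
Proof.
move=> ur; rewrite -!nsq_cint.
rewrite (@cint_ext _ _ _ (fun x => P x * (P x)^*%C +
   (\sum_(m <- r) (- (t m)^*%C) * (P x * (e m x)^*%C) +
   (\sum_(m <- r) (- t m) * (P x * (e m x)^*%C)^*%C +
    \sum_(m <- r) \sum_(k <- r) t m * (t k)^*%C * e (m - k) x)))); last first.
  move=> x _; set S := \sum_(m <- r) t m * e m x.
  have -> : \sum_(m <- r) - (t m)^*%C * (P x * (e m x)^*%C) = - (P x * S^*%C).
    rewrite /S conjc_sum mulr_sumr -sumrN; apply: eq_bigr => m _.
    by rewrite conjcM; ring.
  have -> : \sum_(m <- r) - t m * (P x * (e m x)^*%C)^*%C = - (S * (P x)^*%C).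
    rewrite /S mulr_suml -sumrN; apply: eq_bigr => m _.
    by rewrite conjcM conjcK; ring.
  have -> : \sum_(m <- r) \sum_(k <- r) t m * (t k)^*%C * e (m - k) x = S * S^*%C.
    rewrite /S conjc_sum mulr_suml; apply: eq_bigr => m _.
    rewrite mulr_sumr; apply: eq_bigr => k _.
    by rewrite conjcM /e expmodeD expmodeN; ring.
  by rewrite conjcB; ring.
have im m := cintegrable_mode m.
have imZ m (a : R[i]) := cintegrableZ a mI (im m).
have iJ m := cint_conj mI (im m).
have iJZ m (a : R[i]) := cintegrableZ a mI (iJ m).1.
have ie m : cintegrable I (e m).
  apply: (@cintegrable_bounded _ 1); first exact: cmeasurable_expmode_period.
  by move=> x _; rewrite normc_expmode.
have [i1 E1] := cint_sum r mI (fun m => imZ m (- (t m)^*%C)).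
have [i2 E2] := cint_sum r mI (fun m => iJZ m (- t m)).
have i3' m := cint_sum r mI (fun k => cintegrableZ (t m * (t k)^*%C) mI (ie (m - k))).
have [i3 E3] := cint_sum r mI (fun m => (i3' m).1).
rewrite cintD//; [|exact: cintegrable_sq|by do 2 apply: cintegrableD => //].
rewrite cintD//; last exact: cintegrableD.
rewrite cintD// E1 E2 E3 -!addrA; congr (_ + _).
have -> : \sum_(m <- r) cint I (fun x => \sum_(k <- r) t m * (t k)^*%C * e (m - k) x) =
   \sum_(m <- r) gamma%:C * (t m * (t m)^*%C).
  rewrite [LHS]big_seq [RHS]big_seq; apply: eq_bigr => m mr.
  rewrite (i3' m).2 (bigD1_seq m)//= big1 => [|k km].
    by rewrite cintZ// subrr cint_expmode eqxx addr0 mulrC.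
  by rewrite cintZ// cint_expmode subr_eq0 eq_sym (negPf km) mulr0.
rewrite [in RHS]mulr_sumr [X in _ = _ + X]mulr_sumr -sumrN -!big_split.
apply: eq_bigr => m _; cbv beta; rewrite !cintZ//; last exact: (iJ m).1.
rewrite (iJ m).2 -/(fourier_coef m) conjcB conjcM [(gamma^-1%:C)^*%C]conjc_real.
have g1 : gamma%:C * gamma^-1%:C = 1 by rewrite -rmorphM mulfV ?gt_eqF.
set g := gamma%:C in g1 *; set g' := gamma^-1%:C in g1 *.
set f := fourier_coef m; set T := t m.
change (- T^*%C * f + (- T * f^*%C + g * (T * T^*%C)) =
  - (g' * (f * f^*%C)) + g * ((T - g' * f) * (T^*%C - g' * f^*%C))).
transitivity (- (g' * (f * f^*%C)) + (g * (T * T^*%C) - (g * g') * T * f^*%C - (g * g') * f * T^*%C +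
  (g * g') * g' * f * f^*%C)); last by ring.
by rewrite g1; ring.
Qed.

Lemma normc_sq_conj (z : R[i]) : z * z^*%C = (normc z ^+ 2)%:C.
Proof.
apply/eqP; rewrite normc_sqr eq_complex; case: z => x y /=.
by rewrite mulrN opprK !expr2 mulrN [x * y]mulrC addNr !eqxx.
Qed.

Lemma bessel_identity_real (r : seq int) (t : int -> R[i]) : uniq r ->
  fine (nsq I (fun x => P x - \sum_(m <- r) t m * e m x)) =
  fine (nsq I P) - gamma^-1 * (\sum_(m <- r) normc (fourier_coef m) ^+ 2) +
  gamma * (\sum_(m <- r) normc (t m - gamma^-1%:C * fourier_coef m) ^+ 2).
Proof.
move=> ur; apply: (@complexI R); rewrite bessel_identity//.
rewrite !rmorphD rmorphN !rmorphM /= !rmorph_sum /=.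
by congr (_ - _ * _ + _ * _); apply: eq_bigr => m _; rewrite normc_sq_conj.
Qed.

Lemma nsqP_fin : nsq I P \is a fin_num.
Proof. by rewrite ge0_fin_numE// nsq_ge0. Qed.

Lemma bessel (r : seq int) : uniq r ->
  \sum_(m <- r) normc (fourier_coef m) ^+ 2 <= gamma * fine (nsq I P).
Proof.
move=> ur.
have := bessel_identity_real (fun m => gamma^-1%:C * fourier_coef m) ur.
rewrite [X in gamma * X]big1 => [|m _]; last by rewrite subrr Normc.normc0 expr0n.
rewrite mulr0 addr0 => h.
have : 0 <= fine (nsq I P) - gamma^-1 * \sum_(m <- r) normc (fourier_coef m) ^+ 2.
  by rewrite -h fine_ge0// nsq_ge0.
by rewrite subr_ge0 mulrC ler_pdivrMr// mulrC.
Qed.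

Lemma parseval_approx (eps : R) : 0 < eps -> exists2 r : seq int, uniq r &
  gamma * fine (nsq I P) - eps <= \sum_(m <- r) normc (fourier_coef m) ^+ 2.
Proof.
move=> eps0; have eg : 0 < eps / gamma by rewrite divr_gt0.
have [_ /(_ _ eg)[T [s ->] hT]] := trig_dense gamma0 beta_gamma mP Poo.
(* The list [s] may repeat a frequency; [t] collects the coefficients of each one. *)
pose r := undup [seq p.2 | p <- s].
pose t m : R[i] := \sum_(p <- s | p.2 == m) p.1.
have ur : uniq r by exact: undup_uniq.
exists r => //.
have sE x : trig beta s x = \sum_(m <- r) t m * e m x.
  rewrite /trig /t; under [RHS]eq_bigr do rewrite mulr_suml.
  rewrite (exchange_big_dep xpredT) //= big_seq [RHS]big_seq; apply: eq_bigr => p ps.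
  rewrite big_mkcond (bigD1_seq p.2)//=; last by rewrite mem_undup map_f.
  rewrite eqxx big1_seq ?addr0// => m /andP[mp _].
  by rewrite eq_sym (negPf mp).
have := bessel_identity_real t ur.
set X := \sum_(m <- r) _ ^+ 2; set Y := \sum_(m <- r) _ ^+ 2 => h.
have Y0 : 0 <= Y by apply: sumr_ge0 => m _; exact: sqr_ge0.
have hT' : (nsq I (fun x => P x - \sum_(m <- r) t m * e m x)%R <= (eps / gamma)%:E)%E.
  by apply: le_trans hT; rewrite (@nsq_ext _ _ _ (fun x => P x - trig beta s x)) ?lexx// => x _; rewrite sE.
have : fine (nsq I (fun x => P x - \sum_(m <- r) t m * e m x)) <= eps / gamma.
  by rewrite -lee_fin fineK// ge0_fin_numE ?nsq_ge0// (le_lt_trans hT')// ltry.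
rewrite h => h1.
have : gamma * (fine (nsq I P) - gamma^-1 * X) <= gamma * (eps / gamma).
  rewrite ler_wpM2l ?(ltW gamma0)//; have : 0 <= gamma * Y by rewrite mulr_ge0// ltW.
  lra.
have gN : gamma != 0 by rewrite gt_eqF.
have -> : gamma * (fine (nsq I P) - gamma^-1 * X) = gamma * fine (nsq I P) - X by field.
have -> : gamma * (eps / gamma) = eps by field.
lra.
Qed.

(** The factor gamma appears because [fourier_coef] is not divided by the length of the period. *)
Lemma parseval : (\esum_(m in [set: int]) (normc (fourier_coef m) ^+ 2)%:E =
  gamma%:E * nsq I P)%E.
Proof.
apply/eqP; rewrite eq_le; apply/andP; split.
  apply: ge_ereal_sup => _ [X [finX _] <-].
  rewrite fsbig_finite//= sumEFin -(fineK nsqP_fin) -EFinM lee_fin.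
  exact/bessel/fset_uniq.
apply/lee_subgt0Pr => eps eps0.
have [r ur hr] := parseval_approx eps0.
rewrite -(fineK nsqP_fin) -EFinM -EFinB; apply: le_trans (_ : _ <= (\sum_(m <- r) normc (fourier_coef m) ^+ 2)%:E)%E _.
  by rewrite lee_fin.
rewrite -sumEFin fsbig_seq//.
apply: esum_ge; exists [set` r] => //; split => //; exact: finite_seq.
Qed.

End Parseval.

(** * Periodization and frame bounds *)

Section Periodization.
Context {R : realType}.
Let mu := @lebesgue_measure R.
Implicit Types (u h : R -> R[i]).

Lemma nsq_translate u s : cmeasurable_fun setT u ->
  nsq setT (fun x => u (x + s)) = nsq setT u.
Proof.
move=> mu'; have := @ge0_integral_translate_preimage R (fun x => (normc (u x) ^+ 2)%:E) setT s.
by rewrite preimage_setT; apply => //; [exact: emeasurable_normc2|move=> x; rewrite lee_fin sqr_ge0].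
Qed.

Lemma nsq_subset (D : set R) u : measurable D -> cmeasurable_fun setT u ->
  (nsq D u <= nsq setT u)%E.
Proof.
move=> mD mu'; apply: ge0_subset_integral => //; first exact: emeasurable_normc2.
by move=> x _; rewrite lee_fin sqr_ge0.
Qed.

Lemma normc_sum_sq K (z : 'I_K -> R[i]) :
  normc (\sum_(j < K) z j) ^+ 2 <= K%:R * \sum_(j < K) normc (z j) ^+ 2.
Proof.
pose r j := normc (z j).
have S0 : 0 <= \sum_(j < K) r j by apply: sumr_ge0 => j _; exact: normc_ge0.
apply: (@le_trans _ _ ((\sum_(j < K) r j) ^+ 2)).
  by rewrite lerXn2r ?nnegrE ?normc_ge0// normc_sum.
have h : \sum_(i < K) \sum_(j < K) (r i * r j) <= \sum_(i < K) \sum_(j < K) ((r i ^+ 2 + r j ^+ 2) / 2).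
  apply: ler_sum => i _; apply: ler_sum => j _.
  have := sqr_ge0 (r i - r j); rewrite !expr2; lra.
have -> : (\sum_(j < K) r j) ^+ 2 = \sum_(i < K) \sum_(j < K) (r i * r j).
  by rewrite expr2 mulr_suml; apply: eq_bigr => i _; rewrite mulr_sumr.
apply: (le_trans h); rewrite le_eqVlt; apply/orP; left; apply/eqP.
under eq_bigr => i _ do rewrite -mulr_suml big_split /= sumr_const card_ord.
rewrite -mulr_suml big_split /= sumr_const card_ord sumrMnl -[_ *+ K]mulr_natl.
by field.
Qed.

Lemma nsq_sum_le (D : set R) K (F : 'I_K -> R -> R[i]) : measurable D ->
  (forall j, cmeasurable_fun D (F j)) ->
  (nsq D (fun x => \sum_(j < K) F j x)%R <= K%:R%:E * \sum_(j < K) nsq D (F j))%E.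
Proof.
move=> mD mF; apply: (@le_trans _ _ (\int[mu]_(x in D) (K%:R * \sum_(j < K) normc (F j x) ^+ 2)%:E)%E).
  apply: le_nsq => //; first exact: cmeasurable_sum.
    apply: measurable_funM; first exact: measurable_cst.
    by apply: measurable_sum => j; exact: measurable_normc2.
  by move=> x _; exact: normc_sum_sq.
under eq_integral do rewrite EFinM -sumEFin.
rewrite ge0_integralZl_EFin//.
- by rewrite ge0_integral_sum// => j; [exact: emeasurable_normc2|move=> x _; rewrite lee_fin sqr_ge0].
- by move=> x _; apply: sume_ge0 => j _; rewrite lee_fin sqr_ge0.
- by apply: emeasurable_sum => j; exact: emeasurable_normc2.
Qed.

Variables (beta gamma a : R) (K : nat).
Hypothesis gamma0 : 0 < gamma.
Hypothesis beta_gamma : beta * gamma = 1.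
Hypothesis K0 : (0 < K)%N.

Let I : set (measurableTypeR R) := `[a, a + gamma[%classic.
Let mI : measurable I := measurable_period _ _.

Lemma expmode_shift m (k : int) x : expmode beta m (x + k%:~R * gamma) = expmode beta m x.
Proof.
rewrite expmode_add /expmode (_ : 2 * pi * beta * m%:~R * (k%:~R * gamma) = 2 * pi * (m * k)%:~R).
  by rewrite expi_2pi_int mulr1.
rewrite intrM; transitivity (2 * pi * (m%:~R * k%:~R) * (beta * gamma)); first by ring.
by rewrite beta_gamma mulr1.
Qed.

Variable u : R -> R[i].
Hypothesis mu' : cmeasurable_fun setT u.
Hypothesis uoo : (nsq setT u < +oo)%E.
Hypothesis u_supp : forall x, ~~ (a <= x < a + K%:R * gamma) -> u x = 0.

(** It agrees with [persum] on the period starting at [a]. Its fixed number of terms serves the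
    estimates, the periodicity of [persum] serves the changes of interval. *)
Definition period_sum x : R[i] := \sum_(j < K) u (x + j%:R * gamma).

Lemma cmeasurable_shift (D : set R) s : cmeasurable_fun D (fun x => u (x + s)).
Proof. by apply: (@cmeasurableS _ _ setT) => //; exact: cmeasurable_translate. Qed.

Lemma cmeasurable_period_sum : cmeasurable_fun I period_sum.
Proof. by apply: cmeasurable_sum => j; exact: cmeasurable_shift. Qed.

Lemma nsq_shift_lty s : (nsq I (fun x => u (x + s)%R) < +oo)%E.
Proof.
apply: le_lt_trans uoo; rewrite -(nsq_translate s mu').
by apply: nsq_subset => //; exact: cmeasurable_translate.
Qed.

Lemma nsq_period_sum_lty : (nsq I period_sum < +oo)%E.
Proof.
apply: (le_lt_trans (nsq_sum_le _ _)) => //; first by move=> j; exact: cmeasurable_shift.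
rewrite lte_mul_pinfty// ?lee_fin//.
by apply/lte_sum_pinfty => j _; exact: nsq_shift_lty.
Qed.

Lemma cint_setT (D : set (measurableTypeR R)) F : measurable D -> (forall x, ~ D x -> F x = 0) ->
  cint setT F = cint D F.
Proof.
move=> mD F0; rewrite /cint [X in _ = X +i* _]Rintegral_mkcond [X in _ = _ +i* X]Rintegral_mkcond.
congr (_ +i* _); apply: eq_Rintegral => x _; rewrite /patch; case: ifPn => // /negP xD;
  by rewrite F0// => Dx; apply: xD; exact: mem_set.
Qed.

Lemma cintegrable_supported m : cintegrable `[a, a + K%:R * gamma[ (fun x => u x * (expmode beta m x)^*%C).
Proof.
apply: cintegrable_mode; first by rewrite mulr_gt0// ltr0n.
  by apply: (@cmeasurableS _ _ setT).
by apply: le_lt_trans uoo; apply: nsq_subset.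
Qed.

(** Unfolding: [u] lives on [K] consecutive periods, and the modes are gamma-periodic. *)
Lemma cint_periodization m : cint setT (fun x => u x * (expmode beta m x)^*%C) =
  fourier_coef beta gamma a period_sum m.
Proof.
set D : set (measurableTypeR R) := `[a, a + K%:R * gamma[%classic.
have mD : measurable D by exact: measurable_itv.
rewrite (@cint_setT D)//; last first.
  move=> x Dx; rewrite u_supp ?mul0r//; apply/negP => xD; apply: Dx.
  by rewrite /D /= in_itv.
have mF : cmeasurable_fun setT (fun x => u x * (expmode beta m x)^*%C).
  by apply: cmeasurableM => //; apply: cmeasurable_conj; exact: cmeasurable_expmode.
rewrite (cint_itv_split gamma0 mF (cintegrable_supported m)).
have ij (j : 'I_K) : cintegrable I (fun x => u (x + j%:R * gamma) * (expmode beta m x)^*%C).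
  apply: (@cintegrable_mode _ beta gamma a gamma0 (fun x => u (x + j%:R * gamma))); first exact: cmeasurable_shift.
  exact: nsq_shift_lty.
have [_ E] := cint_sum (index_enum 'I_K) mI ij.
rewrite /fourier_coef -/I (@cint_ext _ _ _ (fun x => \sum_(j < K) u (x + j%:R * gamma) * (expmode beta m x)^*%C)).
  rewrite E; apply: eq_bigr => j _; apply: cint_ext => x _.
  by rewrite (expmode_shift m j%:Z x).
by move=> x _; rewrite /period_sum mulr_suml.
Qed.

Lemma parseval_periodization :
  (\esum_(m in [set: int]) (normc (cint setT (fun x => u x * (expmode beta m x)^*%C)) ^+ 2)%:E =
   gamma%:E * nsq I period_sum)%E.
Proof.
rewrite -(parseval gamma0 beta_gamma cmeasurable_period_sum nsq_period_sum_lty).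
by apply: eq_esum => m _; rewrite cint_periodization.
Qed.

Lemma period_sum_persum x : I x -> period_sum x = persum gamma u x.
Proof.
rewrite /I /= in_itv /= => /andP[ax xg].
rewrite (@persumE _ _ _ _ 0 K).
  by apply: eq_bigr => j _; rewrite add0r.
move=> k [k0|Kk]; apply: u_supp; apply/negP => /andP[h1 h2].
  have : (k + 1)%:~R <= 0%:~R :> R by rewrite ler_int lezD1.
  rewrite intrD -[0%:~R]/(0 : R) -[1%:~R]/(1 : R) => k1.
  have : (k%:~R + 1) * gamma <= 0 * gamma by rewrite ler_wpM2r// ltW.
  by have := gamma0; lra.
move: Kk; rewrite add0r => Kk.
have : K%:Z%:~R <= k%:~R :> R by rewrite ler_int.
rewrite -pmulrn => Kk'.
have : K%:R * gamma <= k%:~R * gamma by rewrite ler_wpM2r// ltW.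
lra.
Qed.

(** Which terms are nonzero depends on [x]; the symmetric partial sums are measurable and, at each
    [x], eventually equal to [persum]. *)
Lemma cmeasurable_persum : cmeasurable_fun setT (persum gamma u).
Proof.
pose S n x := \sum_(j < n + n) u (x + (- n%:Z + j%:Z)%:~R * gamma).
have mS n : cmeasurable_fun setT (S n).
  by apply: cmeasurable_sum => j; exact: cmeasurable_translate.
have SE x : \forall n \near \oo, S n x = persum gamma u x.
  have [N [N1 N2]] := nat_ub ((x - a) / gamma) ((a + K%:R * gamma - x) / gamma).
  rewrite ler_pdivrMr// in N1; rewrite ler_pdivrMr// in N2.
  exists N => // n /= Nn; rewrite (@persumE _ _ _ _ (- n%:Z) (n + n))//.
  have Nn' : N%:R * gamma <= n%:R * gamma by rewrite ler_wpM2r ?(ltW gamma0)// ler_nat.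
  move=> k [kn|nk]; apply: u_supp; apply/negP => /andP[h1 h2].
    have : k%:~R < (- n%:Z)%:~R :> R by rewrite ltr_int.
    rewrite rmorphN /= -(ltr_pM2r gamma0); lra.
  have : n%:Z%:~R <= k%:~R :> R by rewrite ler_int; move: nk; rewrite PoszD addKr.
  rewrite -pmulrn -(ler_pM2r gamma0); lra.
split.
  apply: (@measurable_fun_cvg _ _ _ _ (fun n x => complex.Re (S n x))) => [n|x _].
    by case: (mS n).
  apply: (@cvg_trans _ ((fun=> complex.Re (persum gamma u x)) @ \oo)); last exact: cvg_cst.
  by apply: near_eq_cvg; near=> n; congr complex.Re; apply/esym; near: n; exact: SE.
apply: (@measurable_fun_cvg _ _ _ _ (fun n x => complex.Im (S n x))) => [n|x _].
  by case: (mS n).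
apply: (@cvg_trans _ ((fun=> complex.Im (persum gamma u x)) @ \oo)); last exact: cvg_cst.
by apply: near_eq_cvg; near=> n; congr complex.Im; apply/esym; near: n; exact: SE.
Unshelve. all: by end_near. Qed.

(** [Q] consecutive periods aligned with [a] cover the interval of length alpha starting at [s]; the
    extra gamma pays for the misalignment. *)
Lemma nsq_persum_itv (s alpha : R) (Q : nat) : 0 < alpha -> alpha + gamma <= Q%:R * gamma ->
  (nsq `[0%R, alpha[ (fun y => persum gamma u (y + s)%R) <= Q%:R%:E * nsq I period_sum)%E.
Proof.
move=> al0 alQ.
pose V x : \bar R := (normc (persum gamma u x) ^+ 2)%:E.
have mV : measurable_fun setT V by exact: emeasurable_normc2 cmeasurable_persum.
have V0 x : (0 <= V x)%E by rewrite lee_fin sqr_ge0.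
pose q := Num.floor ((s - a) / gamma).
have /andP[q1 q2] := real_floor_itv (num_real ((s - a) / gamma)).
rewrite -/q in q1 q2; rewrite ler_pdivlMr// in q1; rewrite intrD ltr_pdivrMr// in q2.
have per x (k : int) : V (x + k%:~R * gamma) = V x by rewrite /V persum_shift.
have -> : nsq `[0, alpha[ (fun y => persum gamma u (y + s)%R) =
    (\int[mu]_(x in `[0%R, alpha[) V (x + s)%R)%E by [].
rewrite ge0_integral_translate//.
apply: (@le_trans _ _ (\int[mu]_(x in `[(a + q%:~R * gamma)%R, (a + Q%:R * gamma + q%:~R * gamma)%R[) V x)%E).
  apply: ge0_subset_integral => //; first exact: measurable_funTS.
  move=> x /=; rewrite !in_itv /= => /andP[h1 h2].
  by apply/andP; split; [lra|]; have := gamma0; lra.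
rewrite -ge0_integral_translate//.
under eq_integral do rewrite per.
rewrite ge0_integral_itv_split//.
have -> : nsq I period_sum = (\int[mu]_(x in I) V x)%E.
  by apply: eq_integral => x /set_mem Ix; rewrite /V period_sum_persum.
under eq_bigr => j _.
  under eq_integral do rewrite (per _ j%:Z).
  over.
by rewrite sumr_const card_ord -[X in (X <= _)%E]mule_natl.
Qed.

End Periodization.

(** * Upper and lower bounds in terms of cell energies *)

Section FrameBounds.
Context {R : realType}.
Let mu := @lebesgue_measure R.
Implicit Types (u h : R -> R[i]).

Lemma esum_intZ (k : R) (a : int -> \bar R) : (forall i, 0 <= a i)%E -> 0 <= k ->
  (\esum_(i in [set: int]) (k%:E * a i) = k%:E * \esum_(i in [set: int]) a i)%E.
Proof.
move=> a0 k0; rewrite !esum_int//; last by move=> i; rewrite mule_ge0.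
by rewrite nneseriesZl.
Qed.

Lemma esum_int_shift (a : int -> \bar R) (k : int) :
  (\esum_(i in [set: int]) a (i + k)%R = \esum_(i in [set: int]) a i)%E.
Proof.
rewrite [RHS](@reindex_esum _ _ _ [set: int] [set: int] (fun i => i + k))//.
rewrite setTT_bijective; exists (fun i => i - k) => i; first by rewrite addrK.
by rewrite subrK.
Qed.

Lemma cint_translate F s : cmeasurable_fun setT F ->
  cint setT (fun x => F (x + s)) = cint setT F :> R[i].
Proof.
move=> [F1 F2]; congr (_ +i* _); congr fine.
  have := @integral_translate_preimage R (EFin \o (fun x => complex.Re (F x))) setT s.
  by rewrite preimage_setT; apply => //; exact/measurable_EFinP.
have := @integral_translate_preimage R (EFin \o (fun x => complex.Im (F x))) setT s.
by rewrite preimage_setT; apply => //; exact/measurable_EFinP.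
Qed.

Lemma cintegrable_setT (D : set (measurableTypeR R)) F : measurable D ->
  (forall x, ~ D x -> F x = 0) -> cintegrable D F -> cintegrable setT F.
Proof.
move=> mD F0 [F1 F2].
have restr (f : R -> R) : (forall x, ~ D x -> f x = 0) -> mu.-integrable D (EFin \o f) ->
    mu.-integrable setT (EFin \o f).
  move=> f0 /(integrable_mkcond _ mD) fi.
  apply: (eq_integrable measurableT _ _ _ fi) => x _ /=.
  rewrite /patch; case: ifPn => // /negP xD; rewrite f0// => Dx.
  by apply: xD; exact: mem_set.
by split; apply: restr => // x /F0 ->.
Qed.

Lemma persum_conj (gamma : R) (v : R -> R[i]) x :
  persum gamma (fun y => (v y)^*%C) x = (persum gamma v x)^*%C.
Proof.
rewrite /persum conjc_sum /finite_support !unlock.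
(* Equality of the supports also covers infinite supports, where both sums are 0. *)
suff -> : [set: int] `&` (fun k : int => (v (x + k%:~R * gamma))^*%C) @^-1` [set~ 0] =
    [set: int] `&` (fun k : int => v (x + k%:~R * gamma)) @^-1` [set~ 0] by [].
apply/seteqP; split=> k /= [_ vk]; split=> //; apply: contra_not vk => vk0.
  by rewrite vk0 conjc0.
by rewrite -[LHS]conjcK vk0 conjc0.
Qed.

Variables (alpha beta gamma a b M : R) (g : R -> R[i]) (K : nat).
Hypothesis alpha0 : 0 < alpha.
Hypothesis gamma0 : 0 < gamma.
Hypothesis beta_gamma : beta * gamma = 1.
Hypothesis K0 : (0 < K)%N.
Hypothesis mg : cmeasurable_fun setT g.
Hypothesis g_le : forall x, normc (g x) <= M.
Hypothesis g_supp : forall x, ~~ (a < x < b) -> g x = 0.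
Hypothesis bK : b <= a + K%:R * gamma.

Variable h : R -> R[i].
Hypothesis mh : cmeasurable_fun setT h.
Hypothesis hoo : (nsq setT h < +oo)%E.

Let I : set (measurableTypeR R) := `[a, a + gamma[%classic.
Let mI : measurable I := measurable_period _ _.

(** The product is moved back by [n alpha], so that for every [n] its support lies in (a, b) and one
    period and one [K] serve all rows. *)
Definition window_product (n : int) x := h (x + n%:~R * alpha) * (g x)^*%C.
Local Notation u := window_product.

Lemma cmeasurable_window_product n : cmeasurable_fun setT (u n).
Proof.
by apply: cmeasurableM; [exact: cmeasurable_translate|exact: cmeasurable_conj].
Qed.

Lemma normc_window_product n x : normc (u n x) ^+ 2 <= M ^+ 2 * normc (h (x + n%:~R * alpha)) ^+ 2.
Proof.
rewrite /u Normc.normcM normc_conj exprMn mulrC ler_wpM2r ?sqr_ge0//.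
by rewrite lerXn2r ?nnegrE ?normc_ge0// (le_trans (normc_ge0 (g x))).
Qed.

Lemma nsq_window_product (D : set R) n s : measurable D ->
  (nsq D (fun x => u n (x + s)%R) <=
   (M ^+ 2)%:E * nsq D (fun x => h (x + s + n%:~R * alpha)%R))%E.
Proof.
move=> mD; have mhs : cmeasurable_fun D (fun x => h (x + s + n%:~R * alpha)).
  apply: (@cmeasurableS _ _ setT) => //; under eq_fun do rewrite -addrA.
  exact: cmeasurable_translate.
rewrite /nsq -ge0_integralZl_EFin ?sqr_ge0//.
- under [X in (_ <= X)%E]eq_integral do rewrite -EFinM.
  apply: le_nsq => //.
  + apply: (@cmeasurableS _ _ setT) => //; apply: cmeasurable_translate.
    exact: cmeasurable_window_product.
  + by apply: measurable_funM; [exact: measurable_cst|exact: measurable_normc2].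
  + by move=> x _; exact: normc_window_product.
- by move=> x _; rewrite lee_fin sqr_ge0.
- exact: emeasurable_normc2.
Qed.

Lemma nsq_window_product_lty n : (nsq setT (u n) < +oo)%E.
Proof.
have := @nsq_window_product setT n 0 measurableT.
under eq_fun do rewrite addr0; move/le_lt_trans; apply.
under eq_fun do rewrite addr0.
by rewrite (nsq_translate _ mh) lte_mul_pinfty// lee_fin sqr_ge0.
Qed.

Lemma window_product_supp n x : ~~ (a <= x < a + K%:R * gamma) -> u n x = 0.
Proof.
move=> xN; rewrite /u g_supp ?conjc0 ?mulr0//; apply: contra xN => /andP[/ltW -> xb] /=.
exact: lt_le_trans bK.
Qed.

(** Only the moduli agree: moving by [n alpha] multiplies the integral by a constant of modulus
    1. *)
Lemma normc_inner_gabor m n : normc (inner h (gabor_elt g alpha beta m n)) =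
  normc (cint setT (fun x => u n x * (expmode beta m x)^*%C)).
Proof.
pose F x := h x * (expmode beta m x * g (x - alpha * n%:~R))^*%C.
have mF : cmeasurable_fun setT F.
  apply: cmeasurableM => //; apply: cmeasurable_conj; apply: cmeasurableM.
    exact: cmeasurable_expmode.
  exact: cmeasurable_translate.
have -> : inner h (gabor_elt g alpha beta m n) = cint setT F by [].
rewrite -(cint_translate (n%:~R * alpha) mF).
rewrite (@cint_ext _ _ _ (fun x => (expmode beta m (n%:~R * alpha))^*%C *
    (u n x * (expmode beta m x)^*%C))); last first.
  move=> x _; rewrite /F expmode_add !conjcM /u [alpha * _]mulrC addrK; ring.
rewrite cintZ//.
  by rewrite Normc.normcM normc_conj normc_expmode mul1r.
apply: (@cintegrable_setT `[a, a + K%:R * gamma[) => //.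
  move=> x xN; rewrite window_product_supp ?mul0r//; apply/negP => xD; apply: xN.
  by rewrite /= in_itv.
apply: cintegrable_supported => //; first exact: cmeasurable_window_product.
exact: nsq_window_product_lty.
Qed.

Definition cell_energy n := nsq I (period_sum gamma K (u n)).

Lemma gabor_sumE :
  (\esum_(mn in [set: int * int])
     (normc (inner h (gabor_elt g alpha beta mn.1 mn.2)) ^+ 2)%:E =
   gamma%:E * \esum_(n in [set: int]) cell_energy n)%E.
Proof.
have swap : set_bij [set: int * int] [set: int * int] (fun p => (p.2, p.1)).
  by rewrite setTT_bijective; exists (fun p => (p.2, p.1)) => -[].
rewrite (reindex_esum _ _ _ _ swap) /=.
have -> : [set: int * int] = [set: int] `*`` (fun=> [set: int]) by apply/seteqP; split.
rewrite -(@esum_esum _ _ _ _ _ (fun n m => (normc (inner h (gabor_elt g alpha beta m n)) ^+ 2)%:E)).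
  rewrite -esum_intZ ?(ltW gamma0)//; last by move=> n; exact: nsq_ge0.
  apply: eq_esum => n _.
  rewrite -(parseval_periodization gamma0 beta_gamma K0 (cmeasurable_window_product n)
     (nsq_window_product_lty n) (@window_product_supp n)).
  by apply: eq_esum => m _; rewrite normc_inner_gabor.
by move=> n m _ _; rewrite lee_fin sqr_ge0.
Qed.

(** The period is covered by [p] intervals of length alpha, and the translates of each by alpha Z
    tile the line once. *)
Lemma esum_nsq_shift (p : nat) (s : R) : gamma <= p%:R * alpha ->
  (\esum_(n in [set: int]) nsq I (fun x => h (x + s + n%:~R * alpha)%R) <=
   p%:R%:E * nsq setT h)%E.
Proof.
move=> pa.
pose H (i : nat) (x : R) : \bar R := (normc (h (x + (i%:R * alpha + s))) ^+ 2)%:E.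
have mH i : measurable_fun setT (H i).
  by apply: emeasurable_normc2; exact: cmeasurable_translate.
have H0 i x : (0 <= H i x)%E by rewrite lee_fin sqr_ge0.
apply: (@le_trans _ _ (\esum_(n in [set: int]) \sum_(i < p)
    \int[mu]_(x in `[a, (a + alpha)%R[) H i (x + n%:~R * alpha)%R)%E).
  apply: le_esum => n _.
  have e (i : nat) (x : R) : H 0%N (x + i%:R * alpha + n%:~R * alpha) = H i (x + n%:~R * alpha).
    by rewrite /H; congr ((normc (h _) ^+ 2)%:E); ring.
  pose Hn (x : R) := H 0%N (x + n%:~R * alpha).
  have mHn : measurable_fun setT Hn.
    exact: (measurableT_comp (mH 0%N) (measurable_fun_translate _)).
  have := @ge0_integral_itv_split R Hn a alpha p alpha0 mHn (fun x => H0 0%N _).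
  under [in RHS]eq_bigr => i _.
    under eq_integral do rewrite /Hn e.
    over.
  move=> <-.
  have -> : nsq I (fun x => h (x + s + n%:~R * alpha)%R) = (\int[mu]_(x in I) Hn x)%E.
    by apply: eq_integral => x _; rewrite /Hn /H; congr ((normc (h _) ^+ 2)%:E); ring.
  apply: ge0_subset_integral => //; [exact: measurable_funTS|by move=> x _; exact: H0|].
  move=> x; rewrite /I /= !in_itv /= => /andP[ax xg]; apply/andP; split=> //.
  by apply: (lt_le_trans xg); rewrite lerD2l.
rewrite esum_sum; last by move=> n i _ _; apply: integral_ge0 => x _; exact: H0.
rewrite (eq_bigr (fun=> nsq setT h)).
  by rewrite sumr_const card_ord -[X in (X <= _)%E]mule_natl.
move=> i _; rewrite -ge0_integral_int_partition//.
by rewrite -(nsq_translate (i%:R * alpha + s) mh).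
Qed.

(** One factor [K] comes from the Cauchy-Schwarz inequality, the other from the number of shifts;
    M^2 bounds the window and [p] the overlap. *)
Lemma cell_energy_upper (p : nat) : gamma <= p%:R * alpha ->
  (\esum_(n in [set: int]) cell_energy n <=
   (K%:R * K%:R * M ^+ 2 * p%:R)%:E * nsq setT h)%E.
Proof.
move=> pa.
apply: (@le_trans _ _ (\esum_(n in [set: int]) ((K%:R * M ^+ 2)%:E *
    \sum_(j < K) nsq I (fun x => h (x + j%:R * gamma + n%:~R * alpha)%R)))%E).
  apply: le_esum => n _.
  apply: (le_trans (nsq_sum_le _ _)) => //.
    move=> j; apply: (@cmeasurableS _ _ setT) => //; apply: cmeasurable_translate.
    exact: cmeasurable_window_product.
  rewrite EFinM -muleA lee_wpmul2l ?lee_fin// ge0_sume_distrr.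
    by apply: lee_sum => j _; exact: nsq_window_product.
  by move=> j _; exact: nsq_ge0.
have ge0 n (j : 'I_K) : (0 <= nsq I (fun x => h (x + j%:R * gamma + n%:~R * alpha)%R))%E.
  exact: nsq_ge0.
have KM0 : 0 <= K%:R * M ^+ 2 by apply: mulr_ge0 => //; exact: sqr_ge0.
rewrite esum_intZ//; last by move=> n; apply: sume_ge0.
rewrite esum_sum//.
apply: (@le_trans _ _ ((K%:R * M ^+ 2)%:E * \sum_(j < K) (p%:R%:E * nsq setT h))%E).
  rewrite lee_wpmul2l//.
  by apply: lee_sum => j _; exact: esum_nsq_shift.
rewrite sumr_const card_ord -[X in (_ * X <= _)%E]mule_natl !muleA -!EFinM.
by rewrite (_ : K%:R * M ^+ 2 * K%:R * p%:R = K%:R * K%:R * M ^+ 2 * p%:R) ?lexx//; ring.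
Qed.

Lemma gabor_row_window_product n x :
  gabor_row alpha gamma g (fun y => (h y)^*%C) n x = (persum gamma (u n) (x - n%:~R * alpha))^*%C.
Proof.
rewrite -persum_conj -persum_translate; congr persum; apply/funext => y.
by rewrite /u conjcM conjcK subrK.
Qed.

(** [determined] is used with [eps] the square root of the sum, which bounds each of its rows. A row
    [k] in range satisfies |k - n| <= J because [y] is less than alpha; it has index j = k - n +
    J. *)
Lemma determined_energy (N C y : R) (J : nat) (n : int) : N + alpha <= J%:R * alpha ->
  (forall x, determined alpha gamma g N C x) -> 0 <= y < alpha ->
  normc (h (y + n%:~R * alpha)) ^+ 2 <= C ^+ 2 * \sum_(j < (J + J).+1)
    normc (persum gamma (u (n + (j%:Z - J%:Z))) (y + - ((j%:Z - J%:Z)%:~R * alpha))) ^+ 2.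
Proof.
move=> NJ det /andP[y0 ya]; set S := \sum_(j < _) _.
have S0 : 0 <= S by apply: sumr_ge0 => j _; exact: sqr_ge0.
suff : normc ((h (y + n%:~R * alpha))^*%C) <= C * Num.sqrt S.
  rewrite normc_conj => hS; rewrite -[S]sqr_sqrtr// -exprMn.
  by rewrite lerXn2r ?nnegrE ?normc_ge0// (le_trans _ hS)// normc_ge0.
apply: (det _ (fun z => (h z)^*%C)); first exact: sqrtr_ge0.
move=> k kN; rewrite gabor_row_window_product normc_conj.
have al0 := alpha0.
have kJ : `|k - n| <= J%:Z.
  rewrite -(ler_int R) intr_norm intrB -pmulrn -(ler_pM2r al0).
  rewrite -{1}(gtr0_norm al0) -normrM mulrBl.
  move: kN; rewrite !ler_norml => /andP[k1 k2]; apply/andP; split; lra.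
have jlt : (absz (k - n + J%:Z)%R < (J + J).+1)%N by move: kJ; clear; lia.
have jE : (absz (k - n + J%:Z)%R)%:Z - J%:Z = k - n by move: kJ; clear; lia.
rewrite -[normc _]ger0_norm ?normc_ge0// -sqrtr_sqr ler_wsqrtr// /S.
rewrite (bigD1 (Ordinal jlt))//= jE (_ : n + (k - n) = k); last by rewrite addrC subrK.
rewrite (_ : y + - ((k - n)%:~R * alpha) = y + n%:~R * alpha - k%:~R * alpha); last first.
  by rewrite intrB; ring.
by rewrite lerDl; apply: sumr_ge0 => j _; exact: sqr_ge0.
Qed.

(** The line is cut into cells of length alpha and [determined_energy] is integrated over each. In
    the sum over cells every row occurs 2 J + 1 times, and passing from cells to periods costs
    [Q]. *)
Lemma cell_energy_lower (N C : R) (J Q : nat) : N + alpha <= J%:R * alpha ->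
  alpha + gamma <= Q%:R * gamma -> (forall x, determined alpha gamma g N C x) ->
  (nsq setT h <= (C ^+ 2 * (Q%:R * (J + J).+1%:R))%:E *
     \esum_(n in [set: int]) cell_energy n)%E.
Proof.
move=> NJ alQ det.
pose W (n : int) (j : 'I_(J + J).+1) (y : R) :=
  persum gamma (u (n + (j%:Z - J%:Z))) (y + - ((j%:Z - J%:Z)%:~R * alpha)).
pose D : set (measurableTypeR R) := `[0, alpha[%classic.
have mD : measurable D by exact: measurable_itv.
have mW n j : cmeasurable_fun D (W n j).
  apply: (@cmeasurableS _ _ setT) => //; apply: cmeasurable_translate.
  apply: (cmeasurable_persum gamma0); first exact: cmeasurable_window_product.
  exact: window_product_supp.
have mh2 : measurable_fun setT (fun x => (normc (h x) ^+ 2)%:E) by exact: emeasurable_normc2.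
rewrite {1}/nsq (ge0_integral_int_partition 0 alpha0 mh2); last first.
  by move=> x; rewrite lee_fin sqr_ge0.
rewrite add0r.
apply: (@le_trans _ _ (\esum_(n in [set: int]) ((C ^+ 2 * Q%:R)%:E *
    \sum_(j < (J + J).+1) cell_energy (n + (j%:Z - J%:Z))%R))%E).
  apply: le_esum => n _.
  apply: (@le_trans _ _ (\int[mu]_(y in D)
      (C ^+ 2 * \sum_(j < (J + J).+1) normc (W n j y) ^+ 2)%:E)%E).
    apply: (@le_nsq _ D (fun y => h (y + n%:~R * alpha))) => //.
    - by apply: (@cmeasurableS _ _ setT) => //; exact: cmeasurable_translate.
    - apply: measurable_funM; first exact: measurable_cst.
      by apply: measurable_sum => j; exact: measurable_normc2.
    - by move=> y; rewrite /D /= in_itv /=; move=> yI; exact: (determined_energy n NJ det yI).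
  under eq_integral do rewrite EFinM -sumEFin.
  have W0 j y : (0 <= (normc (W n j y) ^+ 2)%:E)%E by rewrite lee_fin sqr_ge0.
  have mW2 j : measurable_fun D (fun y => (normc (W n j y) ^+ 2)%:E).
    exact: emeasurable_normc2.
  rewrite ge0_integralZl_EFin ?sqr_ge0//; last 2 first.
  - by move=> y _; apply: sume_ge0.
  - exact: emeasurable_sum.
  rewrite ge0_integral_sum// (EFinM (C ^+ 2)) -(muleA (C ^+ 2)%:E) lee_wpmul2l ?lee_fin ?sqr_ge0//.
  rewrite ge0_sume_distrr; last by move=> j _; exact: nsq_ge0.
  apply: lee_sum => j _; apply: nsq_persum_itv => //.
    exact: cmeasurable_window_product.
  exact: window_product_supp.
have E0 n : (0 <= cell_energy n)%E by exact: nsq_ge0.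
have CQ0 : 0 <= C ^+ 2 * Q%:R by apply: mulr_ge0 => //; exact: sqr_ge0.
rewrite esum_intZ//; last by move=> n; apply: sume_ge0.
rewrite esum_sum//.
rewrite (eq_bigr (fun=> \esum_(n in [set: int]) cell_energy n)); last first.
  by move=> j _; exact: (esum_int_shift cell_energy).
by rewrite sumr_const card_ord -[X in (_ * X <= _)%E]mule_natl muleA -EFinM mulrA.
Qed.

End FrameBounds.

(** * The truncated window *)

Section TruncatedWindow.
Context {R : realType}.
Let mu := @lebesgue_measure R.

Lemma normc_analytic_continuous (f : R[i] -> R[i]) (x : R) : analytic_at f x%:C ->
  {for x, continuous (fun y : R => normc (f y%:C))}.
Proof.
move=> fx; apply/cvgrPdist_lt => e e0; have [r r0 fr] := analytic_at_cont fx e0.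
near=> y; apply: (@le_lt_trans _ _ (normc (f y%:C - f x%:C))).
  rewrite distrC ler_norml; apply/andP; split.
    by rewrite lerNl opprB normcB ler_normc_sub.
  exact: ler_normc_sub.
apply: fr; rewrite -rmorphB normc_real.
by near: y; apply/nbhs_ballP; exists r => //= y; rewrite /ball /= distrC.
Unshelve. all: by end_near. Qed.

(** A continuous function exceeding [M] at one point does so on an interval, which no null set
    contains. The matrix estimates need the bound on [g] at every point. *)
Lemma ae_le_continuous (phi : R -> R) (a b M : R) :
  (forall x, a < x < b -> {for x, continuous phi}) ->
  {ae mu, forall x, x \in `]a, b[ -> phi x <= M} ->
  forall x, a < x < b -> phi x <= M.
Proof.
move=> phic [N [mN N0 NM]] x /andP[ax xb]; rewrite leNgt; apply/negP => Mx.
have := phic x; rewrite ax xb => /(_ isT) /cvgrPdist_lt /(_ (phi x - M)).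
rewrite subr_gt0 => /(_ Mx) /nbhs_ballP[r /= r0 rP].
pose s := Num.min r (Num.min (x - a) (b - x)).
have s0 : 0 < s by rewrite !lt_min r0 !subr_gt0 ax xb.
have [sr [sa sb]] : s <= r /\ s <= x - a /\ s <= b - x.
  by rewrite /s !ge_min !lexx !orbT.
have sub : `]x - s, x + s[ `<=` N.
  move=> y /=; rewrite in_itv /= => /andP[y1 y2]; apply: NM => /= phiy.
  have h1 : phi y <= M.
    by apply: phiy; rewrite in_itv /=; clear -y1 y2 sa sb; apply/andP; split; lra.
  have := rP y; rewrite /ball /= => /(_ _)/[!ltr_norml].
  have -> : (- r < x - y) && (x - y < r) by clear -y1 y2 sr; apply/andP; split; lra.
  by move=> /(_ isT)/andP[_ h2]; clear -h1 h2; lra.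
have : (mu `](x - s)%R, (x + s)%R[ <= mu N)%E.
  by apply: le_measure => //; apply: mem_set => //; exact: measurable_itv.
rewrite N0 /mu lebesgue_measure_itv /= lte_fin ifT; last by clear -s0; lra.
by rewrite -EFinB lee_fin; clear -s0; lra.
Qed.

Variables (f : R[i] -> R[i]) (a b : R).
Hypothesis f_an : forall x, a < x < b -> analytic_at f x%:C.
Let g x : R[i] := if x \in `]a, b[ then f x%:C else 0.

Lemma truncationE x : g x = if a < x < b then f x%:C else 0.
Proof. by rewrite /g in_itv. Qed.

Lemma cmeasurable_truncation : cmeasurable_fun `]a, b[ (fun x => f x%:C) -> cmeasurable_fun setT g.
Proof.
have mD : measurable (`]a, b[%classic : set (measurableTypeR R)) by exact: measurable_itv.
move=> [/(measurable_restrictT _ mD) f1 /(measurable_restrictT _ mD) f2]; split.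
  congr (measurable_fun _ _) : f1; apply/funext => x.
  by rewrite /patch /g mem_setE; case: ifP.
congr (measurable_fun _ _) : f2; apply/funext => x.
by rewrite /patch /g mem_setE; case: ifP.
Qed.

Lemma truncation_bounded : Linfty_on `]a, b[ (fun x => f x%:C) ->
  exists2 M, 0 <= M & forall x, normc (g x) <= M.
Proof.
move=> [_ [M fM]]; exists (Num.max 0 M) => [|x]; first by rewrite le_max lexx.
rewrite truncationE; case: ifP => [ab|_]; last by rewrite Normc.normc0 le_max lexx.
rewrite le_max; apply/orP; right; apply: (ae_le_continuous _ fM) ab => y /f_an.
exact: normc_analytic_continuous.
Qed.

Lemma truncation_lower_bound : (forall x, a < x < b -> f x%:C != 0) -> forall c d, a < c -> d < b ->
  exists2 delta, 0 < delta & forall x, c <= x <= d -> delta <= normc (g x).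
Proof.
move=> f0 c d ac db; have [cd|dc] := leP c d; last first.
  by exists 1 => // x /andP[? ?]; lra.
have [x|x xcd xmin] := @EVT_min R (fun y => normc (f y%:C)) c d cd.
  apply: continuous_in_subspaceT => y /set_mem/=; rewrite in_itv /= => /andP[cy yd].
  by apply: normc_analytic_continuous; apply: f_an; lra.
move: xcd; rewrite in_itv /= => /andP[cx xd].
exists (normc (f x%:C)); first by rewrite normc_gt0 f0//; lra.
move=> y /andP[cy yd]; rewrite truncationE ifT; last by lra.
by apply: xmin; rewrite in_itv /= cy.
Qed.

Lemma L2_truncation (M : R) : cmeasurable_fun setT g -> (forall x, normc (g x) <= M) -> L2 g.
Proof.
move=> mg gM; split=> //.
pose D : set (measurableTypeR R) := `]a, b[%classic.
have mD : measurable D by exact: measurable_itv.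
have -> : norm2sq g = nsq D g.
  rewrite /norm2sq /nsq [RHS]integral_mkcond; apply: eq_integral => x _.
  rewrite /patch /g mem_setE; case: ifP => // _.
  by rewrite Normc.normc0 expr0n.
apply: (@le_lt_trans _ _ (\int[mu]_(x in D) (M ^+ 2)%:E)%E).
  apply: le_nsq => //; first exact: (@cmeasurableS _ _ setT).
  move=> x _; rewrite lerXn2r ?nnegrE ?normc_ge0//.
  exact: le_trans (normc_ge0 _) (gM x).
rewrite integral_cst// lte_mul_pinfty ?lee_fin ?sqr_ge0//.
suff : (mu D < +oo)%E by [].
by rewrite /mu /D lebesgue_measure_itv; case: ifP => _; rewrite ?ltry// -EFinB ltry.
Qed.

End TruncatedWindow.

Lemma irrational_incommensurable (R : realType) (alpha gamma : R) : 0 < gamma ->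
  irrational (alpha / gamma) ->
  forall m n : int, m%:~R * alpha = n%:~R * gamma -> m = 0 /\ n = 0.
Proof.
move=> g0 irr m n mn.
have m0 : m = 0.
  apply: contrapT => /eqP m0; apply: irr; apply/rationalP.
  have E : alpha / gamma = n%:~R / m%:~R.
    have m1 : m%:~R != 0 :> R by rewrite intr_eq0.
    by rewrite -[alpha](mulKf m1) mn; field; rewrite m1 gt_eqF.
  (* The denominator of a rational is a natural number here, so for negative [m] the sign goes to
     the numerator. *)
  have [mp|mn'] := leP 0 m.
    by exists n, `|m|%N; rewrite E pmulrn gez0_abs.
  by exists (- n), `|m|%N; rewrite E pmulrn ltz0_abs// !rmorphN /= invrN mulrNN.
split=> //; move: mn; rewrite m0 mul0r => /esym/eqP.
by rewrite mulf_eq0 (gt_eqF g0) orbF intr_eq0 => /eqP.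
Qed.

Theorem theorem1p1 (R : realType) (A : set R[i]) (f : R[i] -> R[i]) (a b : R)
    (A_locfin : locally_finite A)
    (f_analytic : forall z : R[i], ~ A z -> analytic_at f z)
    (ab : a < b)
    (A_ab : forall x : R, x \in `]a, b[ -> ~ A x%:C)
    (f_bounded : Linfty_on `]a, b[ (fun x : R => f x%:C))
    (f_neq0 : forall x : R, x \in `]a, b[ -> f x%:C != 0)
    (f_ess : exists t : R, exists! z : R[i],
        complex.Im z = t /\ essential_singularity f z) :
  forall alpha beta : R, 0 < alpha -> 0 < beta ->
    alpha < b - a -> alpha * beta < 1 -> irrational (alpha * beta) ->
    gabor_frame (fun x : R => if x \in `]a, b[ then f x%:C else 0) alpha beta.
Proof.
move=> alpha beta alpha0 beta0 alpha_ab alpha_beta irr.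
have f_an x : a < x < b -> analytic_at f x%:C.
  by move=> xab; apply: f_analytic; apply: A_ab; rewrite in_itv.
set g := fun x : R => _.
have gE x : g x = if a < x < b then f x%:C else 0 by exact: truncationE.
have mg : cmeasurable_fun setT g by case: f_bounded => + _; exact: cmeasurable_truncation.
have [M M0 gM] := truncation_bounded f_an f_bounded.
have f_neq0' x : a < x < b -> f x%:C != 0 by move=> xab; rewrite f_neq0// in_itv.
have g_ge := truncation_lower_bound f_an f_neq0'.
have g_supp x : ~~ (a < x < b) -> g x = 0 by move=> /negPf xab; rewrite gE xab.
pose gamma := beta^-1.
have gamma0 : 0 < gamma by rewrite invr_gt0.
have beta_gamma : beta * gamma = 1 by rewrite mulfV ?gt_eqF.
have alpha_gamma : alpha < gamma by rewrite -[gamma]mul1r ltr_pdivlMr.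
have incommens : forall m n : int, m%:~R * alpha = n%:~R * gamma -> m = 0 /\ n = 0.
  by apply: irrational_incommensurable => //; rewrite invrK.
have ubound (x y : R) : 0 < y -> exists2 n : nat, (0 < n)%N & x <= n%:R * y.
  move=> y0; have [n [n1 n2]] := nat_ub (x / y) 1.
  exists n; first by rewrite -(ltr_nat R) (lt_le_trans ltr01).
  by rewrite -ler_pdivrMr.
have [K K0 bK] : exists2 K : nat, (0 < K)%N & b <= a + K%:R * gamma.
  by have [K K0 H] := ubound (b - a) _ gamma0; exists K => //; lra.
have [t [z0 [[z0t z0_ess] z0_uniq]]] := f_ess.
have Adf := locally_finite_disc A_locfin.
(* Singularities are isolated because [A] is locally finite, and uniqueness on the line excludes a
   second essential one. *)
have line_merom z : complex.Im z = complex.Im z0 -> z <> z0 -> merom f z.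
  move=> zt zz0; apply: not_essential_merom.
    by apply: filterS (disc_finite_near z Adf) => w; exact: f_analytic.
  by move=> zess; apply: zz0; apply/esym/z0_uniq; rewrite zt.
have [c [d [N0 [C0 [cd N00 C00 W]]]]] := window_exists Adf f_analytic z0_ess line_merom K
  alpha0 alpha_gamma alpha_ab gE gM incommens.
have [|N [C [N1 [C1 det]]]] := window_determined alpha0 alpha_gamma alpha_ab g_supp gM g_ge incommens
  (L := K) _ cd N00 C00 W; first by lra.
have [J _ JN] := ubound (N + alpha) _ alpha0.
have [Q Q0 Qg] := ubound (alpha + gamma) _ gamma0.
have [p _ pa] := ubound gamma _ alpha0.
split; first exact: L2_truncation mg gM.
(* Adding 1 keeps both constants positive even if [C] or [M] is 0. *)
pose B1 := C ^+ 2 * (Q%:R * (J + J).+1%:R) + 1.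
pose B2 := K%:R * K%:R * M ^+ 2 * p%:R + 1.
have C20 : 0 <= C ^+ 2 * (Q%:R * (J + J).+1%:R).
  by rewrite mulr_ge0 ?sqr_ge0// mulr_ge0.
have M20 : 0 <= K%:R * K%:R * M ^+ 2 * p%:R :> R.
  by apply: mulr_ge0 => //; apply: mulr_ge0; [exact: mulr_ge0|exact: sqr_ge0].
have B10 : 0 < B1 by rewrite /B1; lra.
have B20 : 0 < B2 by rewrite /B2; lra.
exists (gamma / B1), (gamma * B2); split; [exact: divr_gt0|exact: mulr_gt0|].
move=> h [mh hoo] S; rewrite -[norm2sq h]/(nsq setT h).
have -> : S = _ := gabor_sumE alpha gamma0 beta_gamma K0 mg gM g_supp bK mh hoo.
set E := (\esum_(n in _) _)%E.
have E0 : (0 <= E)%E by apply: esum_ge0 => n _; exact: nsq_ge0.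
have h0 : (0 <= nsq setT h)%E by exact: nsq_ge0.
split.
  rewrite EFinM -muleA lee_wpmul2l ?lee_fin ?(ltW gamma0)//.
  rewrite muleC lee_pdivrMr//.
  apply: (le_trans (cell_energy_lower alpha0 gamma0 mg g_supp bK mh JN Qg det)).
  by rewrite muleC lee_wpmul2l// lee_fin /B1; lra.
rewrite EFinM -muleA lee_wpmul2l ?lee_fin ?(ltW gamma0)//.
apply: (le_trans (cell_energy_upper a K alpha0 mg gM mh pa)).
by rewrite lee_wpmul2r// lee_fin /B2; lra.
Qed.
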